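(* For $3\le g<\infty$ let $(X_g,\omega_g)$ be the Arnoux--Yoccoz surface of genus $g$, let $(X_\infty,\omega_\infty)$ be the limit surface of infinite genus, and let $\iota_g:U_g\to X_g$ be the canonical piecewise-affine embedding of the open dense subset $U_g\subset X_\infty$, all as constructed in the context. Then the metrics $\iota_g^*|\omega_g|$ converge to $|\omega_\infty|$ uniformly on compact subsets of $X_\infty$ as $g\to\infty$.
   Context: A translation surface is a pair $(X,\omega)$ with $X$ a Riemann surface and $\omega\ne0$ a holomorphic 1-form; $|\omega|$ denotes the flat metric induced on $X$ by $\omega$. **The surface $(X_g,\omega_g)$, $g\ge3$.** Let $\alpha$ be the unique positive root of $x^g+x^{g-1}+\cdots+x-1$. In $\mathbb{R}^2=\mathbb{C}$ put $P_0=\left(\frac{1-\alpha^g}{2},\frac{\alpha^2}{1-\alpha}\right)$, $Q_0=\left(-\frac{\alpha^g}{2},\alpha\right)$, $P_1=\left(-\frac{\alpha^{g-1}+\alpha^g}{2},\frac{\alpha-\alpha^2+\alpha^3}{1-\alpha}\right)$, $P_g=\left(1+\frac{\alpha-\alpha^g}{2},\frac{3\alpha-1-\alpha^2}{1-\alpha}\right)$, $P_i=\left(\frac{\alpha-\alpha^i}{1-\alpha},\frac{\alpha}{1-\alpha}\right)$ for $2\le i\le g-1$, $Q_i=\left(\frac{2\alpha-\alpha^i-\alpha^{i+1}}{2(1-\alpha)},\frac{\alpha-\alpha^{g-i+2}}{1-\alpha}\right)$ for $1\le i\le g$. For $1\le i\le g$ let $T_i$ be the triangle $P_0Q_iQ_{i-1}$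 and $T_{g+i}$ the triangle $P_iQ_{i-1}Q_i$. A prime denotes reflection in the horizontal axis. Glue the $T_i$ ($1\le i\le 2g$) along their common edges, and likewise the $T'_i$; then glue the remaining edges in pairs by translations: $P_0Q_0$ with $P'_0Q'_g$ and $P'_0Q'_0$ with $P_0Q_g$; $P_1Q_1$ with $P'_gQ'_{g-1}$ and $P'_1Q'_1$ with $P_gQ_{g-1}$; $P_1Q_0$ with $P_{g-1}Q_{g-1}$ and $P'_1Q'_0$ with $P'_{g-1}Q'_{g-1}$; $P_gQ_g$ with $Q_1P_2$ and $P'_gQ'_g$ with $Q'_1P'_2$; and for $2\le i\le g-2$, $P_iQ_i$ with $Q'_iP'_{i+1}$ and $P'_iQ'_i$ with $Q_iP_{i+1}$. The form $\omega_g$ is induced by $\mathrm{d}z$; $X_g$ is compact of genus $g$ and $\omega_g$ has two zeroes. Exchanging each $T_i$ with $T_i'$ by reflection induces an isometric involution $\rho_g$ of $X_g$. **The surface $(X_\infty,\omega_\infty)$.** Let $D=D^+\cup D^-$ with $D^+=[0,1]\times[\frac12,1]$ and $D^-=[-\frac12,\frac12]\times[0,\frac12]$. For $n\ge 1$ put $s_n=\sum_{0\le j<n/2}2^{-(n-2j)}$. Identify the following open edges of $D$ in pairs by translations: (i) $(x,\frac12)\sim(x+1,\frac12)$ for $-\frac12<x<0$; (ii) for $n\ge1$: $(x,1)\sim(x-\frac12+2^{-n-1},0)$ for $1-2^{1-n}<x<1-3\cdot2^{-n-1}$ (edge $C'_n$), and $(x,1)\sim(x-\frac12-2^{-n-1},0)$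 for $1-3\cdot2^{-n-1}<x<1-2^{-n}$ (edge $C''_n$); (iii) for $n\ge1$: $(1,y)\sim(e,y-s_n)$ for $1-2^{-n}<y<1-2^{-n-1}$ (edge $A_n$), where $e=-\frac12$ if $n$ is odd and $e=0$ if $n$ is even; (iv) for $n\ge1$: $(\frac12,y)\sim(e',y+s_n)$ for $2^{-n-1}<y<2^{-n}$ (edge $B_n$), where $e'=0$ if $n$ is odd and $e'=-\frac12$ if $n$ is even. All boundary points of $D$ not on one of these open edges are removed, as is the endpoint $(\frac12,\frac12)$. The quotient is $X_\infty$, and $\omega_\infty$ is induced by $\mathrm{d}z$. **The sets $U_g$.** Write $M=\lfloor g/2\rfloor$, $N=\lfloor (g-1)/2\rfloor$. $U_g\subset X_\infty$ is the surface obtained from $D$ by making only the identifications (i), those of $A_n,B_n$ for $n\le M$, and those of $C'_n,C''_n$ for $n\le N$ (the other boundary edges being omitted). It is open and dense, $U_g\subset U_{g+1}$, and every compact subset of $X_\infty$ lies in some $U_g$; so $\iota_g^*|\omega_g|$ is defined on a given compact set for all large $g$. **The embeddings $\iota_g$.** Step 1 (domain). Retract the union of the two triangles with vertices $(\frac12,\frac12),(1,1-2^{-M-1}),(1,1)$ and $(\frac12,\frac12),(1,1),(1-2^{-N},1)$ onto the triangle with vertices $(\frac12,\frac12),(1,1-2^{-M-1}),(1-2^{-N},1)$ by a homeomorphism that is affine on each of the two triangles and fixes the vertices other than $(1,1)$, and fix the rest of $D^+$. This turns $D^+$ into a polygon $D_g^+$ whose vertices are $(\frac12,\frac12)$, $(1,\frac12)$,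 $(0,\frac12)$ and the endpoints of all the edges $A_n,B_n$ ($n\le M$), $C'_n,C''_n$ ($n\le N$) lying on its boundary; it has one ''free'' edge at the cut corner and one free edge on the side $x=0$. Step 2 (target). Cut $T_{2g-M+1},\dots,T_{2g}$ and their mirror images off $X_g$'s triangulated picture and reglue them along their longest edges: let $\Pi_g$ be the polygon formed from $T_1,\dots,T_{2g-M}$ by attaching $T'_{2g}$ along $P_1Q_1$ and, successively for $k=2,\dots,M$, attaching $T_{2g-k+1}$ ($k$ even) or $T'_{2g-k+1}$ ($k$ odd) along its edge $P_{g-k+1}Q_{g-k+1}$ (resp. $P'_{g-k+1}Q'_{g-k+1}$), placed on $P_1Q_0$ if $k=2$ and on the edge of the previously attached triangle to which it is glued in $X_g$ if $k>2$. Then $\Pi_g$ and its mirror image $\Pi_g'$ give $X_g$ after gluing edges. Step 3. $D_g^+$ and $\Pi_g$ have the same number of vertices; match them in cyclic order with $(\frac12,\frac12)\mapsto P_0$ (so $(1,\frac12)\mapsto Q_g$, $(0,\frac12)\mapsto Q_0$). On the image of $D^+$ in $U_g$, $\iota_g$ is the retraction of Step 1 followed by the piecewise-affine map $D_g^+\to\Pi_g$ realizing this matching, affine on each triangle spanned by $(\frac12,\frac12)$ and a boundary edge. On the image of $D^-$, $\iota_g$ is $\rho_g\circ\iota_g\circ\tau^{-1}$, where $\tau(x,y)=(x-\frac12,1-y)$ maps $D^+$ onto $D^-$. These maps respect the identifications defining $U_g$, and give an embedding $\iota_g:U_g\to X_g$. *)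

(* Defs.v *)
From HB Require Import structures.
From Stdlib Require Import Relation_Operators.
From mathcomp Require Import all_boot all_order all_algebra.
From mathcomp Require Import all_classical all_reals all_analysis.

Set Implicit Arguments.
Unset Strict Implicit.
Unset Printing Implicit Defensive.

Import Order.TTheory GRing.Theory Num.Theory.
Import numFieldNormedType.Exports.

Local Open Scope classical_set_scope.
Local Open Scope ring_scope.
Local Open Scope quotient_scope.

(* The library norm on R * R is the max norm. *)
Definition enorm {R : realType} (v : R * R) : R :=
  Num.sqrt (v.1 ^+ 2 + v.2 ^+ 2).

Definition segment {R : realType} (A B : R * R) : set (R * R) :=
  [set p | exists2 t : R, 0 <= t <= 1 & p = (1 - t) *: A + t *: B].

Definition triangle {R : realType} (A B C : R * R) : set (R * R) :=
  [set p | exists x y z : R, [/\ 0 <= x, 0 <= y, 0 <= z, x + y + z = 1 &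
     p = x *: A + y *: B + z *: C]].

Definition mirror {R : realType} (b : bool) (p : R * R) : R * R :=
  if b then (p.1, - p.2) else p.

(* Translation surfaces presented by planar regions glued by translations.
   The form is dz on every region, so the |omega|-length of a straight segment
   contained in a region is its Euclidean length. *)

Record patchwork (R : realType) := Patchwork {
  piece : choiceType;
  region : piece -> set (R * R);
  glued : piece -> R * R -> piece -> R * R -> Prop;
  base : {i : piece & region i} }.

Arguments region {R} S i : rename.
Arguments glued {R S} i p j q : rename.

Section Surface.
Context {R : realType} (S : patchwork R).

Definition points : Type := {i : piece S & region S i}.
HB.instance Definition _ := Topological.on points.

Definition glue_step (x y : points) : Prop :=
  glued (projT1 x) (val (projT2 x)) (projT1 y) (val (projT2 y)).

Definition identified : rel points :=
  fun x y => `[< clos_refl_sym_trans points glue_step x y >].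

Lemma identified_refl : reflexive identified.
Proof. by move=> x; apply/asboolP; exact: rst_refl. Qed.

Lemma identified_sym : symmetric identified.
Proof.
by move=> x y; apply/asboolP/asboolP => h; exact: rst_sym.
Qed.

Lemma identified_trans : transitive identified.
Proof.
by move=> y x z /asboolP xy /asboolP yz; apply/asboolP; exact: rst_trans yz.
Qed.

Canonical identified_equiv :=
  EquivRel identified identified_refl identified_sym identified_trans.

Definition surface := quotient_topology {eq_quot identified_equiv}.

Definition surface_base : surface := \pi_surface (base S : points).

(* The class of the point q of the piece i; junk when q is not in region i. *)
Definition to_surface (i : piece S) (q : R * R) : surface :=
  if (insub q : option (region S i)) is Some u then \pi_surface (existT _ i u : points)
  else surface_base.

(* broken_path x y l: some path from x to y consists of finitely many straight
   segments, each contained in one region, and has |omega|-length l. *)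
Inductive broken_path : surface -> surface -> R -> Prop :=
| broken_nil x : broken_path x x 0
| broken_cons i p q y l : segment p q `<=` region S i ->
    broken_path (to_surface i q) y l ->
    broken_path (to_surface i p) y (enorm (q - p) + l).

(* The flat metric |omega| as a distance: broken geodesics suffice to compute
   the infimum of lengths of paths.  The surfaces below are connected, so the
   infimum is over a nonempty set. *)
Definition flat_dist (x y : surface) : R :=
  inf [set l | broken_path x y l].

End Surface.

(* Metrics are compared as distance functions.  Comparing the length elements
   pointwise would not do: near the diagonal of D^+ the differentials of the
   embeddings iota_g stay away from isometries as g grows, although iota_g is
   uniformly close to a local isometry. *)
Definition pullback_dist {R : realType} {S : Type} {T : patchwork R}
    (f : S -> surface T) (x y : S) : R :=
  flat_dist (f x) (f y).

Section ArnouxYoccoz.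
Context (R : realType) (g : nat).

(* The positive root is unique. *)
Definition alpha : R :=
  xget 0 [set x | 0 < x /\ \sum_(1 <= i < g.+1) x ^+ i - 1 = 0].

Local Notation a := alpha.

Definition P (i : nat) : R * R :=
  if i == 0%N then ((1 - a ^+ g) / 2, a ^+ 2 / (1 - a))
  else if i == 1%N then
    (- ((a ^+ g.-1 + a ^+ g) / 2), (a - a ^+ 2 + a ^+ 3) / (1 - a))
  else if i == g then
    (1 + (a - a ^+ g) / 2, (3 * a - 1 - a ^+ 2) / (1 - a))
  else ((a - a ^+ i) / (1 - a), a / (1 - a)).

Definition Q (i : nat) : R * R :=
  if i == 0%N then (- (a ^+ g / 2), a)
  else ((2 * a - a ^+ i - a ^+ i.+1) / (2 * (1 - a)),
        (a - a ^+ (g - i + 2)) / (1 - a)).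

(* The piece (i, false) is T_i and (i, true) is its mirror image T'_i. *)
Definition T (c : nat * bool) : set (R * R) :=
  let m := mirror c.2 in
  if (1 <= c.1 <= g)%N then
    triangle (m (P 0)) (m (Q c.1)) (m (Q c.1.-1))
  else if (g < c.1 <= 2 * g)%N then
    let i := (c.1 - g)%N in triangle (m (P i)) (m (Q i.-1)) (m (Q i))
  else set0.

(* glued_edges c A B d C D: the edge AB of the triangle c is glued to the edge
   CD of the triangle d. *)
Inductive glued_edges :
  nat * bool -> R * R -> R * R -> nat * bool -> R * R -> R * R -> Prop :=
| glue_spoke b i : (1 <= i < g)%N ->
    glued_edges (i, b) (mirror b (P 0)) (mirror b (Q i))
                (i.+1, b) (mirror b (P 0)) (mirror b (Q i))
| glue_rim b i : (1 <= i <= g)%N ->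
    glued_edges (i, b) (mirror b (Q i.-1)) (mirror b (Q i))
                ((g + i)%N, b) (mirror b (Q i.-1)) (mirror b (Q i))
| glue_P0Q0 b :
    glued_edges (1%N, b) (mirror b (P 0)) (mirror b (Q 0))
                (g, ~~ b) (mirror (~~ b) (P 0)) (mirror (~~ b) (Q g))
| glue_P1Q1 b :
    glued_edges (g.+1, b) (mirror b (P 1)) (mirror b (Q 1))
      ((2 * g)%N, ~~ b) (mirror (~~ b) (P g)) (mirror (~~ b) (Q g.-1))
| glue_P1Q0 b :
    glued_edges (g.+1, b) (mirror b (P 1)) (mirror b (Q 0))
      ((2 * g).-1, b) (mirror b (P g.-1)) (mirror b (Q g.-1))
| glue_PgQg b :
    glued_edges ((2 * g)%N, b) (mirror b (P g)) (mirror b (Q g))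
                (g.+2, b) (mirror b (Q 1)) (mirror b (P 2))
| glue_PiQi b i : (2 <= i <= g - 2)%N ->
    glued_edges ((g + i)%N, b) (mirror b (P i)) (mirror b (Q i))
      ((g + i).+1, ~~ b) (mirror (~~ b) (Q i)) (mirror (~~ b) (P i.+1)).

(* The translation carries the segment AB onto the segment CD, the endpoints
   corresponding in either order. *)
Definition by_translation (A B C D p q : R * R) : Prop :=
  segment A B p /\ exists t, q = p + t /\
    ((C = A + t /\ D = B + t) \/ (C = B + t /\ D = A + t)).

Definition glued_T (c : nat * bool) (p : R * R) (d : nat * bool) (q : R * R) :=
  exists A B C D, glued_edges c A B d C D /\ by_translation A B C D p q.

Hypothesis g_ge3 : (3 <= g)%N.

Lemma P0_in_T1 : P 0 \in T (1%N, false).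
Proof.
rewrite inE /T /= (leq_trans _ g_ge3) //; exists 1, 0, 0; split => //.
  by rewrite !addr0.
by rewrite scale1r !scale0r !addr0.
Qed.

Definition AY_patchwork : patchwork R :=
  @Patchwork R (nat * bool)%type T glued_T
    (existT _ (1%N, false) (exist _ (P 0) P0_in_T1)).

Definition X : Type := surface AY_patchwork.

Definition rho (x : X) : X :=
  let z := repr (x : surface AY_patchwork) in
  let c := projT1 z in
  @to_surface R AY_patchwork (c.1, ~~ c.2) (mirror true (val (projT2 z))).

End ArnouxYoccoz.

Arguments X R {g} g_ge3.

Section Limit.
Context (R : realType).

Definition Dplus : set (R * R) :=
  [set p | 0 <= p.1 <= 1 /\ 2^-1 <= p.2 <= 1].
Definition Dminus : set (R * R) :=
  [set p | - 2^-1 <= p.1 <= 2^-1 /\ 0 <= p.2 <= 2^-1].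

Definition s (n : nat) : R := \sum_(0 <= j < n | (2 * j < n)%N) 2 ^- (n - 2 * j).

(* The pairs of identified edges: (i), C'_n, C''_n, A_n and B_n. *)
Inductive edge := EdgeI | EdgeC' of nat | EdgeC'' of nat
  | EdgeA of nat | EdgeB of nat.

Definition edge_index (e : edge) : nat :=
  match e with
  | EdgeI => 1
  | EdgeC' n | EdgeC'' n | EdgeA n | EdgeB n => n
  end.

Definition edge_source (e : edge) : set (R * R) :=
  match e with
  | EdgeI => [set p | - 2^-1 < p.1 < 0 /\ p.2 = 2^-1]
  | EdgeC' n => [set p | 1 - 2 * 2 ^- n < p.1 < 1 - 3 * 2 ^- n.+1 /\ p.2 = 1]
  | EdgeC'' n => [set p | 1 - 3 * 2 ^- n.+1 < p.1 < 1 - 2 ^- n /\ p.2 = 1]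
  | EdgeA n => [set p | p.1 = 1 /\ 1 - 2 ^- n < p.2 < 1 - 2 ^- n.+1]
  | EdgeB n => [set p | p.1 = 2^-1 /\ 2 ^- n.+1 < p.2 < 2 ^- n]
  end.

Definition edge_image (e : edge) (p : R * R) : R * R :=
  match e with
  | EdgeI => (p.1 + 1, 2^-1)
  | EdgeC' n => (p.1 - 2^-1 + 2 ^- n.+1, 0)
  | EdgeC'' n => (p.1 - 2^-1 - 2 ^- n.+1, 0)
  | EdgeA n => (if odd n then - 2^-1 else 0, p.2 - s n)
  | EdgeB n => (if odd n then 0 else - 2^-1, p.2 + s n)
  end.

(* The interior of D together with both copies of the given open edges. *)
Definition D_with (E : set edge) : set (R * R) :=
  (Dplus `|` Dminus)° `|`
  \bigcup_(e in E) (edge_source e `|` edge_image e @` edge_source e).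

Definition edges : set edge := [set e | (1 <= edge_index e)%N].

Definition Doo : set (R * R) := D_with edges.

Definition glued_D (_ : unit) (p : R * R) (_ : unit) (q : R * R) : Prop :=
  exists e, [/\ edges e, edge_source e p & q = edge_image e p].

Definition Doo_point : R * R := (- (2 * 2)^-1, 2^-1).

Lemma Doo_pointP : Doo_point \in Doo.
Proof.
rewrite inE; right; exists EdgeI => //; left; split => //=.
rewrite ltrN2 oppr_lt0 invr_gt0 mulr_gt0 // andbT invfM.
by rewrite gtr_pMl ?invr_gt0 // invf_lt1 // ltr1n.
Qed.

Definition oo_patchwork : patchwork R :=
  @Patchwork R unit (fun=> Doo) glued_D
    (existT _ tt (exist _ Doo_point Doo_pointP)).

Definition Xoo := surface oo_patchwork.

Definition M (g : nat) : nat := g./2.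
Definition N (g : nat) : nat := g.-1./2.

Definition kept_edges (g : nat) : set edge :=
  [set e | (1 <= edge_index e)%N /\
     match e with
     | EdgeI => True
     | EdgeC' n | EdgeC'' n => (n <= N g)%N
     | EdgeA n | EdgeB n => (n <= M g)%N
     end].

Definition U (g : nat) : set Xoo :=
  @to_surface R oo_patchwork tt @` D_with (kept_edges g).

End Limit.

Section Embedding.
Context {R : realType} (g : nat).

Local Notation P := (@P R g).
Local Notation Q := (@Q R g).
Local Notation M := (M g).
Local Notation N := (N g).

(* The piecewise-affine map sending each triangle c d_j d_(j+1) affinely onto
   the triangle c' e_j e_(j+1), where vs lists the pairs (d_j, e_j); the identity
   outside these triangles.  In both uses below the triangles meet only along
   common sides, so the value is unique. *)
Definition fan_map (c c' : R * R) (vs : seq ((R * R) * (R * R))) (p : R * R) :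
    R * R :=
  xget p [set q | exists (j : nat) (x y z : R),
    let v := nth (0, 0) vs j in let w := nth (0, 0) vs j.+1 in
    [/\ (j.+1 < size vs)%N, [/\ 0 <= x, 0 <= y & 0 <= z], x + y + z = 1,
        p = x *: c + y *: v.1 + z *: w.1 & q = x *: c' + y *: v.2 + z *: w.2]].

Definition center : R * R := (2^-1, 2^-1).

(* The retraction of D^+ onto D_g^+.  The point (1, 1) goes to a point of the
   open segment between the two neighbouring vertices, at parameter lam: being
   an affine homeomorphism onto the cut triangle forces nothing more. *)
Definition retraction (lam : R) : R * R -> R * R :=
  let v : R * R := (1, 1 - 2 ^- M.+1) in
  let w : R * R := (1 - 2 ^- N, 1) in
  fan_map center center
    [:: (v, v); ((1, 1), (1 - lam) *: v + lam *: w); (w, w)].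

(* The translation placing the k-th attached triangle in Pi_g.  For k = 1 it
   takes Q'_(g-1) to P_1 and P'_g to Q_1, for k = 2 it takes P_(g-1) to P_1 and
   Q_(g-1) to Q_0; for k > 2, with i = g - k + 1, it takes the edge P_i Q_i of
   the k-th triangle to the edge Q_i P_(i+1) of the (k-1)-st one (primes
   alternating with the parity of k). *)
Fixpoint attach_shift (k : nat) : R * R :=
  match k with
  | 0 => 0
  | k'.+1 =>
    match k' with
    | 0 => P 1 - mirror true (Q g.-1)
    | 1 => P 1 - P g.-1
    | _ => attach_shift k' + mirror (~~ odd k) (Q (g - k')) - mirror (odd k) (P (g - k'))
    end
  end.

(* placed c t: the polygon Pi_g contains the translate T_c + t. *)
Definition placed (c : nat * bool) (t : R * R) : Prop :=
  (exists i : nat, [/\ (1 <= i <= 2 * g - M)%N, c = (i, false) & t = 0]) \/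
  (exists k : nat, [/\ (1 <= k <= M)%N, c = ((2 * g - k).+1, odd k) &
     t = attach_shift k]).

(* The vertex of the k-th attached triangle off the edge it is attached along *)
Definition new_vertex (k : nat) : R * R :=
  attach_shift k + (if k == 1%N then mirror true (Q g) else mirror (odd k) (Q (g - k))).

(* The vertices of D_g^+ other than (1/2, 1/2), paired with those of Pi_g other
   than P_0, both counterclockwise: up the side x = 1, along the top, then down
   the side x = 0. *)
Definition matching : seq ((R * R) * (R * R)) :=
  [seq ((1, 1 - 2 ^- n.+1), Q (g - n)) | n <- iota 0 M.+1]
  ++ [:: ((1 - 2 ^- N, 1), P N.+1)]
  ++ flatten [seq [:: ((1 - 3 * 2 ^- n.+1, 1), Q n);
                      ((1 - 2 * 2 ^- n, 1), if n == 1%N then new_vertex 1 else P n)]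
             | n <- rev (iota 1 N)]
  ++ [seq ((0, 2 ^- k.+1 + s R k), if k == 1%N then P 1 else new_vertex k)
     | k <- iota 1 M & odd k]
  ++ [seq ((0, 1 - 2 ^- k.+1 - s R k), new_vertex k)
     | k <- rev (iota 1 M) & ~~ odd k]
  ++ [:: ((0, 2^-1), Q 0)].

Definition Dplus_to_Pi (lam : R) (p : R * R) : R * R :=
  fan_map center (P 0) matching (retraction lam p).

Context (g_ge3 : (3 <= g)%N).

(* A point on a common edge of placed triangles has the same class in all. *)
Definition Pi_to_X (q : R * R) : X R g_ge3 :=
  xget (surface_base _) [set y | exists c t,
    [/\ placed c t, T g c (q - t) &
        y = @to_surface R (AY_patchwork R g_ge3) c (q - t)]].

Definition tau_inv (p : R * R) : R * R := (p.1 + 2^-1, 1 - p.2).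

(* Only the values on U g matter; there they do not depend on the chosen
   representative in D. *)
Definition iota_g (lam : R) (x : Xoo R) : X R g_ge3 :=
  let p := val (projT2 (repr x)) in
  if p \in @Dplus R then Pi_to_X (Dplus_to_Pi lam p)
  else rho (Pi_to_X (Dplus_to_Pi lam (tau_inv p))).

End Embedding.

(* Main.v *)
(* Both surfaces consist of two copies, indexed by a boolean, of a plane piece whose
   boundary edges are glued in pairs: the upper square D^+ for X_oo and the polygon
   Pi_g for X_g, the other copy being carried by tau, respectively rho_g. Every vertex
   of Pi_g is O(alpha^M)-close to the vertex of the square matched with it, so iota_g
   moves each point of the square by O(alpha^M).

   Upper bound. Within one copy of Pi_g the distance is at most the Euclidean one plus
   O(alpha^M): a segment that leaves Pi_g is rerouted through common edges of triangles.
   Hence the image of a given broken geodesic of X_oo is almost as long as it, and X_oo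
   being covered by finitely many cells of small diameter, finitely many geodesics give
   a uniform bound.

   Lower bound. The distance to a point x of X_oo is 1-Lipschitz on each copy of the
   square, agrees on glued points, and takes one value at all endpoints of the edges,
   for these converge to a single point of the completion. Flatten it near that value,
   prescribe it in the core of each copy and along the edges of Pi_g, and extend it by
   McShane's formula: this gives a function on X_g with Lipschitz constant close to 1.
   The pair of edges of Pi_g without counterpart in X_oo lies where it is constant. *)
From HB Require Import structures.
From Stdlib Require Import Relation_Operators.
From mathcomp Require Import all_boot all_order all_algebra.
From mathcomp Require Import all_classical all_reals all_analysis.
From mathcomp Require Import ring lra zify.
Require Import Defs.

Set Implicit Arguments.
Unset Strict Implicit.
Unset Printing Implicit Defensive.

Import Order.TTheory GRing.Theory Num.Theory.
Import numFieldNormedType.Exports.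

Local Open Scope classical_set_scope.
Local Open Scope ring_scope.
Local Open Scope quotient_scope.

(** Everything rests on alpha^(g+1) = 2 alpha - 1, the defining equation multiplied by 1 - alpha. It
    makes alpha - 1/2 exponentially small and turns the vertex coordinates of Pi_g into
    perturbations of dyadic numbers.

    The obstacle is that all errors are additive: iota_g displaces points by O(alpha^M), the edges
    of index near M are themselves about that short, and Pi_g is not convex. No estimate on the
    small edges can be multiplicative. For the upper bound this is harmless, because a fixed broken
    path crosses finitely many edges, all of which have counterparts in Pi_g once g is large. For
    the lower bound a path of X_g may cross small edges arbitrarily often, so paths are not compared
    at all and a test function is built instead. It is constant up to a distance 2s from the
    vertices, with s fixed before g. Edges of length at most 4s are then invisible, and for points
    at mutual distance at least s a displacement by O(alpha^M) costs only a factor 1 + O(alpha^M /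
    s) in the Lipschitz constant. *)

(** * The Euclidean norm on the plane *)

Section Plane.
Context {R : realType}.
Implicit Types (p q r u v w A B C : R * R) (x y z t : R).

Lemma pairP p q : p.1 = q.1 -> p.2 = q.2 -> p = q.
Proof. by case: p q => ? ? [? ?] /= -> ->. Qed.

Lemma scaleE x p : x *: p = (x * p.1, x * p.2). Proof. by []. Qed.
Lemma addE p q : p + q = (p.1 + q.1, p.2 + q.2). Proof. by []. Qed.
Lemma oppE p : - p = (- p.1, - p.2). Proof. by []. Qed.

Definition planeE := (scaleE, addE, oppE).

Lemma enorm_ge0 v : 0 <= enorm v. Proof. exact: sqrtr_ge0. Qed.

Lemma enorm_sqr v : enorm v ^+ 2 = v.1 ^+ 2 + v.2 ^+ 2.
Proof. by rewrite sqr_sqrtr // addr_ge0 ?sqr_ge0. Qed.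

Lemma enorm0 : enorm (0 : R * R) = 0.
Proof. by rewrite /enorm /= expr0n /= addr0 sqrtr0. Qed.

Lemma enorm_le v x : 0 <= x -> v.1 ^+ 2 + v.2 ^+ 2 <= x ^+ 2 -> enorm v <= x.
Proof. by move=> x0 h; rewrite -(ler_pXn2r (n:=2)) ?nnegrE ?enorm_ge0// enorm_sqr. Qed.

Lemma le_enorm v x : x ^+ 2 <= v.1 ^+ 2 + v.2 ^+ 2 -> x <= enorm v.
Proof.
move=> h; have [x0|x0] := leP x 0; first exact: le_trans x0 (enorm_ge0 _).
by rewrite -(ler_pXn2r (n:=2)) ?nnegrE ?enorm_ge0 ?enorm_sqr// ltW.
Qed.

Lemma enormZ x v : enorm (x *: v) = `|x| * enorm v.
Proof.
by rewrite /enorm scaleE /= !exprMn -mulrDr sqrtrM ?sqr_ge0// sqrtr_sqr.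
Qed.

Lemma enormN v : enorm (- v) = enorm v.
Proof. by rewrite /enorm oppE /= !sqrrN. Qed.

Lemma enormC p q : enorm (p - q) = enorm (q - p).
Proof. by rewrite -enormN opprB. Qed.

Lemma ler_enorm1 v : `|v.1| <= enorm v.
Proof. by apply: le_enorm; rewrite -normrX ger0_norm ?sqr_ge0// lerDl sqr_ge0. Qed.

Lemma ler_enorm2 v : `|v.2| <= enorm v.
Proof. by apply: le_enorm; rewrite -normrX ger0_norm ?sqr_ge0// lerDr sqr_ge0. Qed.

Lemma enorm_le12 v : enorm v <= `|v.1| + `|v.2|.
Proof.
apply: enorm_le; first by rewrite addr_ge0.
rewrite sqrrD !real_normK ?num_real//.
have : 0 <= `|v.1| * `|v.2| by rewrite mulr_ge0.
by move: (v.1 ^+ 2) (v.2 ^+ 2) (_ * _) => ? ? ? ?; lra.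
Qed.

Lemma enormD u v : enorm (u + v) <= enorm u + enorm v.
Proof.
apply: enorm_le; first by rewrite addr_ge0 ?enorm_ge0.
rewrite [leRHS]sqrrD !enorm_sqr addE /=.
suff : u.1 * v.1 + u.2 * v.2 <= enorm u * enorm v by nra.
have [h|h] := leP (u.1 * v.1 + u.2 * v.2) 0.
  by apply: le_trans h _; rewrite mulr_ge0 ?enorm_ge0.
rewrite -(ler_pXn2r (n:=2)) ?nnegrE ?mulr_ge0 ?enorm_ge0//; last exact: ltW.
rewrite exprMn !enorm_sqr.
have : 0 <= (u.1 * v.2 - u.2 * v.1) ^+ 2 by exact: sqr_ge0.
by nra.
Qed.

Lemma enorm_tri r p q : enorm (p - q) <= enorm (p - r) + enorm (r - q).
Proof. by rewrite -[X in enorm X](_ : (p - r) + (r - q) = _) ?enormD// addrA subrK. Qed.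

Definition det2 u v : R := u.1 * v.2 - u.2 * v.1.

End Plane.

(** * Broken paths and the flat distance on a glued surface *)

Section SurfaceGeneric.
Context {R : realType} (S : patchwork R).
Implicit Types (x y z : surface S) (p q : R * R) (i j : piece S).

Lemma to_surfaceE i q (h : q \in region S i) :
  to_surface i q = \pi_(surface S) (existT _ i (exist _ q h) : points S).
Proof.
rewrite /to_surface; case: insubP => [u _ uq|]; last by rewrite h.
by congr (\pi_(surface S) (existT _ i _)); apply: val_inj.
Qed.

Lemma surfaceP x : exists i q, region S i q /\ x = to_surface i q.
Proof.
case E: (repr x) => [i [q h]]; exists i, q; split; first by have := h; rewrite inE.
by rewrite (to_surfaceE h) -[LHS]reprK E.
Qed.

Lemma eq_to_surface i p j q : region S i p -> region S j q -> glued i p j q ->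
  to_surface i p = to_surface j q.
Proof.
move=> ip jq pq; have hp : p \in region S i by rewrite inE.
have hq : q \in region S j by rewrite inE.
rewrite (to_surfaceE hp) (to_surfaceE hq).
by apply/eqmodP/asboolP; apply: rst_step.
Qed.

Lemma repr_to_surface i q (h : q \in region S i) :
  clos_refl_sym_trans (points S) (@glue_step R S)
    (repr (to_surface i q)) (existT _ i (exist _ q h)).
Proof. suff : repr (to_surface i q) = (existT _ i (exist _ q h) : points S) %[mod surface S].
  by move=> /eqmodP /asboolP.
by rewrite reprK (to_surfaceE h). Qed.

(** A chain of gluings links the chosen representative of a class to the given point, so a map
    invariant under single gluings has the same value at both. Maps out of the surfaces are
    evaluated through this. *)
Lemma repr_lift (A : Type) (V : points S -> A) :
  (forall a b, glue_step a b -> V a = V b) ->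
  forall i q (h : q \in region S i),
    V (repr (to_surface i q)) = V (existT _ i (exist _ q h)).
Proof.
move=> HV i q h; have := repr_to_surface h.
by elim=> [a b /HV|a|a b _ ->|a b c _ -> _ ->].
Qed.

Lemma broken_path_trans x y z l l' :
  broken_path x y l -> broken_path y z l' -> broken_path x z (l + l').
Proof.
elim=> [{}x|i p q {}y {}l h _ IH] yz; first by rewrite add0r.
by rewrite -addrA; apply: broken_cons => //; apply: IH.
Qed.

Lemma segmentC p q : segment p q = segment q p.
Proof.
suff H (a b : R * R) : segment a b `<=` segment b a by apply/seteqP; split; exact: H.
move=> r [t /andP[t0 t1] ->]; exists (1 - t).
  by apply/andP; split; lra.
by rewrite opprB addrC subrKC addrC.
Qed.

Lemma broken_path_seg i p q : segment p q `<=` region S i ->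
  broken_path (to_surface i p) (to_surface i q) (enorm (q - p)).
Proof. by move=> h; rewrite -[enorm _]addr0; apply: broken_cons => //; exact: broken_nil. Qed.

Lemma broken_path_sym x y l : broken_path x y l -> broken_path y x l.
Proof.
elim=> [{}x|i p q {}y {}l h _ IH]; first exact: broken_nil.
rewrite addrC; apply: broken_path_trans IH _; rewrite enormC.
by apply: broken_path_seg; rewrite segmentC.
Qed.

Lemma broken_path_ge0 x y l : broken_path x y l -> 0 <= l.
Proof. by elim=> // *; rewrite addr_ge0 ?enorm_ge0. Qed.

Lemma flat_dist_le x y l : broken_path x y l -> flat_dist x y <= l.
Proof.
move=> h; apply: ge_inf => //.
by exists 0 => k /= /broken_path_ge0.
Qed.

Lemma flat_distC x y : flat_dist x y = flat_dist y x.
Proof.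
rewrite /flat_dist; congr inf.
by apply/seteqP; split=> l; exact: broken_path_sym.
Qed.

Lemma flat_dist_xx x : flat_dist x x <= 0.
Proof. by apply: flat_dist_le; exact: broken_nil. Qed.

Definition connected_surface := forall x y, exists l, broken_path x y l.

Hypothesis conn : connected_surface.

Lemma flat_dist_approx x y e : 0 < e ->
  exists2 l, broken_path x y l & l < flat_dist x y + e.
Proof.
move=> e0; apply: inf_adherent => //; split.
  by have [l h] := conn x y; exists l.
by exists 0 => k /= /broken_path_ge0.
Qed.

Lemma flat_dist_tri y x z : flat_dist x z <= flat_dist x y + flat_dist y z.
Proof.
apply/ler_addgt0Pl => e e0.
have e2 : 0 < e / 2 by rewrite divr_gt0.
have [l xy hl] := flat_dist_approx x y e2.
have [l' yz hl'] := flat_dist_approx y z e2.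
have := flat_dist_le (broken_path_trans xy yz).
by move: (flat_dist x z) (flat_dist x y) (flat_dist y z) hl hl' => ? ? ? ? ? ?; lra.
Qed.

(** The increments of [v] telescope along a broken path. Lower bounds for distances in X_g come from
    here: it suffices to exhibit a function that is [L]-Lipschitz along segments inside single
    regions. *)
Lemma le_flat_dist (v : surface S -> R) (L : R) : 0 <= L ->
  (forall i p q, segment p q `<=` region S i ->
     v (to_surface i q) - v (to_surface i p) <= L * enorm (q - p)) ->
  forall x y, v y - v x <= L * flat_dist x y.
Proof.
move=> L0 H x y.
have K l : broken_path x y l -> v y - v x <= L * l.
  elim=> [{}x|i p q {}y {}l h _ IH]; first by rewrite subrr mulr0.
  have := H _ _ _ h; rewrite mulrDr; lra.
have [L00|Lpos] := eqVneq L 0.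
  by have [l /K] := conn x y; rewrite L00 !mul0r.
have {}Lpos : 0 < L by rewrite lt_def Lpos.
rewrite -ler_pdivrMl//; apply: lb_le_inf.
  by have [l h] := conn x y; exists l.
by move=> l /= /K; rewrite ler_pdivrMl.
Qed.

End SurfaceGeneric.

(** * Segments, triangles and affine functions *)

Section Planar.
Context {R : realType}.
Implicit Types (p q r A B C : R * R) (x y z t : R).

Lemma segmentE t A B : (1 - t) *: A + t *: B = A + t *: (B - A).
Proof. by apply: pairP; rewrite !planeE /=; ring. Qed.

Lemma segment_l A B : segment A B A.
Proof. by exists 0; rewrite ?lexx ?ler01// segmentE scale0r addr0. Qed.

Lemma segment_r A B : segment A B B.
Proof. by rewrite segmentC; exact: segment_l. Qed.

Lemma triangle_convex A B C p q : triangle A B C p -> triangle A B C q ->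
  segment p q `<=` triangle A B C.
Proof.
move=> [x [y [z [x0 y0 z0 s ->]]]] [x' [y' [z' [x0' y0' z0' s' ->]]]].
move=> r [t /andP[t0 t1] ->].
exists ((1 - t) * x + t * x'), ((1 - t) * y + t * y'), ((1 - t) * z + t * z').
split; rewrite ?addr_ge0 ?mulr_ge0 ?subr_ge0//.
  transitivity ((1 - t) * (x + y + z) + t * (x' + y' + z')); first by ring.
  by rewrite s s'; ring.
by apply: pairP; rewrite !planeE /=; ring.
Qed.

Lemma triangle_seg A B C p : segment B C p -> triangle A B C p.
Proof.
move=> [t /andP[t0 t1] ->]; exists 0, (1 - t), t; split; rewrite ?subr_ge0//; first by ring.
by rewrite scale0r add0r.
Qed.

Lemma triangleC A B C : triangle A B C = triangle A C B.
Proof.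
suff H (U V W : R * R) : triangle U V W `<=` triangle U W V by apply/seteqP; split; exact: H.
move=> p [x [y [z [x0 y0 z0 s ->]]]]; exists x, z, y; split=> //.
  by rewrite addrAC.
by rewrite addrAC.
Qed.

Lemma triangleCA A B C : triangle A B C = triangle B A C.
Proof.
suff H (U V W : R * R) : triangle U V W `<=` triangle V U W by apply/seteqP; split; exact: H.
move=> p [x [y [z [x0 y0 z0 s ->]]]]; exists y, x, z; split=> //.
  by rewrite (addrC y).
by rewrite (addrC (y *: _)).
Qed.

Definition aff (h : R * R -> R) := exists a b c, forall p, h p = a * p.1 + b * p.2 + c.

Lemma aff_triangle_ge (h : R * R -> R) m A B C p : aff h ->
  m <= h A -> m <= h B -> m <= h C -> triangle A B C p -> m <= h p.
Proof.
move=> [a [b [c H]]] hA hB hC [x [y [z [x0 y0 z0 s ->]]]].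
have -> : h (x *: A + y *: B + z *: C) = x * h A + y * h B + z * h C.
  by rewrite !H !planeE /=; rewrite -[c in LHS]mul1r -s; ring.
have -> : m = x * m + y * m + z * m by rewrite -!mulrDl s mul1r.
by rewrite !lerD// ler_wpM2l.
Qed.

Lemma aff_segment_ge (h : R * R -> R) m A B p : aff h ->
  m <= h A -> m <= h B -> segment A B p -> m <= h p.
Proof.
move=> ah hA hB /(triangle_seg A); exact: (aff_triangle_ge ah).
Qed.

Lemma aff_opp (h : R * R -> R) : aff h -> aff (fun p => - h p).
Proof. by move=> [a [b [c H]]]; exists (- a), (- b), (- c) => p; rewrite H; ring. Qed.

Lemma aff_triangle_le (h : R * R -> R) m A B C p : aff h ->
  h A <= m -> h B <= m -> h C <= m -> triangle A B C p -> h p <= m.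
Proof.
move=> ah hA hB hC T; rewrite -lerN2.
by apply: (aff_triangle_ge (aff_opp ah)) T; rewrite lerN2.
Qed.

Lemma aff_segment_le (h : R * R -> R) m A B p : aff h ->
  h A <= m -> h B <= m -> segment A B p -> h p <= m.
Proof.
move=> ah hA hB /(triangle_seg A); exact: (aff_triangle_le ah).
Qed.

Lemma aff1 : aff (fun p => p.1).
Proof. by exists 1, 0, 0 => p; ring. Qed.
Lemma aff2 : aff (fun p => p.2).
Proof. by exists 0, 1, 0 => p; ring. Qed.
Lemma aff_det A u : aff (fun p => det2 u (p - A)).
Proof.
exists (- u.2), u.1, (u.2 * A.1 - u.1 * A.2) => p.
by rewrite /det2 !planeE /=; ring.
Qed.

(** The displacement of a point with fixed barycentric coordinates is a convex combination of those
    of the vertices. Closeness of matched vertices therefore controls the piecewise affine maps. *)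
Lemma triangle_dist A B C A' B' C' x y z d : 0 <= x -> 0 <= y -> 0 <= z ->
  x + y + z = 1 -> enorm (A - A') <= d -> enorm (B - B') <= d -> enorm (C - C') <= d ->
  enorm ((x *: A + y *: B + z *: C) - (x *: A' + y *: B' + z *: C')) <= d.
Proof.
move=> x0 y0 z0 s hA hB hC.
have -> : x *: A + y *: B + z *: C - (x *: A' + y *: B' + z *: C') =
   x *: (A - A') + y *: (B - B') + z *: (C - C').
  by apply: pairP; rewrite !planeE /=; ring.
apply: le_trans (enormD _ _) _.
apply: le_trans (lerD (enormD _ _) (lexx _)) _.
rewrite !enormZ !ger0_norm//.
have -> : d = x * d + y * d + z * d by rewrite -!mulrDl s mul1r.
by rewrite !lerD// ler_wpM2l.
Qed.

End Planar.

(** * The root alpha *)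

Section Alpha.
Context {R : realType}.

Lemma geo_sum (x : R) n : (1 - x) * \sum_(1 <= i < n.+1) x ^+ i = x - x ^+ n.+1.
Proof.
elim: n => [|n IH]; first by rewrite big_geq// mulr0 expr1 subrr.
by rewrite big_nat_recr//= mulrDr IH [x ^+ n.+2]exprS; ring.
Qed.

(** The default value of [xget] is excluded by exhibiting a root between 0 and 1: the polynomial
    equals -1 at 0 and g - 1 at 1. *)
Lemma alpha_root g : (3 <= g)%N ->
  0 < alpha R g /\ \sum_(1 <= i < g.+1) alpha R g ^+ i - 1 = 0.
Proof.
move=> g3; rewrite /alpha; case: xgetP => [x _ [//]|].
pose p : {poly R} := \sum_(1 <= i < g.+1) 'X^i - 1.
have pE x : p.[x] = \sum_(1 <= i < g.+1) x ^+ i - 1.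
  by rewrite /p hornerD hornerN hornerC horner_sum; congr (_ - 1); apply: eq_bigr => i _; rewrite hornerXn.
have p0 : p.[0] <= 0.
  rewrite pE big1_seq ?sub0r ?lerN10// => i /=.
  by rewrite mem_index_iota => /andP[i1 _]; rewrite expr0n eqn0Ngt i1.
have p1 : 0 <= p.[1].
  rewrite pE (eq_bigr (fun=> 1)); last by move=> i _; rewrite expr1n.
  by rewrite big_const_nat subn1 iter_addr_0 subr_ge0 ler1n; lia.
have [|x] := @poly_ivt _ p 0 1 ler01.
  by rewrite p0 p1.
move=> /andP[x0 _] /rootP px /(_ x) []; split.
  rewrite lt_neqAle x0 andbT eq_sym; apply/eqP => x00; move: px.
  rewrite x00 pE big1_seq ?sub0r => [|i].
    by move/eqP; rewrite oppr_eq0 oner_eq0.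
  by rewrite mem_index_iota => /andP[_ /andP[i1 _]]; rewrite expr0n eqn0Ngt i1.
by rewrite -pE.
Qed.

Section Fixed.
Variable g : nat.
Hypothesis g3 : (3 <= g)%N.
Local Notation a := (alpha R g).

Lemma alpha_gt0 : 0 < a. Proof. by have [] := alpha_root g3. Qed.

(** In this form the equation measures the distance of alpha from 1/2: the excess 2 alpha - 1 is a
    power of alpha that grows with g. *)
Lemma alpha_eq : a ^+ g.+1 = 2 * a - 1.
Proof.
have [_ /eqP] := alpha_root g3; rewrite subr_eq0 => /eqP h.
by have := geo_sum a g; rewrite h mulr1 => h'; lra.
Qed.

Lemma alpha_gt12 : 2^-1 < a.
Proof.
have := exprn_gt0 g.+1 alpha_gt0; rewrite alpha_eq => h; lra.
Qed.

Lemma alpha_lt55 : a < 55 / 100.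
Proof.
have [a0 /eqP] := alpha_root g3; rewrite subr_eq0 => /eqP h.
(* Three terms are present for every g >= 3; equality would give the root for g = 3, about 0.544. *)
have : a + a ^+ 2 + a ^+ 3 <= 1.
  rewrite -h (big_cat_nat (n := 4))//= big_nat_recr//= big_nat_recr//= big_nat1 expr1.
  by rewrite lerDl big_seq sumr_ge0// => i _; rewrite exprn_ge0// ltW.
rewrite ltNge => h3; apply/negP => a55.
have : (55 / 100) ^+ 2 <= a ^+ 2 by rewrite ler_pXn2r// nnegrE; lra.
have : (55 / 100) ^+ 3 <= a ^+ 3 by rewrite ler_pXn2r// nnegrE; lra.
by rewrite !exprS !expr0; lra.
Qed.

Lemma alpha_lt1 : a < 1. Proof. by have := alpha_lt55; lra. Qed.

Lemma alpha_exp_ge0 n : 0 <= a ^+ n.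
Proof. by rewrite exprn_ge0// ltW// alpha_gt0. Qed.

Lemma alpha_exp_gt0 n : 0 < a ^+ n.
Proof. by rewrite exprn_gt0// alpha_gt0. Qed.

Lemma alpha_exp_le m n : (m <= n)%N -> a ^+ n <= a ^+ m.
Proof.
by move=> mn; rewrite ler_wiXn2l// ltW ?alpha_gt0 ?alpha_lt1.
Qed.

Lemma alpha_exp_le1 n : a ^+ n <= 1.
Proof. by rewrite -(expr0 a) alpha_exp_le. Qed.

Lemma alpha_exp_half n : 2 ^- n <= a ^+ n.
Proof. by rewrite -exprVn lerXn2r ?nnegrE ?invr_ge0 ?ler0n ?(ltW alpha_gt0) ?(ltW alpha_gt12). Qed.

(** The bound is uniform in n: passing from n to n + 1 halves the error and adds (alpha - 1/2)
    alpha^n, which is at most alpha^(g+1) / 2. *)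
Lemma alpha_exp_approx n : `|a ^+ n - 2 ^- n| <= 2 * a ^+ g.+1.
Proof.
rewrite ger0_norm ?subr_ge0 ?alpha_exp_half//.
suff : a ^+ n - 2 ^- n <= (2 * a - 1) * (2 * (1 - a ^+ n)) .
  have := alpha_exp_ge0 n; have := alpha_exp_ge0 g.+1; rewrite -alpha_eq; nra.
have a1 := alpha_lt55; have a2 := alpha_gt12.
elim: n => [|n IH]; first by rewrite !expr0 invr1 !subrr !mulr0.
have := alpha_exp_le1 n; have := alpha_exp_ge0 n; have := alpha_exp_half n.
have : 0 <= (2 : R) ^- n by rewrite invr_ge0 exprn_ge0.
rewrite !exprS invfM; move: IH; move: (2 ^- n) (a ^+ n) => x y IH x0 xy y0 y1.
have -> : 2^-1 = 1 / 2 :> R by rewrite mul1r.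
nra.
Qed.

End Fixed.

(** Although alpha depends on g, the bound 0.55 does not, and M tends to infinity. All errors below
    are multiples of this power. *)
Lemma alpha_cvg (e : R) : 0 < e -> exists G, forall g, (3 <= g)%N -> (G <= g)%N ->
  alpha R g ^+ M g <= e.
Proof.
move=> e0.
have [n hn] : exists n, (55 / 100 : R) ^+ n <= e.
  have /cvgrPdist_le/(_ _ e0)[n _ hn] : (fun n => (55 / 100 : R) ^+ n) @ \oo --> 0.
    by apply: cvg_expr; rewrite ger0_norm; lra.
  exists n; have := hn n (leqnn n) => /=; rewrite sub0r normrN ger0_norm// exprn_ge0//; lra.
exists n.*2 => g g3 ng; apply: le_trans hn.
have nM : (n <= M g)%N by rewrite /M; lia.
apply: le_trans (alpha_exp_le g3 nM) _.
by apply: lerXn2r; rewrite ?nnegrE ?(ltW (alpha_gt0 g3)) ?(ltW (alpha_lt55 g3))//; lra.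
Qed.

End Alpha.

(** * Edges of the square *)

Section Square.
Context {R : realType}.
Implicit Types (p q z u v : R * R) (t x y c : R) (n m : nat).

Lemma halfS n : 2 ^- n.+1 = 2 ^- n / 2 :> R.
Proof. by rewrite exprS invfM mulrC. Qed.

Lemma half_gt0 n : 0 < 2 ^- n :> R.
Proof. by rewrite invr_gt0 exprn_gt0. Qed.

Lemma half_le n m : (n <= m)%N -> 2 ^- m <= 2 ^- n :> R.
Proof. by move=> nm; rewrite lef_pV2 ?posrE ?exprn_gt0// ler_eXn2l// ltr1n. Qed.

Lemma half_lt2 n m : (n < m)%N -> 2 * 2 ^- m <= 2 ^- n :> R.
Proof. by move=> nm; have := half_le nm; rewrite halfS; lra. Qed.

Lemma half0 : 2 ^- 0 = 1 :> R. Proof. by rewrite expr0 invr1. Qed.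

Lemma half1 : 2 ^- 1 = 2^-1 :> R. Proof. by rewrite expr1. Qed.

Lemma half_eq0 x c : (forall n, `|x| <= c * 2 ^- n.+1) -> x = 0.
Proof.
move=> h; apply/eqP; rewrite -normr_le0; apply/ler_addgt0Pr => e e0; rewrite add0r.
have c0 : 0 <= c by have := le_trans (normr_ge0 _) (h 0%N); rewrite pmulr_lge0 ?half_gt0.
have /cvgrPdist_le/(_ _ e0)[n _ hn] : (fun n => c * (2^-1) ^+ n) @ \oo --> (c * 0 : R).
  by apply: cvgMr; apply: cvg_expr; rewrite ger0_norm; lra.
have := hn n (leqnn n) => /=; rewrite mulr0 sub0r normrN ger0_norm; last first.
  by rewrite mulr_ge0// exprn_ge0// invr_ge0.
apply: le_trans; apply: le_trans (h n) _; rewrite exprVn ler_wpM2l//.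
exact: half_le.
Qed.

Lemma sSS n : s R n.+2 = s R n + 2 ^- n.+2.
Proof.
rewrite /s big_mkcond big_nat_recl//= big_nat_recr//=.
rewrite muln0 subn0 /= ifF ?addr0; last by apply/negbTE; lia.
rewrite [RHS]addrC [in RHS]big_mkcond; congr (_ + _).
by apply: eq_bigr => i _; do 2 (case: ifPn => //; try lia); move=> _ _; congr (2 ^- _); lia.
Qed.

(** By [sSS] the sums grow along each parity class like a geometric series of ratio 1/4, with limits
    2/3 (odd) and 1/3 (even). *)
Lemma sE n : s R n = if odd n then (2 - 2 ^- n) / 3 else (1 - 2 ^- n) / 3.
Proof.
elim/ltn_ind: n => -[_|[_|n IH]].
- by rewrite /s big_geq//= half0 subrr mul0r.
- by rewrite /s big_mkcond big_nat1 muln0 /= subn0 expr1; lra.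
by rewrite sSS IH// !halfS /= negbK; case: ifP => _; lra.
Qed.

(** Since tau carries D^+ to D^-, the edges of one copy of D^+ suffice: the two halves of the bottom
    side ([Bot true] is the right one), C'_n and C''_n on top, A_n on the right, which tau carries
    to B_n, and on the left the images of B_n (n odd) and of A_n (n even). *)
Inductive bedge := Bot of bool | Top' of nat | Top'' of nat | Rgt of nat | Lft of nat.

Definition valid (e : bedge) : bool :=
  match e with Bot _ => true | Top' n | Top'' n | Rgt n | Lft n => (0 < n)%N end.

(** The gluing takes the edge [e] of copy [b] to the edge [partner e] of copy [b (+) flips e]. *)
Definition partner (e : bedge) : bedge :=
  match e with
  | Bot h => Bot (~~ h) | Top' n => Top'' n | Top'' n => Top' n
  | Rgt n => Lft n | Lft n => Rgt n
  end.

Definition flips (e : bedge) : bool :=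
  match e with Rgt n | Lft n => odd n | _ => true end.

Definition horiz (e : bedge) : bool :=
  match e with Rgt _ | Lft _ => false | _ => true end.

Definition level (e : bedge) : R :=
  match e with Bot _ => 2^-1 | Top' _ | Top'' _ | Rgt _ => 1 | Lft _ => 0 end.

(** For odd left edges [lo] exceeds [hi]: the edges are oriented so that the gluing preserves the
    affine parameter. *)
Definition lo (e : bedge) : R :=
  match e with
  | Bot h => if h then 2^-1 else 0
  | Top' n => 1 - 2 * 2 ^- n
  | Top'' n => 1 - 3 * 2 ^- n.+1
  | Rgt n => 1 - 2 ^- n
  | Lft n => if odd n then s R n + 2 ^- n else 1 - 2 ^- n - s R n
  end.

Definition hi (e : bedge) : R :=
  match e with
  | Bot h => if h then 1 else 2^-1
  | Top' n => 1 - 3 * 2 ^- n.+1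
  | Top'' n => 1 - 2 ^- n
  | Rgt n => 1 - 2 ^- n.+1
  | Lft n => if odd n then s R n + 2 ^- n.+1 else 1 - 2 ^- n.+1 - s R n
  end.

Definition onside e c : R * R := if horiz e then (c, level e) else (level e, c).
Definition eA e := onside e (lo e).
Definition eB e := onside e (hi e).
Definition ept e t := (1 - t) *: eA e + t *: eB e.

Lemma eptE e t : ept e t = onside e (lo e + t * (hi e - lo e)).
Proof.
by rewrite /ept /eA /eB /onside; case: ifP => _; apply: pairP; rewrite !planeE /=; ring.
Qed.

Lemma ept0 e : ept e 0 = eA e.
Proof. by rewrite /ept subr0 scale1r scale0r addr0. Qed.
Lemma ept1 e : ept e 1 = eB e.
Proof. by rewrite /ept subrr scale1r scale0r add0r. Qed.

Definition len (e : bedge) : R := `|hi e - lo e|.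

Lemma half_le2 n : (0 < n)%N -> 2 ^- n <= 2^-1 :> R.
Proof. by move=> n0; rewrite -half1 half_le. Qed.

Lemma half_le4 n : (0 < n)%N -> ~~ odd n -> 2 ^- n <= 4^-1 :> R.
Proof.
move=> n0 on; have n2 : (2 <= n)%N by case: n n0 on => [|[]].
by have := half_le n2; rewrite halfS half1; lra.
Qed.

Lemma lohi e : valid e -> (if horiz e then 0 else 2^-1) <= lo e <= 1 /\
  (if horiz e then 0 else 2^-1) <= hi e <= 1.
Proof.
case: e => [h|n|n|n|n] /=; rewrite ?sE ?halfS; try move=> n0; try have h2 := half_le2 n0;
  try have hp := half_gt0 n.
- by case: h; split; lra.
- by split; lra.
- by split; lra.
- by split; lra.
- by case: (boolP (odd n)) => on; [|have h4 := half_le4 n0 on]; split; lra.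
Qed.

Lemma lenE e : valid e -> len e = if e is Bot _ then 2^-1 else
   2 ^- (match e with Top' n | Top'' n | Rgt n | Lft n => n.+1 | _ => 0 end).
Proof.
rewrite /len; case: e => [h|n|n|n|n] /= n0; rewrite ?halfS; try have hp := half_gt0 n.
- by case: h; rewrite ger0_norm; lra.
- by rewrite ger0_norm; lra.
- by rewrite ger0_norm; lra.
- by rewrite ger0_norm; lra.
- by case: (boolP (odd n)) => on; [rewrite ler0_norm|rewrite ger0_norm]; lra.
Qed.

Lemma len_gt0 e : valid e -> 0 < len e.
Proof. by move=> ve; rewrite lenE//; case: e ve => [h|n|n|n|n] _; rewrite ?half_gt0//; lra. Qed.

Lemma len_le e : valid e -> len e <= 2^-1.
Proof. by move=> ve; rewrite lenE//; case: e ve => [h|n|n|n|n] _ //; apply: half_le2. Qed.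

Definition tent t : R := Num.min t (1 - t).

(** [tent t] times the length is the distance from the point to the nearer end of the interval, and
    x lies beyond one of the ends. *)
Lemma gap t c c' x : 0 <= t <= 1 ->
  (x <= c /\ x <= c') \/ (c <= x /\ c' <= x) ->
  tent t * `|c' - c| <= `|c + t * (c' - c) - x|.
Proof.
move=> /andP[t0 t1] H; set T := tent t.
have T1 : T <= t by rewrite ge_min lexx.
have T2 : T <= 1 - t by rewrite ge_min lexx orbT.
have [h|h] := leP c c'.
  rewrite (ger0_norm (_ : 0 <= c' - c)) ?subr_ge0//.
  by case: H => -[h3 h4]; [rewrite ger0_norm|rewrite ler0_norm]; nra.
rewrite (ltr0_norm (_ : c' - c < 0)) ?subr_lt0//.
by case: H => -[h3 h4]; [rewrite ger0_norm|rewrite ler0_norm]; nra.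
Qed.

(** On the top and on the right the edges are successive dyadic intervals. On the left they
    accumulate at height 2/3, the odd ones from above and the even ones from below. *)
Lemma edges_apart e e' : valid e -> valid e' -> e <> e' ->
  horiz e = horiz e' -> level e = level e' ->
  [/\ lo e' <= lo e, lo e' <= hi e, hi e' <= lo e & hi e' <= hi e] \/
  [/\ lo e <= lo e', lo e <= hi e', hi e <= lo e' & hi e <= hi e'].
Proof.
have L n m : (0 < n)%N -> (n < m)%N ->
   [/\ 2 * 2 ^- m <= 2 ^- n :> R, 0 < 2 ^- m :> R & 2 ^- n <= 2^-1 :> R].
  by move=> n0 nm; rewrite half_lt2// half_gt0 half_le2.
case: e => [h|n|n|n|n]; case: e' => [k|m|m|m|m] //=; move=> n0 m0 ne _; rewrite ?sE ?halfS => lv.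
- by case: h ne lv; case: k => // _ _; [left|right]; split; lra.
- by clear ne; lra.
- by clear ne; lra.
- by clear ne; lra.
- have [/(L _ _ n0)[]|/(L _ _ m0)[]|e] := ltngtP n m; last by case: ne; rewrite e.
  + by right; clear ne; split; lra.
  + by left; clear ne; split; lra.
- have [/(L _ _ n0)[]|/(L _ _ m0)[]|<-] := ltngtP n m.
  + by right; clear ne; split; lra.
  + by left; clear ne; split; lra.
  + by have := half_gt0 n; right; clear ne; split; lra.
- by clear ne; lra.
- have [/(L _ _ n0)[]|/(L _ _ m0)[]|<-] := ltngtP n m.
  + by right; clear ne; split; lra.
  + by left; clear ne; split; lra.
  + by have := half_gt0 n; left; clear ne; split; lra.
- have [/(L _ _ n0)[]|/(L _ _ m0)[]|e] := ltngtP n m; last by case: ne; rewrite e.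
  + by right; clear ne; split; lra.
  + by left; clear ne; split; lra.
- have [/(L _ _ n0)[]|/(L _ _ m0)[]|e] := ltngtP n m; last by case: ne; rewrite e.
  + by right; clear ne; split; lra.
  + by left; clear ne; split; lra.
- by clear ne; lra.
- by clear ne; lra.
have hn := half_gt0 n; have hm := half_gt0 m.
(* Indices of equal parity differ by at least 2, which gives the factor 4 that separates two left
   edges on the same side of 2/3. *)
have D : odd n = odd m -> (n < m)%N -> 4 * 2 ^- m <= 2 ^- n :> R.
  move=> onm nm; have /half_le : (n.+2 <= m)%N.
    by rewrite ltn_neqAle nm andbT; apply: contra_eq_neq onm => <- /=; case: (odd n).
  by rewrite !halfS; lra.
have D' : odd m = odd n -> (m < n)%N -> 4 * 2 ^- n <= 2 ^- m :> R.
  move=> onm nm; have /half_le : (m.+2 <= n)%N.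
    by rewrite ltn_neqAle nm andbT; apply: contra_eq_neq onm => <- /=; case: (odd m).
  by rewrite !halfS; lra.
case: (boolP (odd n)) => on; case: (boolP (odd m)) => om.
- have [nm|nm|e] := ltngtP n m; last by case: ne; rewrite e.
  + by left; have := D _ nm; rewrite on om => /(_ erefl) ?; clear ne L D D' n0 m0; split; lra.
  + by right; have := D' _ nm; rewrite on om => /(_ erefl) ?; clear ne L D D' n0 m0; split; lra.
- by left; clear ne L D D' n0 m0; split; lra.
- by right; clear ne L D D' n0 m0; split; lra.
have [nm|nm|e] := ltngtP n m; last by case: ne; rewrite e.
- have := D _ nm; rewrite (negbTE on) (negbTE om) => /(_ erefl) ?.
  by right; clear ne L D D' n0 m0; split; lra.
have := D' _ nm; rewrite (negbTE on) (negbTE om) => /(_ erefl) ?.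
by left; clear ne L D D' n0 m0; split; lra.
Qed.

Lemma tent_le t : tent t <= 2^-1.
Proof. by rewrite /tent; have [h|h] := leP t (1 - t); lra. Qed.

Lemma conv_le t c c' y : 0 <= t <= 1 -> c <= y -> c' <= y -> c + t * (c' - c) <= y.
Proof. by move=> /andP[? ?] ? ?; nra. Qed.

Lemma conv_ge t c c' y : 0 <= t <= 1 -> y <= c -> y <= c' -> y <= c + t * (c' - c).
Proof. by move=> /andP[? ?] ? ?; nra. Qed.

(** On a common side the edges do not overlap; if the sides are perpendicular, the second edge lies
    beyond an end of the first in the direction of the first; if they are opposite, their distance
    is at least 1/2, more than [tent t * len e] can be. *)
Lemma ept_apart e e' t t' : valid e -> valid e' -> e <> e' ->
  0 <= t <= 1 -> 0 <= t' <= 1 ->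
  tent t * len e <= enorm (ept e t - ept e' t').
Proof.
move=> ve ve' ne t01 t01'.
have [/andP[a1 a2] /andP[a3 a4]] := lohi ve.
have [/andP[b1 b2] /andP[b3 b4]] := lohi ve'.
rewrite !eptE /onside; case: (boolP (horiz e)) => he; case: (boolP (horiz e')) => he'.
- have [lv|lv] := eqVneq (level e) (level e').
    apply: le_trans (ler_enorm1 _); rewrite /len /=; apply: gap => //.
    have := edges_apart ve ve' ne; rewrite he he' => /(_ erefl lv).
    by move=> [] [? ? ? ?]; [left|right]; split; rewrite ?conv_le ?conv_ge.
  apply: le_trans (ler_enorm2 _) => /=.
  have : 2^-1 <= `|level e - level e'|.
    by case: e lv he {ve ne a1 a2 a3 a4} => [?|?|?|?|?]; case: e' he' {ve' b1 b2 b3 b4} => [?|?|?|?|?] //= _; rewrite ?eqxx// => _ _; [rewrite ler0_norm|rewrite ler0_norm|rewrite ger0_norm|rewrite ger0_norm]; lra.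
  by have := len_le ve; have := len_gt0 ve; have := tent_le t; nra.
- rewrite he in a1 a3.
  apply: le_trans (ler_enorm1 _); rewrite /len /=; apply: gap => //.
  by case: e' he' {ve' ne b1 b2 b3 b4} => [?|?|?|?|?] //= _; [right|left].
- rewrite (negbTE he) in a1 a3.
  apply: le_trans (ler_enorm2 _); rewrite /len /=; apply: gap => //.
  by case: e' he' {ve' ne b1 b2 b3 b4} => [?|?|?|?|?] //= _; [left|right|right].
have [lv|lv] := eqVneq (level e) (level e').
  apply: le_trans (ler_enorm2 _); rewrite /len /=; apply: gap => //.
  have := edges_apart ve ve' ne; rewrite (negbTE he) (negbTE he') => /(_ erefl lv).
  by move=> [] [? ? ? ?]; [left|right]; split; rewrite ?conv_le ?conv_ge.
apply: le_trans (ler_enorm1 _) => /=.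
have : 2^-1 <= `|level e - level e'|.
  by case: e lv he {ve ne a1 a2 a3 a4} => [?|?|?|?|?]; case: e' he' {ve' b1 b2 b3 b4} => [?|?|?|?|?] //= _; rewrite ?eqxx// => _ _; [rewrite ger0_norm|rewrite ler0_norm]; lra.
by have := len_le ve; have := len_gt0 ve; have := tent_le t; nra.
Qed.

End Square.

(** * Vertices of the square and the distance to them *)

Section Vertices.
Context {R : realType}.
Implicit Types (p q z u v : R * R) (t x y c : R) (n m : nat) (b : bool).

Lemma partnerK e : partner (partner e) = e.
Proof. by case: e => //= h; rewrite negbK. Qed.

Lemma valid_partner e : valid (partner e) = valid e.
Proof. by case: e. Qed.

Lemma flips_partner e : flips (partner e) = flips e.
Proof. by case: e. Qed.

Lemma len_partner e : valid e -> len (R:=R) (partner e) = len e.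
Proof. by move=> ve; rewrite !lenE ?valid_partner//; case: e ve. Qed.

Definition vertices : set (R * R) :=
  [set z | exists e, valid e /\ (z = eA e \/ z = eB e)].

Lemma vertices_eA e : valid e -> vertices (eA e).
Proof. by exists e; split=> //; left. Qed.

Lemma vertices_eB e : valid e -> vertices (eB e).
Proof. by exists e; split=> //; right. Qed.

(** Compatibility with the gluings, the endpoints of the edges included although they are not points
    of X_oo. *)
Definition edge_invariant (f : bool -> R * R -> R) := forall b e t, valid e ->
  0 <= t <= 1 -> f b (ept e t) = f (b (+) flips e) (ept (partner e) t).

Definition nonexpanding (f : R * R -> R) := forall p q, f p - f q <= enorm (p - q).

Lemma nonexpanding_abs f p q : nonexpanding f -> `|f p - f q| <= enorm (p - q).
Proof. by move=> H; rewrite ler_norml H andbT lerNl opprB enormC H. Qed.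

(* Following the identifications, the corners (1, 1 - 2^-n) of each copy of the
   square all get the same value, which is that of their limit (1, 1); so do the
   corners on the upper side, which link the two copies. *)
Lemma vertices_const f : edge_invariant f -> (forall b, nonexpanding (f b)) ->
  forall b z, vertices z -> f b z = f false (1, 1).
Proof.
move=> fI fL.
have fA b e : valid e -> f b (eA e) = f (b (+) flips e) (eA (partner e)).
  by move=> ve; rewrite -!ept0; apply: fI; rewrite ?lexx ?ler01.
have fB b e : valid e -> f b (eB e) = f (b (+) flips e) (eB (partner e)).
  by move=> ve; rewrite -!ept1; apply: fI; rewrite ?lexx ?ler01.
have RB n : eB (Rgt n) = eA (Rgt n.+1) :> R * R by [].
have LB n : eB (Lft n) = eA (Lft n.+2) :> R * R.
  rewrite /eA /eB /onside /= negbK !sE /= negbK !halfS.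
  by case: (boolP (odd n)) => on; congr pair; lra.
have TB n : eB (Top'' n) = eA (Top' n.+1) :> R * R.
  by rewrite /eA /eB /onside /= !halfS; congr pair; lra.
have step b n : (0 < n)%N -> f b (eA (Rgt n.+1)) = f b (eA (Rgt n.+2)).
  move=> n0; rewrite -RB fB//= LB (fA _ (Lft n.+2))//= negbK.
  by rewrite addbK.
have R12 b : f b (eA (Rgt 1)) = f b (eA (Rgt 2)).
  have E1 : eA (Lft 2) = eA (Bot false) :> R * R.
    by rewrite /eA /onside /= sE /= !halfS half0; congr pair; lra.
  have E2 : eA (Bot true) = eB (Bot false) :> R * R by [].
  have E3 : eB (Bot true) = eA (Rgt 1) :> R * R.
    by rewrite /eA /eB /onside /= expr1; congr pair; lra.
  rewrite [RHS]fA//= addbF E1 [RHS]fA//= E2 [RHS]fB//= E3.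
  by rewrite !addbT negbK.
have Rconst b n : (0 < n)%N -> f b (eA (Rgt n)) = f b (eA (Rgt 1)).
  case: n => // n _; elim: n => // n <-.
  by case: n => [|n]; [exact: esym (R12 b)|exact: esym (step b n.+1 isT)].
have Rlim b n : (0 < n)%N -> f b (eA (Rgt n)) = f b (1, 1).
  move=> n0; apply/eqP; rewrite -subr_eq0; apply/eqP; apply: (@half_eq0 _ _ 1) => m.
  rewrite Rconst// -(Rconst b m.+1)//; apply: le_trans (nonexpanding_abs _ _ (fL b)) _.
  rewrite /eA /onside /=; apply: le_trans (enorm_le12 _) _ => /=.
  by rewrite subrr normr0 add0r addrAC subrr sub0r normrN ger0_norm ?mul1r.
have Tconst b n : (0 < n)%N -> f b (eA (Top' n)) = f b (eA (Top' 1)).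
  case: n => // n _; elim: n => // n <-; rewrite (fA b (Top' n.+1))//= addbT.
  rewrite -TB (fB b (Top'' _))//= addbT.
  by [].
have Tlim b n : (0 < n)%N -> f b (eA (Top' n)) = f b (1, 1).
  move=> n0; apply/eqP; rewrite -subr_eq0; apply/eqP; apply: (@half_eq0 _ _ 2) => m.
  rewrite Tconst// -(Tconst b m.+1)//; apply: le_trans (nonexpanding_abs _ _ (fL b)) _.
  rewrite /eA /onside /=; apply: le_trans (enorm_le12 _) _ => /=.
  by rewrite subrr normr0 addr0 addrAC subrr sub0r normrN ger0_norm.
have flip b : f b (1, 1) = f (~~ b) (1, 1).
  rewrite -(Tlim b 1%N)// -(Rlim (~~ b) 1%N)// (fA _ (Rgt 1))//= addbT negbK.
  by congr (f _ _); rewrite /eA /onside /= sE /= halfS half0; congr pair; lra.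
have both b : f b (1, 1) = f false (1, 1) by case: b; rewrite // flip.
suff H b e : valid e -> f b (eA e) = f false (1, 1) /\ f b (eB e) = f false (1, 1).
  by move=> b z [e [ve [->|->]]]; have [] := H b e ve.
have RA (c : bool) n : (0 < n)%N -> f c (eA (Rgt n)) = f false (1, 1) by move=> ?; rewrite Rlim.
have TA (c : bool) n : (0 < n)%N -> f c (eA (Top' n)) = f false (1, 1) by move=> ?; rewrite Tlim.
have T'A (c : bool) n : (0 < n)%N -> f c (eA (Top'' n)) = f false (1, 1).
  by move=> n0; rewrite fA//= TA.
have BA (c h : bool) : f c (eA (Bot h)) = f false (1, 1).
  have -> : f c (eA (Bot h)) = f (c (+) h) (eA (Bot false)).
    by case: h; rewrite ?addbF// fA//= addbT.
  have -> : eA (Bot false) = eA (Lft 2) :> R * R.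
    by rewrite /eA /onside /= sE /= !halfS half0; congr pair; lra.
  by rewrite fA//= RA.
case: e => [h|n|n|n|n] ve.
- split=> //; case: h {ve}; last exact: (BA b true).
  have -> : eB (Bot true) = eA (Rgt 1) :> R * R.
    by rewrite /eA /eB /onside /= expr1; congr pair; lra.
  exact: RA.
- by split; [exact: TA|exact: (T'A b n ve)].
- by split; [exact: T'A|rewrite TB; exact: TA].
- by split; [exact: RA|rewrite RB; exact: RA].
- by split; [rewrite fA//= RA|rewrite fB//= RB RA].
Qed.

Section SetDist.
Variable A : set (R * R).
Hypothesis A0 : A !=set0.

Definition setdist p : R := inf [set enorm (p - z) | z in A].

Lemma setdist_has p : has_inf [set enorm (p - z) | z in A].
Proof.
split; first by case: A0 => z Az; exists (enorm (p - z)), z.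
by exists 0 => _ [z _ <-]; exact: enorm_ge0.
Qed.

Lemma setdist_le p z : A z -> setdist p <= enorm (p - z).
Proof. by move=> vz; apply: ge_inf; [have [] := setdist_has p|exists z]. Qed.

Lemma le_setdist p x : (forall z, A z -> x <= enorm (p - z)) -> x <= setdist p.
Proof.
move=> h; apply: lb_le_inf; first by have [] := setdist_has p.
by move=> _ [z vz <-]; exact: h.
Qed.

Lemma setdist_near p e : 0 < e -> exists2 z, A z & enorm (p - z) < setdist p + e.
Proof. by move=> e0; have [_ [z vz <-] h] := inf_adherent e0 (setdist_has p); exists z. Qed.

Lemma setdist_nonexpanding : nonexpanding setdist.
Proof.
move=> p q; rewrite lerBlDl; apply/ler_addgt0Pr => e e0.
have [z vz hz] := setdist_near q e0.
have := setdist_le p vz; have := enorm_tri q p z.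
by move: hz; move: (setdist p) (setdist q) => ? ?; lra.
Qed.

End SetDist.

Lemma vertices_neq0 : vertices !=set0.
Proof. by exists (eA (Bot true)); exact: vertices_eA. Qed.

Definition distZ := setdist vertices.

Lemma enorm_edge e : enorm (eB e - eA e) = len (R:=R) e.
Proof.
rewrite /len /eA /eB /onside; case: ifP => _; rewrite /enorm /=.
  by rewrite subrr expr0n addr0 sqrtr_sqr.
by rewrite subrr expr0n add0r sqrtr_sqr.
Qed.

Lemma ept_eA e t : ept e t - eA e = t *: (eB e - eA e) :> R * R.
Proof. by apply: pairP; rewrite /ept !planeE /=; ring. Qed.

Lemma ept_eB e t : ept e t - eB e = - ((1 - t) *: (eB e - eA e)) :> R * R.
Proof. by apply: pairP; rewrite /ept !planeE /=; ring. Qed.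

Lemma ept_vertex e t z : valid e -> 0 <= t <= 1 -> vertices z ->
  tent t * len e <= enorm (ept e t - z).
Proof.
move=> ve t01 [e' [ve' zE]].
have [e'e|ne] := pselect (e = e'); last first.
  by case: zE => ->; rewrite -1?ept0 -1?ept1; apply: ept_apart => //; rewrite lexx ler01.
subst e' => {ve'}.
have T1 : tent t <= t by rewrite ge_min lexx.
have T2 : tent t <= 1 - t by rewrite ge_min lexx orbT.
have l0 := len_gt0 (R:=R) ve; move/andP: t01 => [t0 t1].
case: zE => ->; last rewrite ept_eB enormN.
  by rewrite ept_eA enormZ enorm_edge ger0_norm// ler_wpM2r// ltW.
by rewrite enormZ enorm_edge ger0_norm ?ler_wpM2r ?subr_ge0// ltW.
Qed.

Lemma ept_sub e t t' : ept e t - ept e t' = (t - t') *: (eB e - eA e) :> R * R.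
Proof. by apply: pairP; rewrite /ept !planeE /=; ring. Qed.

(** Any vertex is an endpoint of some edge, and by [ept_apart] other edges are no nearer than the
    endpoints of [e] itself. *)
Lemma distZ_ept e t : valid e -> 0 <= t <= 1 -> distZ (ept e t) = tent t * len e.
Proof.
move=> ve t01; apply/le_anti/andP; split; last first.
  by apply: (le_setdist vertices_neq0) => z; exact: ept_vertex.
have [t0 t1] := andP t01.
rewrite /tent; have [h|h] := leP t (1 - t).
  apply: le_trans (setdist_le vertices_neq0 _ (vertices_eA ve)) _.
  by rewrite ept_eA enormZ enorm_edge ger0_norm.
apply: le_trans (setdist_le vertices_neq0 _ (vertices_eB ve)) _.
by rewrite ept_eB enormN enormZ enorm_edge ger0_norm// subr_ge0.
Qed.

End Vertices.

(** * The limit surface *)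

Section LimitSurface.
Context {R : realType}.
Implicit Types (p q z u v d : R * R) (t x y c : R) (n m : nat) (b : bool).

Local Notation Esq := (@Dplus R).
Local Notation Dsq := (@Dplus R `|` @Dminus R).
Local Notation cl p := (@to_surface R (oo_patchwork R) tt p).

Definition tau p : R * R := (p.1 - 2^-1, 1 - p.2).
Definition chart b p := if b then tau p else p.

Lemma tauB p q : enorm (tau p - tau q) = enorm (p - q).
Proof.
by rewrite /enorm /tau /=; congr Num.sqrt; ring.
Qed.

Lemma chartB b p q : enorm (chart b p - chart b q) = enorm (p - q).
Proof. by case: b; rewrite //= tauB. Qed.

Lemma chart_conv b t p q : chart b ((1 - t) *: p + t *: q) = (1 - t) *: chart b p + t *: chart b q.
Proof. by case: b => //=; apply: pairP; rewrite /tau !planeE /=; ring. Qed.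

Lemma Esq_conv p q t : Esq p -> Esq q -> 0 <= t <= 1 -> Esq ((1 - t) *: p + t *: q).
Proof.
move=> [/andP[? ?] /andP[? ?]] [/andP[? ?] /andP[? ?]] /andP[? ?].
by split; rewrite !planeE /=; apply/andP; split; nra.
Qed.

Lemma chart_D b p : Esq p -> Dsq (chart b p).
Proof.
move=> [/andP[? ?] /andP[? ?]]; case: b; [right|left]; split => /=; apply/andP; split; lra.
Qed.

Lemma D_chart q : Dsq q -> exists b p, Esq p /\ q = chart b p.
Proof.
case=> [h|[/andP[? ?] /andP[? ?]]]; first by exists false, q.
exists true, (q.1 + 2^-1, 1 - q.2); split; last by apply: pairP => /=; lra.
by split => /=; apply/andP; split; lra.
Qed.

Lemma interiorP (A : set (R * R)) q : A° q <->
  exists2 r, 0 < r & forall p, `|q.1 - p.1| < r -> `|q.2 - p.2| < r -> A p.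
Proof.
rewrite /interior; split => [/nbhs_ballP[r /= r0 h]|[r r0 h]].
  by exists r => // p h1 h2; apply: h; split.
by apply/nbhs_ballP; exists r => //= p [h1 h2]; exact: h.
Qed.

Definition Eint p := 0 < p.1 < 1 /\ 2^-1 < p.2 < 1.

Lemma chart_interior b p : Eint p -> Dsq° (chart b p).
Proof.
move=> [/andP[h1 h2] /andP[h3 h4]]; apply/interiorP.
pose r := Num.min (Num.min p.1 (1 - p.1)) (Num.min (p.2 - 2^-1) (1 - p.2)).
exists r; first by rewrite !lt_min; lra.
have : r <= p.1 by rewrite !ge_min lexx.
have : r <= 1 - p.1 by rewrite !ge_min lexx !orbT.
have : r <= p.2 - 2^-1 by rewrite !ge_min lexx !orbT.
have : r <= 1 - p.2 by rewrite !ge_min lexx !orbT.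
move: r => r r1 r2 r3 r4 q.
by case: b => /=; rewrite !ltr_norml => /andP[? ?] /andP[? ?]; [right|left]; split => /=; apply/andP; split; lra.
Qed.

Lemma middle_interior x : 0 < x < 2^-1 -> Dsq° (x, 2^-1).
Proof.
move=> /andP[h1 h2]; apply/interiorP.
pose r := Num.min (Num.min x (2^-1 - x)) (2^-1).
exists r; first by rewrite !lt_min; lra.
have : r <= x by rewrite !ge_min lexx.
have : r <= 2^-1 - x by rewrite !ge_min lexx !orbT.
have : r <= 2^-1 by rewrite !ge_min lexx !orbT.
move: r => r r1 r2 r3 q /=; rewrite !ltr_norml => /andP[? ?] /andP[? ?].
have [h|h] := leP 2^-1 q.2; [left|right]; split => /=; apply/andP; split; lra.
Qed.

Lemma interior_Doo p : Dsq° p -> Doo p.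
Proof. by left. Qed.

(* [EdgeI] and the middle of D are the bottom edges of the two copies of E. *)
Definition bedge_of (e : edge) : bool * bedge :=
  match e with
  | EdgeI => (true, Bot false) | EdgeC' n => (false, Top' n) | EdgeC'' n => (false, Top'' n)
  | EdgeA n => (false, Rgt n) | EdgeB n => (true, Rgt n)
  end.

Definition inner t := 0 < t < 1.

Lemma valid_bedge_of (e : edge) : edges e -> valid (bedge_of e).2.
Proof. by case: e. Qed.

Lemma edge_imageE (e : edge) t : edge_image e (chart (bedge_of e).1 (ept (bedge_of e).2 t)) =
  chart ((bedge_of e).1 (+) flips (bedge_of e).2) (ept (partner (bedge_of e).2) t).
Proof.
case: e => [|n|n|n|n]; rewrite !eptE /onside /= ?sE.
- by apply: pairP; rewrite /tau /=; lra.
- by apply: pairP; rewrite /tau /= ?halfS; lra.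
- by apply: pairP; rewrite /tau /= ?halfS; lra.
- by case: (odd n); apply: pairP; rewrite /tau /= ?halfS; lra.
- by case: (odd n); apply: pairP; rewrite /tau /= ?halfS; lra.
Qed.

Lemma edge_sourceE (e : edge) t : edges e -> inner t ->
  edge_source e (chart (bedge_of e).1 (ept (bedge_of e).2 t)).
Proof.
rewrite eptE; case: e => [|n|n|n|n] /= n0 /andP[t0 t1]; rewrite /onside /= ?halfS.
- by split => /=; lra.
all: have hn := half_gt0 (R:=R) n; split => /=; try (by apply/andP; split; nra).
all: by lra.
Qed.

Lemma edge_sourceP (e : edge) p : edges e -> edge_source e p ->
  exists2 t, inner t & p = chart (bedge_of e).1 (ept (bedge_of e).2 t).
Proof.
have K x0 w x : 0 < w -> x0 < x < x0 + w -> exists2 t, inner t & x = x0 + t * w.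
  move=> w0 /andP[h1 h2]; exists ((x - x0) / w); last by field; rewrite gt_eqF.
  by rewrite /inner ltr_pdivlMr// ltr_pdivrMr//; lra.
case: e => [|n|n|n|n] /= n0; rewrite ?halfS; try (have hn := half_gt0 (R:=R) n);
  move=> [].
- move=> h1 h2; have [t t01 tE] := K (- 2^-1) 2^-1 p.1 ltac:(lra) ltac:(lra).
  by exists t => //; rewrite eptE /onside /tau /=; apply: pairP => /=; lra.
- move=> h1 h2; have [t t01 tE] := K (1 - 2 * 2 ^- n) (2 ^- n / 2) p.1 ltac:(lra) ltac:(lra).
  by exists t => //; rewrite eptE /onside /tau /= ?halfS; apply: pairP => /=; lra.
- move=> h1 h2; have [t t01 tE] := K (1 - 3 * (2 ^- n / 2)) (2 ^- n / 2) p.1 ltac:(lra) ltac:(lra).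
  by exists t => //; rewrite eptE /onside /tau /= ?halfS; apply: pairP => /=; lra.
- move=> h1 h2; have [t t01 tE] := K (1 - 2 ^- n) (2 ^- n / 2) p.2 ltac:(lra) ltac:(lra).
  by exists t => //; rewrite eptE /onside /tau /= ?halfS; apply: pairP => /=; lra.
- move=> h1 h2; have [t t01 tE] := K (- 2 ^- n) (2 ^- n / 2) (- p.2) ltac:(lra) ltac:(lra).
  by exists t => //; rewrite eptE /onside /tau /= ?halfS; apply: pairP => /=; lra.
Qed.

(** The edge [Bot b] of copy [b] is the middle segment of D, where the two copies touch inside the
    plane; every other edge is the source or the image of an identified edge. *)
Lemma bedge_cases b be : valid be -> be = Bot b \/
  (exists e, edges e /\ (bedge_of e = (b, be) \/ bedge_of e = (b (+) flips be, partner be))).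
Proof.
case: be => [h|n|n|n|n] ve.
- case: b h {ve} => [] []; by [left|right; exists EdgeI; split => //; left|right; exists EdgeI; split => //; right].
- by right; case: b; [exists (EdgeC'' n)|exists (EdgeC' n)]; split => //; [right|left].
- by right; case: b; [exists (EdgeC' n)|exists (EdgeC'' n)]; split => //; [right|left].
- by right; case: b; [exists (EdgeB n)|exists (EdgeA n)]; split => //; left.
- right; exists (if b (+) odd n then EdgeB n else EdgeA n).
  by split; [case: (_ (+) _)|right => /=; case: (_ (+) _)].
Qed.

Lemma chart_ept_Doo b be t : valid be -> inner t -> Doo (chart b (ept be t)).
Proof.
move=> ve ti; have [->|[e [ee [E|E]]]] := bedge_cases b ve.
- apply: interior_Doo; move/andP: ti => [t0 t1].
  have -> : chart b (ept (Bot b) t) = (t * 2^-1, 2^-1).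
    by case: b {ve}; rewrite /= eptE /onside /tau /=; apply: pairP => /=; lra.
  by apply: middle_interior; lra.
- by right; exists e => //; left; have := edge_sourceE ee ti; rewrite E.
- right; exists e => //; right.
  have := edge_sourceE ee ti; have := edge_imageE e t; rewrite E /=.
  rewrite flips_partner partnerK addbK => eI eS.
  by rewrite -eI; exists (chart (b (+) flips be) (ept (partner be) t)).
Qed.

Lemma cl_glue b be t : valid be -> inner t ->
  cl (chart b (ept be t)) = cl (chart (b (+) flips be) (ept (partner be) t)).
Proof.
move=> ve ti.
have D1 := chart_ept_Doo b ve ti.
have D2 : Doo (chart (b (+) flips be) (ept (partner be) t)).
  by apply: chart_ept_Doo => //; rewrite valid_partner.
have [E|[e [ee [E|E]]]] := bedge_cases b ve.
- congr to_surface; rewrite E /=.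
  by case: b {E D1 D2}; rewrite !eptE /onside /tau /=; apply: pairP => /=; lra.
- apply: eq_to_surface => //; exists e; have := edge_sourceE ee ti; have := edge_imageE e t.
  by rewrite E.
- symmetry; apply: eq_to_surface => //; exists e; have := edge_sourceE ee ti; have := edge_imageE e t.
  by rewrite E /= flips_partner partnerK addbK.
Qed.

Lemma DooP q : Doo q -> Dsq° q \/
  exists b be t, [/\ valid be, be <> Bot b, inner t & q = chart b (ept be t)].
Proof.
move=> [|[e ee h]]; [by left|right].
have [t ti H] : exists2 t, inner t & q = chart (bedge_of e).1 (ept (bedge_of e).2 t) \/
   q = edge_image e (chart (bedge_of e).1 (ept (bedge_of e).2 t)).
  case: h => [/(edge_sourceP ee)[t ti ->]|[p /(edge_sourceP ee)[t ti ->] <-]].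
    by exists t => //; left.
  by exists t => //; right.
have ve := valid_bedge_of ee.
case: H => ->.
  by exists (bedge_of e).1, (bedge_of e).2, t; split => //; case: (e).
rewrite edge_imageE.
exists ((bedge_of e).1 (+) flips (bedge_of e).2), (partner (bedge_of e).2), t.
by split => //; [rewrite valid_partner|case: (e)].
Qed.

Lemma Doo_D q : Doo q -> Dsq q.
Proof.
move=> /DooP[/interior_subset//|[b [be [t [ve _ ti ->]]]]].
apply: chart_D; rewrite eptE /onside; have [] := lohi (R:=R) ve.
case/andP: ti => /ltW t0 /ltW t1.
by case: be ve => [h|n|n|n|n] ve /= /andP[? ?] /andP[? ?]; split => /=; apply/andP; split; try lra; nra.
Qed.

Lemma Xoo_chart (x : Xoo R) :
  exists b p, [/\ Esq p, Doo (chart b p), val (projT2 (repr x)) = chart b p & x = cl (chart b p)].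
Proof.
case E: (repr x) => [[] [q h]] /=; have Dq : Doo q by have := h; rewrite inE.
have [b [p [Ep qE]]] := D_chart (Doo_D Dq); exists b, p; rewrite -qE; split => //.
by rewrite (to_surfaceE (S := oo_patchwork R) h) -[LHS]reprK E.
Qed.

End LimitSurface.

(** * Compact subsets of the limit surface lie in some U_g *)

Section LimitCompact.
Context {R : realType}.
Implicit Types (p q z u v d : R * R) (t x y c : R) (n m : nat) (b : bool).

Local Notation Esq := (@Dplus R).
Local Notation Dsq := (@Dplus R `|` @Dminus R).
Local Notation cl p := (@to_surface R (oo_patchwork R) tt p).

Lemma vertices_Esq z : vertices z -> Esq z.
Proof.
move=> [e [ve zE]]; have [/andP[a1 a2] /andP[a3 a4]] := lohi (R:=R) ve.
by case: zE => ->; rewrite /eA /eB /onside; case: e ve a1 a2 a3 a4 => [h|n|n|n|n] /= ve a1 a2 a3 a4;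
  split => /=; apply/andP; split; lra.
Qed.

Lemma vertices_shape z : vertices z ->
  [\/ z.1 = 1, z.2 = 1, z.1 = 0 | z = (2^-1, 2^-1)].
Proof.
move=> [e [ve zE]]; case: e ve zE => [h|n|n|n|n] ve.
- by case: h {ve} => -[] ->; rewrite /eA /eB /onside /=; by [constructor 1|constructor 3|constructor 4].
- by case=> ->; constructor 2.
- by case=> ->; constructor 2.
- by case=> ->; constructor 1.
- by case=> ->; constructor 3.
Qed.

Definition ZD : set (R * R) := [set q | exists b z, vertices z /\ q = chart b z].

Lemma ZD_neq0 : ZD !=set0.
Proof. by case: (@vertices_neq0 R) => z vz; exists z, false, z. Qed.

(** From a vertex on the outer boundary, and from the corners (1/2, 1/2) and (0, 1/2), some
    horizontal, vertical or diagonal displacement by r/2 leaves D. *)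
Lemma ZD_interior q : ZD q -> ~ Dsq° q.
Proof.
move=> [b [z [vz ->]]] /interiorP[r r0 h].
have [/andP[e1 e2] /andP[e3 e4]] := vertices_Esq vz.
have rr : `|r / 2| < r by rewrite ger0_norm; lra.
have H (s t : R) : (s = 0 \/ s = r / 2 \/ s = - (r / 2)) -> (t = 0 \/ t = r / 2 \/ t = - (r / 2)) ->
    Dsq ((chart b z).1 + s, (chart b z).2 + t).
  move=> hs ht; apply: h => /=.
    by rewrite opprD addrA subrr sub0r; case: hs => [->|[|] ->]; rewrite ?oppr0 ?normr0 ?normrN.
  by rewrite opprD addrA subrr sub0r; case: ht => [->|[|] ->]; rewrite ?oppr0 ?normr0 ?normrN.
clear h.
case: (vertices_shape vz) => zE; case: b H => /= H.
- have := H (r / 2) (- (r / 2)) (or_intror (or_introl erefl)) (or_intror (or_intror erefl)).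
  by rewrite zE; clear -r0 e1 e2 e3 e4 => -[] [/= /andP[? ?] /andP[? ?]]; lra.
- have := H (r / 2) 0 (or_intror (or_introl erefl)) (or_introl erefl).
  by rewrite zE; clear -r0 e1 e2 e3 e4 => -[] [/= /andP[? ?] /andP[? ?]]; lra.
- have := H 0 (- (r / 2)) (or_introl erefl) (or_intror (or_intror erefl)).
  by rewrite zE; clear -r0 e1 e2 e3 e4 => -[] [/= /andP[? ?] /andP[? ?]]; lra.
- have := H 0 (r / 2) (or_introl erefl) (or_intror (or_introl erefl)).
  by rewrite zE; clear -r0 e1 e2 e3 e4 => -[] [/= /andP[? ?] /andP[? ?]]; lra.
- have := H (- (r / 2)) 0 (or_intror (or_intror erefl)) (or_introl erefl).
  by rewrite zE; clear -r0 e1 e2 e3 e4 => -[] [/= /andP[? ?] /andP[? ?]]; lra.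
- have := H (- (r / 2)) (r / 2) (or_intror (or_intror erefl)) (or_intror (or_introl erefl)).
  by rewrite zE; clear -r0 e1 e2 e3 e4 => -[] [/= /andP[? ?] /andP[? ?]]; lra.
- have := H (- (r / 2)) (r / 2) (or_intror (or_intror erefl)) (or_intror (or_introl erefl)).
  by rewrite zE; clear -r0 e1 e2 e3 e4 => -[] [/= /andP[? ?] /andP[? ?]]; lra.
- have := H (r / 2) (- (r / 2)) (or_intror (or_introl erefl)) (or_intror (or_intror erefl)).
  by rewrite zE; clear -r0 e1 e2 e3 e4 => -[] [/= /andP[? ?] /andP[? ?]]; lra.
Qed.

(** Apart from the segment [Bot b], which both copies share, an edge is separated from the other
    copy by a line through one of its ends or lies on the far side of its own copy. Vertices of the
    other copy are thus no nearer than its endpoints. *)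
Lemma cross_copy b be t z : valid be -> be <> Bot b -> 0 <= t <= 1 -> Esq z ->
  tent t * len be <= enorm (chart b (ept be t) - chart (~~ b) z).
Proof.
move=> ve ne t01 [/andP[z1 z2] /andP[z3 z4]].
have [/andP[a1 a2] /andP[a3 a4]] := lohi (R:=R) ve.
have h1 := ler_enorm1 (chart b (ept be t) - chart (~~ b) z).
have h2 := ler_enorm2 (chart b (ept be t) - chart (~~ b) z).
have G (x : R) : (x <= lo be /\ x <= hi be) \/ (lo be <= x /\ hi be <= x) ->
    tent t * len be <= `|lo be + t * (hi be - lo be) - x|.
  exact: gap.
have F : tent t * len be <= (2 : R)^-1.
  by have := len_le (R:=R) ve; have := len_gt0 (R:=R) ve; have := tent_le t; nra.
move: h1 h2; rewrite eptE /onside; set s := (lo be + _) in G *.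
have A (x y : R) : x <= y \/ x <= - y -> x <= `|y|.
  by rewrite ler_normr => -[->|->]; rewrite ?orbT.
have S1 c : c <= lo be -> c <= hi be -> c <= s by exact: conv_ge.
have S2 c : lo be <= c -> hi be <= c -> s <= c by exact: conv_le.
clearbody s.
case: be ve ne a1 a2 a3 a4 S1 S2 G F => [h|n|n|n|n] ve ne a1 a2 a3 a4 S1 S2 G F h1 h2.
- have {ne}hb : h = ~~ b by case: h b ne {G F h1 h2 a1 a2 a3 a4 ve S1 S2} => [] [].
  case: b hb h1 h2 => hb; rewrite {h}hb in a1 a2 a3 a4 ve G F S1 S2 * => /= h1 _; apply: le_trans h1.
    have sl : s <= 2^-1 by apply: S2 => /=; lra.
    have := G 2^-1 ltac:(right; split; rewrite /=; lra); rewrite ler0_norm ?subr_le0// => /le_trans; apply.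
    by apply: A; right; lra.
  have sl : 2^-1 <= s by apply: S1 => /=; lra.
  have := G 2^-1 ltac:(left; split; rewrite /=; lra); rewrite ger0_norm ?subr_ge0// => /le_trans; apply.
  by apply: A; left; lra.
- by apply: le_trans h2; apply: A; case: (b) => /=; [right|left]; lra.
- by apply: le_trans h2; apply: A; case: (b) => /=; [right|left]; lra.
- case: b ne h1 h2 => /= ne h1 h2; last by apply: le_trans h1; apply: A; left; lra.
  apply: le_trans h2; have sl : 2^-1 <= s by exact: S1.
  have := G 2^-1 ltac:(by left); rewrite ger0_norm ?subr_ge0// => /le_trans; apply.
  by apply: A; right; lra.
- case: b ne h1 h2 => /= ne h1 h2; first by apply: le_trans h1; apply: A; right; lra.
  apply: le_trans h2; have sl : 2^-1 <= s by exact: S1.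
  have := G 2^-1 ltac:(by left); rewrite ger0_norm ?subr_ge0// => /le_trans; apply.
  by apply: A; left; lra.
Qed.

Definition distD := setdist ZD.

Lemma distD_ept b be t : valid be -> be <> Bot b -> 0 <= t <= 1 ->
  distD (chart b (ept be t)) = tent t * len be.
Proof.
move=> ve ne t01; apply/le_anti/andP; split; last first.
  apply: (le_setdist ZD_neq0) => _ [b' [z [vz ->]]].
  have [->|bb] := eqVneq b' b; first by rewrite chartB; exact: ept_vertex.
  have -> : b' = ~~ b by case: (b) (b') bb => [] [].
  by apply: cross_copy => //; exact: vertices_Esq.
rewrite -distZ_ept//; apply: (le_setdist (@vertices_neq0 R)) => z vz.
by rewrite -(chartB b); apply: (setdist_le ZD_neq0); exists b, z.
Qed.

Lemma tent_gt0 t : inner t -> 0 < tent t.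
Proof. by move=> /andP[t0 t1]; rewrite lt_min t0 subr_gt0. Qed.

Lemma inner_le t : inner t -> 0 <= t <= 1.
Proof. by move=> /andP[/ltW -> /ltW ->]. Qed.

Lemma distD_gt0 q : Doo q -> 0 < distD q.
Proof.
move=> /DooP[qi|[b [be [t [ve ne ti ->]]]]]; last first.
  by rewrite distD_ept// ?inner_le// mulr_gt0 ?tent_gt0 ?len_gt0.
have /interiorP[r r0 h] := qi.
rewrite ltNge; apply/negP => d0.
have [z Zz hz] := setdist_near ZD_neq0 q r0.
have {}hz : enorm (q - z) < r by apply: lt_le_trans hz _; rewrite -[leRHS]add0r lerD2r.
apply: (ZD_interior Zz); have oi : open (Dsq°) by exact: open_interior.
have e1 := ler_enorm1 (q - z); have e2 := ler_enorm2 (q - z).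
apply/interiorP; exists (r - enorm (q - z)); first by rewrite subr_gt0.
move=> p h1 h2; apply: h.
  have := ler_distD z.1 q.1 p.1; move: e1 h1 => /=.
  by move: (`|_|) (`|_|) (`|_|) (enorm _) => *; lra.
have := ler_distD z.2 q.2 p.2; move: e2 h2 => /=.
by move: (`|_|) (`|_|) (`|_|) (enorm _) => *; lra.
Qed.

Lemma vertex_notin b z : vertices z -> ~ Doo (chart b z).
Proof.
move=> vz /distD_gt0; apply/negP; rewrite -leNgt.
apply: le_trans (setdist_le ZD_neq0 (chart b z) (z := chart b z) _) _; first by exists b, z.
by rewrite subrr enorm0.
Qed.

(** An edge omitted from U_g has length at most 2^-(N+1), so its points are too close to a
    vertex. *)
Lemma kept_edgesP (d : R) q (g : nat) : Doo q -> d <= distD q -> (2 : R) ^- (N g).+1 < d ->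
  D_with (kept_edges g) q.
Proof.
move=> Dq dq Nd; case: (Dq) => [|[e ee h]]; first by left.
have [ke|nke] := pselect (kept_edges g e); first by right; exists e.
exfalso.
have ve := valid_bedge_of ee.
have [b [be [t [ve' ne lb ti qE]]]] : exists b be t, [/\ valid be, be <> Bot b,
    len (R:=R) be = len (bedge_of e).2, inner t & q = chart b (ept be t)].
  case: h => [/(edge_sourceP ee)[t ti ->]|[p /(edge_sourceP ee)[t ti ->] <-]].
    by exists (bedge_of e).1, (bedge_of e).2, t; split => //; case: (e).
  rewrite edge_imageE; eexists _, _, t; split; last reflexivity.
  - by rewrite valid_partner.
  - by case: (e).
  - by rewrite len_partner.
  - by [].
move: dq; rewrite qE distD_ept ?inner_le// lb leNgt; apply/negP; rewrite -leNgt.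
have n1 : (N g < edge_index e)%N.
  have MN : (N g <= M g)%N by rewrite /N /M half_leq// leq_pred.
  move: nke ee; rewrite /kept_edges /edges; case: (e) => [|n|n|n|n] /= nke ee.
  - by exfalso; apply: nke.
  - by rewrite ltnNge; apply/negP => ?; apply: nke.
  - by rewrite ltnNge; apply/negP => ?; apply: nke.
  - by rewrite ltnNge; apply/negP => ?; apply: nke; split => //; exact: leq_trans MN.
  - by rewrite ltnNge; apply/negP => ?; apply: nke; split => //; exact: leq_trans MN.
have : len (R:=R) (bedge_of e).2 <= 2 ^- (N g).+1.
  have [eI|eI] := pselect (e = EdgeI).
    by exfalso; apply: nke; rewrite eI.
  rewrite lenE//; case: (e) eI n1 => [//|n|n|n|n] _ /= n1; apply: half_le; exact: ltnW.
have := tent_le t; have := tent_gt0 ti; have := half_gt0 (R:=R) (N g).+1; nra.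
Qed.

End LimitCompact.

(** * Distances in the limit surface *)

Section LimitMetric.
Context {R : realType}.
Implicit Types (p q z u v : R * R) (t c d : R) (n m : nat) (b : bool).

Local Notation Esq := (@Dplus R).
Local Notation Dsq := (@Dplus R `|` @Dminus R).
Local Notation cl p := (@to_surface R (oo_patchwork R) tt p).

Lemma nonexpanding_continuous (f : R * R -> R) : nonexpanding f -> continuous f.
Proof.
move=> fL p; apply/cvgrPdist_lt => e e0.
have e2 : 0 < e / 2 by rewrite divr_gt0.
exists (ball p.1 (e / 2), ball p.2 (e / 2)).
  by split; exact: nbhsx_ballx.
move=> q [/= h1 h2]; apply: le_lt_trans (nonexpanding_abs _ _ fL) _.
apply: le_lt_trans (enorm_le12 _) _ => /=.
by rewrite [ltRHS]splitr ltrD.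
Qed.

(** The distance in D to the vertices agrees on glued points, hence descends to a continuous
    positive function on X_oo. On a compact set it has a positive lower bound d, and points at
    distance at least d avoid the short omitted edges. *)
Lemma compact_in_U (K : set (Xoo R)) : compact K ->
  exists G, forall g, (G <= g)%N -> K `<=` @U R g.
Proof.
move=> cK.
pose V : points (oo_patchwork R) -> R := unstable.sigT_fun (fun i : unit => distD \o @set_val _ (region (oo_patchwork R) i)).
have Vc : continuous V.
  apply: sigT_continuous => i q; apply: continuous_comp.
    exact: initial_continuous.
  exact: nonexpanding_continuous (setdist_nonexpanding ZD_neq0) _.
have Vg (a b : points (oo_patchwork R)) : glue_step a b -> V a = V b.
  case: a b => [[] [p hp]] [[] [q hq]] [e [ee /= hs qE]].
  have [t ti pE] := edge_sourceP ee hs.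
  rewrite /V /unstable.sigT_fun /= !set_valE /= qE pE edge_imageE !distD_ept ?inner_le ?len_partner ?valid_partner ?valid_bedge_of//.
    by case: (e).
  by case: (e).
pose W : Xoo R -> R := V \o repr.
have Wc : continuous W.
  apply: repr_comp_continuous Vc _ => a b /eqP/eqmodP/asboolP.
  by elim=> [c d /Vg ->|c|c d _ /eqP ->|c d h _ /eqP -> _].
have Wpos (x : Xoo R) : 0 < W x.
  rewrite /W /V /=; case: (repr x) => [[] [p hp]] /=; rewrite set_valE /=.
  by apply: distD_gt0; have := hp; rewrite inE.
have [d d0 Kd] : exists2 d : R, 0 < d & forall x : Xoo R, K x -> d <= W x.
  have /continuous_compact/(_ cK)/compact_bounded[B [_ HB]] : {within K, continuous (fun x => (W x)^-1)}.
    by apply: continuous_subspaceT => x; apply: cvgV; [exact: nbhs_filter|rewrite gt_eqF|exact: Wc].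
  exists (`|B| + 1)^-1; first by rewrite invr_gt0 ltr_wpDl.
  move=> x Kx; rewrite -[W x]invrK lef_pV2 ?posrE ?invr_gt0 ?ltr_wpDl//.
  have := HB (`|B| + 1); rewrite ltr_pwDr ?ler_norm// => /(_ isT (W x)^-1) => h.
  by apply: le_trans (ler_norm _) (h _); exists x.
have [n hn] : exists n, 2 ^- n.+1 < d.
  apply: contrapT => H; have : d = 0; last by move/eqP; rewrite gt_eqF.
  apply: (@half_eq0 _ _ 1) => n; rewrite gtr0_norm// mul1r leNgt; apply/negP => h.
  by apply: H; exists n.
exists n.*2.+1 => g gn x Kx; have [b [p [Ep Dp pE ->]]] := Xoo_chart x.
exists (chart b p) => //; apply: (@kept_edgesP _ d) => //.
  have := Kd x Kx; rewrite /W /V /= -pE.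
  by case: (repr x) => [[] ?].
apply: le_lt_trans hn; apply: half_le; rewrite ltnS /N; lia.
Qed.

Lemma chart_segment b p q : Esq p -> Eint q -> Doo (chart b p) ->
  segment (chart b p) (chart b q) `<=` (@Doo R).
Proof.
move=> Ep Eq Dp r [t /andP[t0 t1] ->].
have [->|tn] := eqVneq t 0; first by rewrite subr0 scale1r scale0r addr0.
have {}tn : 0 < t by rewrite lt_def tn.
rewrite -chart_conv; apply: interior_Doo; apply: chart_interior.
move: Ep Eq => [/andP[? ?] /andP[? ?]] [/andP[? ?] /andP[? ?]].
by split; rewrite !planeE /=; apply/andP; split; nra.
Qed.

(** The straight segment may run along the boundary through removed points. It is replaced by two
    segments through its midpoint pushed slightly towards the interior point (1/2, 3/4). *)
Lemma chart_path b p q d : 0 < d -> Esq p -> Esq q -> Doo (chart b p) -> Doo (chart b q) ->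
  exists2 l, broken_path (cl (chart b p)) (cl (chart b q)) l & l <= enorm (p - q) + d.
Proof.
move=> d0 Ep Eq Dp Dq.
pose s := Num.min (d / 4) (2^-1).
have s0 : 0 < s by rewrite lt_min; lra.
have s1 : s <= d / 4 by rewrite ge_min lexx.
have s2 : s <= 2^-1 by rewrite ge_min lexx orbT.
clearbody s; pose mid := 2^-1 *: (p + q); pose r := (1 - s) *: mid + s *: (2^-1, 3 / 4).
have Er : Eint r.
  move: Ep Eq => [/andP[? ?] /andP[? ?]] [/andP[? ?] /andP[? ?]].
  by split; rewrite /r /mid !planeE /=; apply/andP; split; nra.
have P1 := broken_path_seg (S := oo_patchwork R) (i := tt) (chart_segment Ep Er Dp).
have P2 := broken_path_sym (broken_path_seg (S := oo_patchwork R) (i := tt) (chart_segment Eq Er Dq)).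
exists (enorm (chart b r - chart b p) + enorm (chart b r - chart b q)).
  exact: broken_path_trans P1 P2.
rewrite !chartB.
have rm : enorm (r - mid) <= 2 * s.
  rewrite (_ : r - mid = s *: ((2^-1, 3 / 4) - mid)); last first.
    by rewrite /r; apply: pairP; rewrite !planeE /=; ring.
  rewrite enormZ gtr0_norm// [leRHS]mulrC ler_pM2l//; apply: le_trans (enorm_le12 _) _.
  move: Ep Eq => [/andP[? ?] /andP[? ?]] [/andP[? ?] /andP[? ?]].
  rewrite [leRHS](_ : 2 = 1 + 1 :> R); last by lra.
  by apply: lerD; rewrite ler_norml /mid !planeE /=; apply/andP; split; lra.
have h1 : enorm (mid - p) = enorm (p - q) / 2.
  rewrite (_ : mid - p = - (2^-1 *: (p - q))); last by apply: pairP; rewrite /mid !planeE /=; field.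
  by rewrite enormN enormZ ger0_norm// mulrC.
have h2 : enorm (mid - q) = enorm (p - q) / 2.
  rewrite (_ : mid - q = 2^-1 *: (p - q)); last by apply: pairP; rewrite /mid !planeE /=; field.
  by rewrite enormZ ger0_norm// mulrC.
have := enorm_tri mid r p; have := enorm_tri mid r q; rewrite h1 h2.
by move: (enorm (r - p)) (enorm (r - q)) (enorm _) (enorm _) rm => *; lra.
Qed.

Lemma chart_dist b p q : Esq p -> Esq q -> Doo (chart b p) -> Doo (chart b q) ->
  flat_dist (cl (chart b p)) (cl (chart b q)) <= enorm (p - q).
Proof.
move=> Ep Eq Dp Dq; apply/ler_addgt0Pr => d d0.
by have [l /flat_dist_le h1 h2] := chart_path d0 Ep Eq Dp Dq; exact: le_trans h1 h2.
Qed.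

Lemma Esq_diam p q : Esq p -> Esq q -> enorm (p - q) <= 3 / 2.
Proof.
move=> [/andP[? ?] /andP[? ?]] [/andP[? ?] /andP[? ?]].
apply: le_trans (enorm_le12 _) _; rewrite (_ : 3 / 2 = 1 + 2^-1); last lra.
by rewrite !planeE /=; apply: lerD; rewrite ler_norml; apply/andP; split; lra.
Qed.

(** Both copies contain the point (1/4, 1/2) of the middle segment; each half of the path is at most
    3/2 + 1/2 long. *)
Lemma Xoo_connected_diam (x y : Xoo R) :
  exists2 l, broken_path x y l & l <= 4.
Proof.
have [b [p [Ep Dp _ ->]]] := Xoo_chart x; have [b' [q [Eq Dq _ ->]]] := Xoo_chart y.
pose m (c : bool) : R * R := if c then (3 / 4, 2^-1) else (4^-1, 2^-1).
have Em (c : bool) : Esq (m c) by case: c; split => /=; apply/andP; split; lra.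
have mE (c : bool) : chart c (m c) = (4^-1, 2^-1).
  by case: c => //=; apply: pairP; rewrite /tau /=; lra.
have Dm (c : bool) : Doo (chart c (m c)).
  by rewrite mE; apply: interior_Doo; apply: middle_interior; lra.
have h0 : 0 < (2^-1 : R) by lra.
have [l1 P1 L1] := chart_path h0 Ep (Em b) Dp (Dm b).
have [l2 P2 L2] := chart_path h0 (Em b') Eq (Dm b') Dq.
exists (l1 + l2); last by have := Esq_diam Ep (Em b); have := Esq_diam (Em b') Eq; lra.
by apply: broken_path_trans P1 _; rewrite !mE in P2 *.
Qed.

Lemma Xoo_connected : connected_surface (oo_patchwork R).
Proof. by move=> x y; have [l h _] := Xoo_connected_diam x y; exists l. Qed.

Lemma Xoo_diam (x y : Xoo R) : flat_dist x y <= 4.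
Proof. by have [l /flat_dist_le h1 h2] := Xoo_connected_diam x y; exact: le_trans h2. Qed.

End LimitMetric.

(** * McShane extension of Lipschitz functions *)

Section McShane.
Context {R : realType}.
Variables (L : R) (G : R * R -> R -> Prop).
Hypothesis L0 : 0 <= L.
Hypothesis GL : forall p y q z, G p y -> G q z -> y - z <= L * enorm (p - q).
Hypothesis G0 : exists p y, G p y.

(** [G] is the graph of a partial function, given as a relation; its single-valuedness is the case p
    = q of the Lipschitz condition [GL]. *)
Definition mcshane (p : R * R) : R :=
  inf [set x | exists q y, G q y /\ x = y + L * enorm (p - q)].

Lemma mcshane_has p : has_inf [set x | exists q y, G q y /\ x = y + L * enorm (p - q)].
Proof.
have [q0 [y0 G00]] := G0; split; first by exists (y0 + L * enorm (p - q0)), q0, y0.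
exists (y0 - L * enorm (q0 - p)) => _ [q [y [Gq ->]]].
have := GL G00 Gq; have := ler_wpM2l L0 (enorm_tri p q0 q); rewrite mulrDr.
by move: (L * _) (L * _) (L * _) => *; lra.
Qed.

Lemma mcshaneE p y : G p y -> mcshane p = y.
Proof.
move=> Gp; apply/le_anti/andP; split.
  apply: ge_inf; first by have [] := mcshane_has p.
  by exists p, y; split => //; rewrite subrr enorm0 mulr0 addr0.
apply: lb_le_inf; first by have [] := mcshane_has p.
by move=> _ [q [z [Gq ->]]]; rewrite -lerBlDl; exact: GL.
Qed.

Lemma mcshane_lip p q : mcshane p - mcshane q <= L * enorm (p - q).
Proof.
rewrite lerBlDl; apply/ler_addgt0Pr => e e0.
have [_ [r [y [Gr ->]]] h] := inf_adherent e0 (mcshane_has q).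
have : mcshane p <= y + L * enorm (p - r).
  by apply: ge_inf; [have [] := mcshane_has p|exists r, y].
have := ler_wpM2l L0 (enorm_tri q p r); rewrite mulrDr; rewrite -/(mcshane q) in h.
by move: (mcshane p) (mcshane q) h => A B h h1 h2; lra.
Qed.

End McShane.

(** * The distance to a point as a function on two squares *)

Section LimitPotential.
Context {R : realType}.
Implicit Types (p q z u v : R * R) (t c d : R) (n m : nat) (b : bool).
Variable x : Xoo R.

Local Notation Esq := (@Dplus R).
Local Notation cl p := (@to_surface R (oo_patchwork R) tt p).

Definition potential_graph b q d :=
  [/\ Esq q, Doo (chart b q) & d = flat_dist x (cl (chart b q))].

(** The distance to [x] makes sense only at boundary points that were not removed; the extension
    gives values on the whole closed square, in particular at the vertices. *)
Definition potential b := mcshane 1 (potential_graph b).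

Lemma potential_graph_lip b p d q c : potential_graph b p d -> potential_graph b q c ->
  d - c <= 1 * enorm (p - q).
Proof.
move=> [Ep Dp ->] [Eq Dq ->]; rewrite mul1r lerBlDl.
apply: le_trans (flat_dist_tri Xoo_connected (cl (chart b q)) _ _) _.
by rewrite lerD2l enormC chart_dist.
Qed.

Lemma potential_graph_neq0 b : exists p d, potential_graph b p d.
Proof.
exists (2^-1, 3 / 4); eexists; split; last reflexivity.
  by split => /=; apply/andP; split; lra.
by apply: interior_Doo; apply: chart_interior; split => /=; apply/andP; split; lra.
Qed.

Lemma potential_nonexpanding b : nonexpanding (potential b).
Proof.
move=> p q; rewrite -[leRHS]mul1r.
exact: (mcshane_lip ler01 (@potential_graph_lip b) (potential_graph_neq0 b)).
Qed.

Lemma potentialE b p : Esq p -> Doo (chart b p) -> potential b p = flat_dist x (cl (chart b p)).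
Proof.
move=> Ep Dp; apply: (mcshaneE ler01 (@potential_graph_lip b) (potential_graph_neq0 b)).
by split.
Qed.

Lemma ept_Esq be t : valid be -> 0 <= t <= 1 -> Esq (ept be t).
Proof.
move=> ve t01; apply: Esq_conv => //; apply: vertices_Esq.
  exact: vertices_eA.
exact: vertices_eB.
Qed.

(** Both sides are Lipschitz in the parameter, so the identity on open edges passes to their
    endpoints. *)
Lemma edge_invariant_inner (f : bool -> R * R -> R) : (forall b, nonexpanding (f b)) ->
  (forall b e t, valid e -> inner t -> f b (ept e t) = f (b (+) flips e) (ept (partner e) t)) ->
  edge_invariant f.
Proof.
move=> fL fI b e t ve t01.
have S (t' : R) : inner t' -> `|f b (ept e t) - f (b (+) flips e) (ept (partner e) t)| <= 2 * `|t - t'|.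
  move=> ti; have K (c : bool) e' : valid e' -> `|f c (ept e' t) - f c (ept e' t')| <= `|t - t'|.
    move=> ve'; apply: le_trans (nonexpanding_abs _ _ (fL c)) _.
    rewrite ept_sub enormZ enorm_edge -[leRHS]mulr1 ler_wpM2l//.
    by have := len_le (R:=R) ve'; lra.
  have := K b e ve; have := K (b (+) flips e) (partner e); rewrite valid_partner => /(_ ve).
  rewrite (fI b e t')//; move: (f b _) (f _ _) (f _ _) => A B C.
  by have := ler_distD B A C; rewrite (distrC C B); lra.
apply/eqP; rewrite -subr_eq0; apply/eqP; apply: (@half_eq0 _ _ 2) => n.
have hn := half_gt0 (R:=R) n.+1; have hn1 : (2 : R) ^- n.+1 <= 2^-1 by exact: half_le2.
case/andP: t01 => t0 t1; have [tl|tl] := leP t (2^-1).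
  apply: le_trans (S (t + 2 ^- n.+1 / 2) _) _; first by rewrite /inner; apply/andP; split; lra.
  by rewrite opprD addrA subrr sub0r normrN ger0_norm; lra.
apply: le_trans (S (t - 2 ^- n.+1 / 2) _) _; first by rewrite /inner; apply/andP; split; lra.
by rewrite opprB addrC subrK ger0_norm; lra.
Qed.

Lemma potential_invariant : edge_invariant potential.
Proof.
apply: edge_invariant_inner => [b|b e t ve ti]; first exact: potential_nonexpanding.
have ve' : valid (partner e) by rewrite valid_partner.
have t01 := inner_le ti.
rewrite !potentialE; [|exact: ept_Esq|exact: chart_ept_Doo|exact: ept_Esq|exact: chart_ept_Doo].
by rewrite (cl_glue b ve ti).
Qed.

End LimitPotential.

(** * The surface X_g *)

Section Coordinates.
Context {R : realType}.
Variable g : nat.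
Hypothesis g3 : (3 <= g)%N.
Local Notation a := (alpha R g).
Local Notation P := (@P R g).
Local Notation Q := (@Q R g).
Local Notation M := (M g).
Local Notation N := (N g).
Implicit Types (i k n : nat).

Lemma M_gt0 : (0 < M)%N. Proof. by rewrite /Defs.M; lia. Qed.
Lemma M_le : (M.*2 <= g)%N. Proof. by rewrite /Defs.M; lia. Qed.
Lemma NM : (N + M).+1 = g. Proof. by rewrite /Defs.N /Defs.M; lia. Qed.
Lemma N_gt0 : (0 < N)%N. Proof. by rewrite /Defs.N; lia. Qed.
Lemma N_le : (N <= M)%N. Proof. by rewrite /Defs.N /Defs.M; lia. Qed.
Lemma M_le_N : (M <= N.+1)%N. Proof. by rewrite /Defs.N /Defs.M; lia. Qed.

Lemma alpha1_neq0 : 1 - a != 0.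
Proof. by rewrite subr_eq0 eq_sym lt_eqF// alpha_lt1. Qed.

Lemma alpha1_gt0 : 0 < 1 - a.
Proof. by rewrite subr_gt0 alpha_lt1. Qed.

Lemma QE i : (0 < i)%N ->
  Q i = ((2 * a - a ^+ i - a ^+ i.+1) / (2 * (1 - a)), (a - a ^+ (g - i + 2)) / (1 - a)).
Proof. by case: i. Qed.

Lemma PE i : (1 < i < g)%N -> P i = ((a - a ^+ i) / (1 - a), a / (1 - a)).
Proof.
move=> /andP[i1 ig]; rewrite /Defs.P; case: i i1 ig => [|[|i]]//= _ ig.
by rewrite ltn_eqF.
Qed.

Lemma Pg : P g = (1 + (a - a ^+ g) / 2, (3 * a - 1 - a ^+ 2) / (1 - a)).
Proof.
have g0 : (g == 0%N) = false by apply/negbTE; lia.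
have g1 : (g == 1%N) = false by apply/negbTE; lia.
by rewrite /Defs.P g0 g1 eqxx.
Qed.

Lemma P1E : P 1 = (- ((a ^+ g.-1 + a ^+ g) / 2), (a - a ^+ 2 + a ^+ 3) / (1 - a)).
Proof. by []. Qed.

Lemma alphaSg : a * a ^+ g = 2 * a - 1.
Proof. by rewrite -exprS alpha_eq. Qed.

Lemma QP_diff i : (1 < i < g)%N -> Q i - P i = (a ^+ i / 2, - (a ^+ (g - i + 2) / (1 - a))).
Proof.
move=> ig; rewrite QE ?PE//; last by lia.
have a1 := alpha1_neq0; apply: pairP; rewrite !planeE /= ?exprS; by field; rewrite ?a1.
Qed.

Lemma PQ_diff i : (0 < i < g.-1)%N -> P i.+1 - Q i = (a ^+ i / 2, a ^+ (g - i + 2) / (1 - a)).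
Proof.
move=> ig; rewrite QE ?PE//; [|lia|lia].
have a1 := alpha1_neq0; apply: pairP; rewrite !planeE /= ?exprS; by field; rewrite ?a1.
Qed.

(** The zigzag of vertices on the left side of Pi_g: for k >= 2 the k-th triangle is attached along
    W_(k-2) W_(k-1) and adds W_k. The triangle attached first fills the upper left corner instead,
    and its new vertex is not [W 1]. *)
Definition W k : R * R :=
  if k == 0%N then Q 0 else if k == 1%N then P 1 else new_vertex g k.

Local Notation shift := (@attach_shift R g).

Lemma shiftE k : (1 < k)%N -> shift k = W k.-1 - mirror (odd k) (P (g - k.-1)).
Proof. by case: k => [|[|[|k]]]//= _; [rewrite subn1|rewrite /W /new_vertex /= !negbK]. Qed.

Definition C0 : R := a ^+ 3 / ((1 - a) * (1 + a)).

Lemma alphaD1_neq0 : 1 + a != 0.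
Proof. by rewrite gt_eqF// addr_gt0 ?alpha_gt0. Qed.

Lemma mirrorB b (p q : R * R) : mirror b (p - q) = mirror b p - mirror b q.
Proof. by case: b => //; apply: pairP; rewrite /mirror !planeE /=; ring. Qed.

Lemma mirrorD b (p q : R * R) : mirror b (p + q) = mirror b p + mirror b q.
Proof. by case: b => //; apply: pairP; rewrite /mirror !planeE /=; ring. Qed.

Lemma mirror_mirror b c (p : R * R) : mirror b (mirror c p) = mirror (b (+) c) p.
Proof. by case: b; case: c; apply: pairP => //=; rewrite opprK. Qed.

Lemma mirrorK b : involutive (@mirror R b).
Proof. by move=> p; rewrite mirror_mirror addbb. Qed.

Lemma mirror_conv b t (p q : R * R) :
  mirror b ((1 - t) *: p + t *: q) = (1 - t) *: mirror b p + t *: mirror b q.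
Proof. by case: b => //; apply: pairP; rewrite /mirror !planeE /=; ring. Qed.

Lemma enorm_mirror b (p : R * R) : enorm (mirror b p) = enorm p.
Proof. by case: b => //; rewrite /enorm /= sqrrN. Qed.

Lemma signE k : (-1) ^+ odd k * a ^+ k = (- a) ^+ k.
Proof. by rewrite [RHS]exprNn signr_odd. Qed.

Lemma WS k : (0 < k)%N -> (k < g.-1)%N -> W k.+1 = W k + (- (a ^+ (g - k.+1) / 2), (- a) ^+ k * (a ^+ 3 / (1 - a))).
Proof.
move=> k0 kg; rewrite {1}/W /= eqSS (negbTE (lt0n_neq0 k0)) /new_vertex eqSS (negbTE (lt0n_neq0 k0)).
rewrite shiftE //= -addrA [- _ + _]addrC -mirrorB; congr (_ + _).
have -> : (g - k = (g - k.+1).+1)%N by lia.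
have -> : Q (g - k.+1) - P (g - k.+1).+1 = - (P (g - k.+1).+1 - Q (g - k.+1)) by rewrite opprB.
rewrite PQ_diff; last by lia.
have -> : (g - (g - k.+1) + 2 = k + 3)%N by lia.
rewrite -signE exprD; case: (odd k); apply: pairP; rewrite /mirror !planeE /=; ring.
Qed.

(** The steps [WS] are summed: the abscissae give a geometric series, the heights an alternating one
    oscillating about alpha + [C0]. *)
Lemma WE k : (k < g)%N ->
  W k = (- ((a ^+ (g - k) - a ^+ g.+1) / (2 * (1 - a))), a + C0 * (1 - (- a) ^+ k)).
Proof.
have a1 := alpha1_neq0; have a2 := alphaD1_neq0.
elim: k => [|k IH] kg.
  by rewrite /W /= subn0 expr0; apply: pairP; rewrite ?planeE /= ?exprS; field.
case: k IH kg => [|k] IH kg.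
  rewrite /W /= /Defs.P /=.
  have E : (g - 1 = g.-1)%N by lia.
  rewrite E; have Eg : g = g.-1.+1 by lia.
  have e1 : a ^+ g = a * a ^+ g.-1 by rewrite -exprS -Eg.
  apply: pairP; rewrite ?planeE /= ?exprS ?e1 /C0; field.
    by [].
  by rewrite a1 a2.
rewrite WS ?IH//; [|lia|lia].
have -> : (g - k.+1 = (g - k.+2).+1)%N by lia.
apply: pairP; rewrite ?planeE /= ![a ^+ (_).+1]exprS ?[(- a) ^+ k.+2]exprS /C0; field.
  by [].
by rewrite a1 a2.
Qed.

Lemma shift1 : mirror true (P g) + shift 1 = Q 1.
Proof.
rewrite (_ : shift 1 = P 1 - mirror true (Q g.-1))// Pg (@QE 1)// (@QE g.-1); last by lia.
have a1 := alpha1_neq0.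
have -> : (g - g.-1 + 2 = 3)%N by lia.
have -> : (g - 1 + 2 = g.+1)%N by lia.
have e1 : a ^+ g = a * a ^+ g.-1 by rewrite -exprS; congr (_ ^+ _); lia.
have e2 := alphaSg; rewrite e1 in e2.
have e3 : g.-1.+1 = g by lia.
have a0 : a != 0 by rewrite gt_eqF ?alpha_gt0.
(* The defining equation solved for alpha^(g-1); the identity to be proved relies on it. *)
have eu : a ^+ g.-1 = (2 * a - 1) / (a * a) by rewrite -e2; field.
rewrite P1E e3 [a ^+ g.+1]exprS e1 eu.
by apply: pairP; rewrite /mirror ?planeE /= ?exprS ?expr0; field; rewrite ?a1 ?a0.
Qed.

Lemma shift1' : mirror true (Q g) + shift 1 = (0, a / (1 - a)).
Proof.
rewrite (_ : shift 1 = P 1 - mirror true (Q g.-1))// (@QE g) ?(@QE g.-1); [|lia|lia].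
have a1 := alpha1_neq0.
have -> : (g - g.-1 + 2 = 3)%N by lia.
have -> : (g - g + 2 = 2)%N by lia.
have e3 : g.-1.+1 = g by lia.
have e1 : a ^+ g = a * a ^+ g.-1 by rewrite -exprS e3.
rewrite e3; apply: pairP; rewrite /mirror ?planeE /= ?exprS ?e1.
  by field.
by field.
Qed.

Lemma shift1'' : mirror true (Q g.-1) + shift 1 = P 1.
Proof. by rewrite addrC subrK. Qed.

Lemma new_vertex1 : new_vertex g 1 = (0, a / (1 - a)) :> R * R.
Proof. by rewrite /new_vertex eqxx addrC shift1'. Qed.

(** The translation is chosen to place one end of the attaching edge; since glued edges differ by a
    translation, the other end falls into place as well. *)
Lemma shift_vertices k : (1 < k <= M)%N ->
  [/\ mirror (odd k) (P (g - k.-1)) + shift k = W k.-1,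
      mirror (odd k) (Q (g - k)) + shift k = W k &
      mirror (odd k) (Q (g - k.-1)) + shift k = W k.-2].
Proof.
move=> kM; have MM := M_le; split.
- by rewrite shiftE ?subrKC//; lia.
- by case: k kM => [|[|k]]//= kM; rewrite addrC.
case: k kM => [|[|k]]// kM; rewrite shiftE// addrCA -mirrorB /=.
rewrite QP_diff; last by lia.
case: k kM => [|k] kM.
  rewrite /= !WE; [|lia|lia].
  rewrite subn1; have -> : (g - g.-1 + 2 = 3)%N by lia.
  have e3 : g.-1.+1 = g by lia.
  have e1 : a ^+ g = a * a ^+ g.-1 by rewrite -exprS e3.
  have a1 := alpha1_neq0; have a2 := alphaD1_neq0.
  by apply: pairP; rewrite ?planeE /= ?subn0 ?subn1 ?exprS ?e1 /C0; field; rewrite ?a1 ?a2.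
rewrite WS; [|lia|lia].
rewrite -[RHS]addr0 -addrA; congr (_ + _).
have -> : (g - (g - k.+2) + 2 = k.+1 + 3)%N by lia.
rewrite -signE exprD /=.
by case: (odd k); apply: pairP; rewrite /mirror ?planeE /=; ring.
Qed.

End Coordinates.

Section TriangleMaps.
Context {R : realType}.
Implicit Types (p A B C t : R * R).

Lemma triangle_shift A B C p t : triangle (A + t) (B + t) (C + t) (p + t) <-> triangle A B C p.
Proof.
have H A' B' C' p' t' : triangle A' B' C' p' -> triangle (A' + t') (B' + t') (C' + t') (p' + t').
  move=> [x [y [z [x0 y0 z0 s ->]]]]; exists x, y, z; split => //.
  rewrite !scalerDr -[t' in LHS]scale1r -s !scalerDl.
  by apply: pairP; rewrite !planeE /=; ring.
by split=> [/(H _ _ _ _ (- t))|/H]; rewrite // !addrK.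
Qed.

Lemma triangle_mirror b A B C p :
  triangle (mirror b A) (mirror b B) (mirror b C) (mirror b p) <-> triangle A B C p.
Proof.
have H A' B' C' p' : triangle A' B' C' p' ->
    triangle (mirror b A') (mirror b B') (mirror b C') (mirror b p').
  move=> [x [y [z [x0 y0 z0 s ->]]]]; exists x, y, z; split => //.
  by case: b => //; apply: pairP; rewrite /mirror !planeE /=; ring.
by split=> [/H|/H]; rewrite // !mirrorK.
Qed.

Lemma triangle_v1 A B C : triangle A B C A.
Proof.
exists 1, 0, 0; split => //; first by rewrite !addr0.
by rewrite scale1r !scale0r !addr0.
Qed.

Lemma triangle_v2 A B C : triangle A B C B.
Proof. by rewrite triangleCA; exact: triangle_v1. Qed.

Lemma triangle_v3 A B C : triangle A B C C.
Proof. by rewrite triangleC; exact: triangle_v2. Qed.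

End TriangleMaps.

(** * The triangles of Pi_g and its interior edges *)

Section Surface.
Context {R : realType}.
Variable g : nat.
Hypothesis g3 : (3 <= g)%N.
Local Notation a := (alpha R g).
Local Notation P := (@P R g).
Local Notation Q := (@Q R g).
Local Notation W := (@W R g).
Local Notation M := (M g).
Local Notation N := (N g).
Local Notation X := (@X R g g3).
Local Notation T := (@T R g).
Local Notation AY := (@AY_patchwork R g g3).
Implicit Types (p q A B C D : R * R) (i k n : nat) (b : bool) (t : R).

(* The triangles of Pi_g: the fan around P_0, the triangles glued onto its rim,
   and the attached ones. *)
Inductive place := Fan of nat | Cap of nat | Att of nat.

Definition vplace (pl : place) : bool :=
  match pl with
  | Fan i => (0 < i <= g)%N | Cap i => (0 < i <= N.+1)%N | Att k => (0 < k <= M)%N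
  end.

Definition pc (pl : place) : nat * bool :=
  match pl with
  | Fan i => (i, false) | Cap i => ((g + i)%N, false) | Att k => ((2 * g - k).+1, odd k)
  end.

Definition sh (pl : place) : R * R :=
  match pl with Att k => attach_shift g k | _ => 0 end.

Definition tri (pl : place) : set (R * R) :=
  match pl with
  | Fan i => triangle (P 0) (Q i) (Q i.-1)
  | Cap i => triangle (P i) (Q i.-1) (Q i)
  | Att k => if k == 1%N then triangle (Q 1) (P 1) (new_vertex g 1)
             else triangle (W k.-1) (W k) (W k.-2)
  end.

Lemma triE pl q : vplace pl -> T (pc pl) (q - sh pl) <-> tri pl q.
Proof.
have MM := M_le g3; have NM' := NM g3.
case: pl => [i|i|k] /= h; rewrite /Defs.T /=.
- by rewrite h subr0.
- rewrite ifF; last by apply/negbTE; lia.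
  rewrite ifT; last by lia.
  by rewrite subr0 addKn.
rewrite ifF; last by apply/negbTE; lia.
rewrite ifT; last by lia.
rewrite -(triangle_shift _ _ _ _ (attach_shift g k)) subrK.
have [k1|k1] := eqVneq k 1%N.
  rewrite k1 -(shift1 g3) -(shift1'' g) (new_vertex1 g3) -(shift1' g3).
  have -> : ((2 * g - 1).+1 - g = g)%N by lia.
  by [].
have kM : (1 < k <= M)%N by case: k k1 h => [|[|k]].
have [<- <- <-] := @shift_vertices R g g3 _ kM.
have -> : ((2 * g - k).+1 - g = g - k.-1)%N by lia.
by have -> : ((g - k.-1).-1 = g - k)%N by lia.
Qed.

Lemma placedP (c : nat * bool) (t : R * R) : placed g c t <-> exists2 pl, vplace pl & c = pc pl /\ t = sh pl.
Proof.
have MM := M_le g3; have NM' := NM g3; split.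
  case=> [[i [h -> ->]]|[k [h -> ->]]]; last by exists (Att k).
  have [ig|ig] := leqP i g.
    by exists (Fan i) => //=; lia.
  exists (Cap (i - g)); first by rewrite /vplace; lia.
  by split => //=; rewrite subnKC// ltnW.
case=> -[i|i|k] /= h [-> ->].
- by left; exists i; split => //; lia.
- by left; exists (g + i)%N; split => //; lia.
- by right; exists k.
Qed.

(** The point of X_g at position [q] of the copy [b] of Pi_g, read in the triangle [pl]. Positions
    in the mirror copy are also given in the coordinates of Pi_g, the reflection being applied
    here. *)
Definition clp b pl q : X := @to_surface R AY ((pc pl).1, (pc pl).2 (+) b) (mirror b (q - sh pl)).

Lemma clpE b pl q :
  clp b pl q = @to_surface R AY ((pc pl).1, (pc pl).2 (+) b) (mirror b (q - sh pl)).
Proof. by []. Qed.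

Lemma T_mirror n c b p : T (n, c (+) b) (mirror b p) <-> T (n, c) p.
Proof.
rewrite /Defs.T /=; case: ifP => _.
  by rewrite addbC -!mirror_mirror triangle_mirror.
case: ifP => // _.
by rewrite addbC -!mirror_mirror triangle_mirror.
Qed.

Lemma T_place b pl q : vplace pl -> tri pl q -> T ((pc pl).1, (pc pl).2 (+) b) (mirror b (q - sh pl)).
Proof. by move=> vp /(triE q vp) h; apply/T_mirror; case: (pc pl) h. Qed.

Lemma T_convex (c : nat * bool) p q : T c p -> T c q -> segment p q `<=` T c.
Proof.
rewrite /Defs.T; case: ifP => _; first exact: triangle_convex.
by case: ifP => // _; exact: triangle_convex.
Qed.

Lemma clp_path b pl p q : vplace pl -> tri pl p -> tri pl q ->
  broken_path (clp b pl p) (clp b pl q) (enorm (p - q)).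
Proof.
move=> vp hp hq; have -> : enorm (p - q) = enorm (mirror b (q - sh pl) - mirror b (p - sh pl)).
  by rewrite -mirrorB enorm_mirror opprD addrACA subrr addr0 enormC.
by apply: broken_path_seg; apply: T_convex; exact: T_place.
Qed.

Lemma clp_dist b pl p q : vplace pl -> tri pl p -> tri pl q ->
  flat_dist (clp b pl p) (clp b pl q) <= enorm (p - q).
Proof. by move=> vp hp hq; apply: flat_dist_le; exact: clp_path. Qed.

(** Transports a gluing of triangles of X_g to the coordinates of Pi_g. The list of gluings may name
    the ends of the second edge in either order; the equality of edge vectors decides which ends
    correspond. *)
Lemma glue_clp b pl b' pl' A B C D A' B' C' D' t :
  vplace pl -> vplace pl' -> tri pl A -> tri pl B -> tri pl' C -> tri pl' D ->
  glued_edges g ((pc pl).1, (pc pl).2 (+) b) A' B' ((pc pl').1, (pc pl').2 (+) b') C' D' ->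
  A' = mirror b (A - sh pl) -> B' = mirror b (B - sh pl) ->
  (C' = mirror b' (C - sh pl') /\ D' = mirror b' (D - sh pl')) \/
  (C' = mirror b' (D - sh pl') /\ D' = mirror b' (C - sh pl')) ->
  mirror b (B - A) = mirror b' (D - C) -> 0 <= t <= 1 ->
  clp b pl ((1 - t) *: A + t *: B) = clp b' pl' ((1 - t) *: C + t *: D).
Proof.
move=> vp vp' tA tB tC tD ge AE BE CE tr t01.
have tconv (U V S : R * R) : (1 - t) *: U + t *: V - S = (1 - t) *: (U - S) + t *: (V - S).
  by apply: pairP; rewrite !planeE /=; ring.
have in1 : T ((pc pl).1, (pc pl).2 (+) b) (mirror b ((1 - t) *: A + t *: B - sh pl)).
  apply: (T_convex (T_place b vp tA) (T_place b vp tB)).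
  by exists t => //; rewrite tconv mirror_conv.
have in2 : T ((pc pl').1, (pc pl').2 (+) b') (mirror b' ((1 - t) *: C + t *: D - sh pl')).
  apply: (T_convex (T_place b' vp' tC) (T_place b' vp' tD)).
  by exists t => //; rewrite tconv mirror_conv.
apply: (@eq_to_surface R AY _ _ _ _ in1 in2).
exists A', B', C', D'; split => //; split.
  by exists t => //; rewrite tconv mirror_conv AE BE.
have e1 : mirror b' (D - sh pl') = mirror b' (C - sh pl') + mirror b (B - A).
  by rewrite tr -mirrorD; congr mirror; apply: pairP; rewrite !planeE /=; ring.
have e2 : mirror b (B - sh pl) = mirror b (A - sh pl) + mirror b (B - A).
  by rewrite -mirrorD; congr mirror; apply: pairP; rewrite !planeE /=; ring.
exists (mirror b' (C - sh pl') - mirror b (A - sh pl)).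
rewrite !tconv !mirror_conv; split.
  by rewrite e1 e2; apply: pairP; rewrite !planeE /=; ring.
case: CE => -[-> ->]; [left|right]; rewrite AE BE e1 e2.
  by split; apply: pairP; rewrite !planeE /=; ring.
by split; apply: pairP; rewrite !planeE /=; ring.
Qed.

Lemma tri_Fan i : [/\ tri (Fan i) (P 0), tri (Fan i) (Q i) & tri (Fan i) (Q i.-1)].
Proof. by split; [exact: triangle_v1|exact: triangle_v2|exact: triangle_v3]. Qed.

Lemma tri_Cap i : [/\ tri (Cap i) (P i), tri (Cap i) (Q i.-1) & tri (Cap i) (Q i)].
Proof. by split; [exact: triangle_v1|exact: triangle_v2|exact: triangle_v3]. Qed.

Lemma tri_Att1 : [/\ tri (Att 1) (Q 1), tri (Att 1) (P 1) & tri (Att 1) (new_vertex g 1)].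
Proof. by split; [exact: triangle_v1|exact: triangle_v2|exact: triangle_v3]. Qed.

Lemma tri_Att k : (1 < k)%N ->
  [/\ tri (Att k) (W k.-1), tri (Att k) (W k) & tri (Att k) (W k.-2)].
Proof.
by case: k => [|[|k]] // _; split; [exact: triangle_v1|exact: triangle_v2|exact: triangle_v3].
Qed.

Lemma glue_fan b i p : (0 < i < g)%N -> segment (P 0) (Q i) p ->
  clp b (Fan i) p = clp b (Fan i.+1) p.
Proof.
move=> ig [t t01 ->]; have [h1 h2 _] := tri_Fan i; have [h3 _ h4] := tri_Fan i.+1.
apply: (glue_clp (pl := Fan i) (pl' := Fan i.+1) (A' := mirror b (P 0)) (B' := mirror b (Q i))
  (C' := mirror b (P 0)) (D' := mirror b (Q i))); rewrite /= ?subr0//; [lia|lia| |].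
  exact: glue_spoke.
by left.
Qed.

Lemma glue_cap b i p : (0 < i <= N.+1)%N -> segment (Q i.-1) (Q i) p ->
  clp b (Fan i) p = clp b (Cap i) p.
Proof.
have NM' := NM g3; have M0 := M_gt0 g3.
move=> ig [t t01 ->]; have [_ h1 h2] := tri_Fan i; have [_ h3 h4] := tri_Cap i.
apply: (glue_clp (pl := Fan i) (pl' := Cap i) (A' := mirror b (Q i.-1)) (B' := mirror b (Q i))
  (C' := mirror b (Q i.-1)) (D' := mirror b (Q i))); rewrite /= ?subr0//; [lia| |].
  by apply: glue_rim; lia.
by left.
Qed.

Lemma addrE (A B C : R * R) : A + B = C -> A = C - B.
Proof. by move=> <-; rewrite addrK. Qed.

Lemma glue_att1 b p : segment (P 1) (Q 1) p -> clp b (Cap 1) p = clp b (Att 1) p.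
Proof.
have NM' := NM g3; have M0 := M_gt0 g3.
move=> [t t01 ->]; have [h1 _ h2] := tri_Cap 1; have [h3 h4 _] := tri_Att1.
apply: (glue_clp (pl := Cap 1) (pl' := Att 1) (A' := mirror b (P 1)) (B' := mirror b (Q 1))
  (C' := mirror (~~ b) (P g)) (D' := mirror (~~ b) (Q g.-1))); rewrite /= ?subr0//.
- have -> : (g + 1 = g.+1)%N by lia.
  have -> : ((2 * g - 1).+1 = 2 * g)%N by lia.
  exact: glue_P1Q1.
- right; rewrite -(addrE (shift1 g3)) -(addrE (shift1'' g)) !mirror_mirror.
  by rewrite addbT.
Qed.

Lemma glue_att2 b p : (1 < M)%N -> segment (W 0) (W 1) p -> clp b (Cap 1) p = clp b (Att 2) p.
Proof.
have NM' := NM g3.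
move=> M1; rewrite segmentC => -[t t01 ->]; have [h1 h2 _] := tri_Cap 1.
have [h3 _ h4] := @tri_Att 2 isT.
have kM : (1 < 2 <= M)%N by [].
have [e1 _ e3] := @shift_vertices R g g3 _ kM.
apply: (glue_clp (pl := Cap 1) (pl' := Att 2) (A' := mirror b (P 1)) (B' := mirror b (Q 0))
  (C' := mirror b (P g.-1)) (D' := mirror b (Q g.-1))); rewrite /= ?subr0//.
- have -> : (g + 1 = g.+1)%N by lia.
  have -> : ((2 * g - 2).+1 = (2 * g).-1)%N by lia.
  exact: glue_P1Q0.
- by left; rewrite -(addrE e1) -(addrE e3) /= subn1.
Qed.

Lemma glue_att b k p : (1 < k < M)%N -> segment (W k.-1) (W k) p ->
  clp b (Att k) p = clp b (Att k.+1) p.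
Proof.
have NM' := NM g3; have MM := M_le g3.
move=> kM [t t01 ->]; have [h1 h2 _] := @tri_Att k ltac:(lia).
have [h3 _ h4] := @tri_Att k.+1 ltac:(lia).
have [e1 e2 e3] := @shift_vertices R g g3 k ltac:(lia).
have [d1 d2 d3] := @shift_vertices R g g3 k.+1 ltac:(lia).
rewrite /= in d1 d2 d3 h3 h4.
(* The gluing is listed from the later attached triangle to the earlier one and with the edge
   reversed. *)
symmetry.
rewrite [in RHS]addrC [in LHS]addrC.
have CV (A B : R * R) : t *: B + (1 - t) *: A = (1 - (1 - t)) *: B + (1 - t) *: A by rewrite subKr.
rewrite !CV; have s01 : 0 <= 1 - t <= 1 by case/andP: t01 => ? ?; apply/andP; split; lra.
apply: (glue_clp (pl := Att k.+1) (pl' := Att k)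
  (A' := mirror (odd k.+1 (+) b) (P (g - k))) (B' := mirror (odd k.+1 (+) b) (Q (g - k)))
  (C' := mirror (odd k (+) b) (Q (g - k))) (D' := mirror (odd k (+) b) (P (g - k).+1))) s01 => //.
- by rewrite /vplace; lia.
- by rewrite /vplace; lia.
- have := @glue_PiQi R g (odd k.+1 (+) b) (g - k) ltac:(lia).
  rewrite /= addNb negbK.
  have -> : ((2 * g - k.+1).+1 = g + (g - k))%N by lia.
  by have -> : ((2 * g - k).+1 = (g + (g - k)).+1)%N by lia.
- by rewrite /sh -(addrE d1) mirror_mirror addbC.
- by rewrite /sh -(addrE d3) mirror_mirror addbC.
- left; rewrite /sh -(addrE e2) -(addrE e1) !mirror_mirror (addbC b); split => //.
  by congr (mirror _ (P _)); lia.
Qed.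

End Surface.

(** * Boundary edges of Pi_g and their gluings *)

Section Crossing.
Context {R : realType}.
Variable g : nat.
Hypothesis g3 : (3 <= g)%N.
Local Notation a := (alpha R g).
Local Notation P := (@P R g).
Local Notation Q := (@Q R g).
Local Notation W := (@W R g).
Local Notation M := (M g).
Local Notation N := (N g).
Local Notation X := (@X R g g3).
Local Notation T := (@T R g).
Local Notation AY := (@AY_patchwork R g g3).
Local Notation clp := (@clp R g g3).
Local Notation vplace := (vplace g).
Local Notation tri := (@tri R g).
Implicit Types (p q A B C D : R * R) (i k n : nat) (b : bool) (t : R).

(** The edges of the square that have a counterpart on the boundary of Pi_g; [gA] and [gB] are the
    ends of this counterpart and [home] is the triangle of Pi_g that contains it. *)
Definition gvalid (e : bedge) : bool :=
  match e with
  | Bot _ => true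
  | Top' n | Top'' n => (0 < n <= N)%N
  | Rgt n | Lft n => (0 < n <= M)%N
  end.

Definition gA (e : bedge) : R * R :=
  match e with
  | Bot h => if h then P 0 else Q 0
  | Top' n => if n == 1%N then new_vertex g 1 else P n
  | Top'' n => Q n
  | Rgt n => Q (g - n.-1)
  | Lft n => if n == 1%N then new_vertex g 1 else W n.-2
  end.

Definition gB (e : bedge) : R * R :=
  match e with
  | Bot h => if h then Q g else P 0
  | Top' n => Q n
  | Top'' n => P n.+1
  | Rgt n => Q (g - n)
  | Lft n => W n
  end.

Definition home (e : bedge) : place :=
  match e with
  | Bot h => if h then Fan g else Fan 1
  | Top' n => if n == 1%N then Att 1 else Cap n
  | Top'' n => Cap n.+1
  | Rgt n => Fan (g - n.-1)
  | Lft n => Att n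
  end.

Definition gpt e t : R * R := (1 - t) *: gA e + t *: gB e.

Lemma gvalid_partner e : gvalid (partner e) = gvalid e.
Proof. by case: e. Qed.

Lemma gvalid_valid e : gvalid e -> valid e.
Proof. by case: e => //= n /andP[]. Qed.

Lemma vplace_home e : gvalid e -> vplace (home e).
Proof.
have NM' := NM g3; have MM := M_le g3; have M0 := M_gt0 g3.
by case: e => [[]|n|n|n|n] //=; try (by lia); case: eqP => /=; lia.
Qed.

Lemma tri_home e : gvalid e -> tri (home e) (gA e) /\ tri (home e) (gB e).
Proof.
have NM' := NM g3; have MM := M_le g3; have M0 := M_gt0 g3.
case: e => [h|n|n|n|n] ve.
- by case: h ve => _; [have [? ? ?] := tri_Fan (R:=R) g g|have [? ? ?] := tri_Fan (R:=R) g 1].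
- rewrite /=; case: eqP => [->|_]; first by have [] := tri_Att1 (R:=R) g.
  by have [] := tri_Cap (R:=R) g n.
- by have [? ? ?] := tri_Cap (R:=R) g n.+1.
- have [_ h1 h2] := tri_Fan (R:=R) g (g - n.-1); split => //.
  by have e : ((g - n.-1).-1 = g - n)%N by [move: ve => /=; lia]; rewrite e in h2.
- rewrite /=; have [->|n1] := eqVneq n 1%N; first by have [] := tri_Att1 (R:=R) g.
  by split; [exact: triangle_v3|exact: triangle_v2].
Qed.

Lemma tri_gpt e t : gvalid e -> 0 <= t <= 1 -> tri (home e) (gpt e t).
Proof.
move=> ve t01; have [h1 h2] := tri_home ve.
case: (home e) h1 h2 => [i|i|k] /= h1 h2.
- by apply: (triangle_convex h1 h2); exists t.
- by apply: (triangle_convex h1 h2); exists t.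
by move: h1 h2; case: ifP => _ h1 h2; apply: (triangle_convex h1 h2); exists t.
Qed.

Lemma conv_rev t A B : (1 - t) *: A + t *: B = (1 - (1 - t)) *: B + (1 - t) *: A.
Proof. by rewrite subKr addrC. Qed.

Lemma new_vertex1_diff : new_vertex g 1 - Q 1 = (- (a ^+ 1 / 2), a ^+ (g - 1 + 2) / (1 - a)) :> R * R.
Proof.
have a1 := alpha1_neq0 (R:=R) g3.
rewrite (new_vertex1 g3) QE//; apply: pairP; rewrite !planeE /= ?expr1 ?expr2.
  by field; rewrite ?a1.
by field; rewrite ?a1.
Qed.

Lemma Q0_diff : Q 0 - P 0 = (- 2^-1, a - a ^+ 2 / (1 - a)).
Proof.
have a1 := alpha1_neq0 (R:=R) g3.
by apply: pairP; rewrite /Defs.P /Defs.Q !planeE /=; field; rewrite ?a1.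
Qed.

Lemma Qg_diff : P 0 - Q g = (- 2^-1, - (a - a ^+ 2 / (1 - a))).
Proof.
have a1 := alpha1_neq0 (R:=R) g3; have a0 : a != 0 by rewrite gt_eqF ?alpha_gt0.
have eu : a ^+ g = (2 * a - 1) / a by rewrite -alphaSg//; field.
rewrite QE; last by lia.
have -> : (g - g + 2 = 2)%N by lia.
apply: pairP; rewrite /Defs.P !planeE /= ?[a ^+ g.+1]exprS ?eu; field; rewrite ?a1 ?a0 //.
Qed.

(** The boundary of Pi_g is glued in the pattern of the square, with the same [partner] and [flips]:
    the gluings of X_g are listed by triangles and are re-read here edge by edge. *)
Lemma crossing b e t : gvalid e -> 0 <= t <= 1 ->
  clp b (home e) (gpt e t) = clp (b (+) flips e) (home (partner e)) (gpt (partner e) t).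
Proof.
have NM' := NM g3; have MM := M_le g3; have M0 := M_gt0 g3; have N0 := N_gt0 g3.
have a1 := alpha1_neq0 (R:=R) g3.
move=> ve t01; have s01 : 0 <= 1 - t <= 1 by case/andP: t01 => ? ?; apply/andP; split; lra.
(* Selects one edge of each pair of partners; the identity is symmetric in the pair. *)
pose half e' : bool := match e' with Bot h => ~~ h | Top' _ | Rgt _ => true | _ => false end.
wlog H : b e ve / half e.
  move=> H; case E: (half e).
    exact: H.
  have := H (b (+) flips e) (partner e); rewrite gvalid_partner => /(_ ve).
  rewrite flips_partner partnerK addbK => <- //.
  by case: (e) E => [[]|?|?|?|?].
have ve' : gvalid (partner e) by rewrite gvalid_partner.
have vh := vplace_home ve; have vh' := vplace_home ve'.
have [tA tB] := tri_home ve; have [tA' tB'] := tri_home ve'.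
case: e H ve ve' vh vh' tA tB tA' tB' => [h|n|n|n|n] //.
- case: h => //= _ ve ve' vh vh' tA tB tA' tB'.
  rewrite /gpt /= !(conv_rev t).
  apply: (glue_clp g3 (pl := Fan 1) (pl' := Fan g) (A' := mirror b (P 0)) (B' := mirror b (Q 0))
    (C' := mirror (~~ b) (P 0)) (D' := mirror (~~ b) (Q g))) => //=; rewrite ?subr0 ?addbT//.
  + exact: glue_P0Q0.
  + by right.
  + by rewrite Q0_diff Qg_diff; case: (b); rewrite /mirror /= ?opprK.
- move=> _ ve ve' vh vh' tA tB tA' tB'.
  have [n1|n1] := eqVneq n 1%N.
    subst n; rewrite /gpt /= !(conv_rev t).
    apply: (glue_clp g3 (pl := Att 1) (pl' := Cap 2) (A' := mirror (~~ b) (P g)) (B' := mirror (~~ b) (Q g))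
      (C' := mirror (~~ b) (Q 1)) (D' := mirror (~~ b) (P 2))) => //=; rewrite ?subr0 ?addbT//.
    + have -> : ((2 * g - 1).+1 = 2 * g)%N by clear -g3; lia.
      rewrite addn2.
      exact: glue_PgQg.
    + by rewrite -(addrE (shift1 g3)) mirror_mirror addbT.
    + by rewrite (new_vertex1 g3) -(addrE (shift1' g3)) mirror_mirror addbT.
    + by right.
    + rewrite (new_vertex1_diff) -[Q 1 - P 2]opprB PQ_diff//; last by clear -g3; lia.
      by case: b; rewrite /mirror ?planeE /= ?opprK.
  rewrite /gpt /= (negbTE n1).
  have n2 : (1 < n <= N)%N by case: n n1 ve {ve' vh vh' tA tB tA' tB'} => [|[|n]].
  apply: (glue_clp g3 (pl := Cap n) (pl' := Cap n.+1) (A' := mirror b (P n)) (B' := mirror b (Q n))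
    (C' := mirror (~~ b) (Q n)) (D' := mirror (~~ b) (P n.+1))) => //=; rewrite ?subr0 ?addbT//.
  + by move: vh; rewrite /= (negbTE n1).
  + by move: tA; rewrite /= (negbTE n1).
  + by move: tB; rewrite /= (negbTE n1).
  + rewrite addnS.
    by apply: glue_PiQi; clear -n2 NM' M0; lia.
  + by left.
  + rewrite QP_diff// ?PQ_diff//; [|by clear -n2 NM' M0; lia|by clear -n2 NM' M0; lia].
    by case: b; rewrite /mirror ?planeE /= ?opprK.
move=> _ ve ve' vh vh' tA tB tA' tB'.
have /= vn := ve.
have [k1 k2] : mirror (odd n) (Q (g - n)) + sh g (Att n) = W n /\
    mirror (odd n) (Q (g - n.-1)) + sh g (Att n) = gA (Lft n).
  have [n1|n1] := eqVneq n 1%N.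
    subst n; rewrite /sh /= subn0 (new_vertex1 g3) -(shift1' g3) subn1; split => //.
    exact: shift1''.
  have n2 : (1 < n <= M)%N by case: n n1 vn {ve ve' vh vh' tA tB tA' tB'} => [|[|n]].
  by have [? ? ?] := @shift_vertices R g g3 n n2; rewrite /= (negbTE n1).
rewrite /gpt !(conv_rev t).
have e1 : ((g - n.-1).-1 = g - n)%N by clear -vn MM; lia.
apply: (glue_clp g3 (pl := home (Rgt n)) (pl' := home (Lft n)) (A' := mirror b (Q (g - n.-1).-1)) (B' := mirror b (Q (g - n.-1)))
    (C' := mirror b (Q (g - n.-1).-1)) (D' := mirror b (Q (g - n.-1)))) => //; rewrite /= ?subr0 ?addbF//.
+ rewrite (addbC b) addKb.
  have -> : ((2 * g - n).+1 = g + (g - n.-1))%N by clear -vn MM; lia.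
  by apply: glue_rim; clear -vn MM NM' N0 M0; lia.
+ by rewrite e1.
+ left; rewrite e1 -(addrE k1) -(addrE k2) !mirror_mirror.
  by rewrite -addbA addbb addbF.
+ rewrite /= in k2; rewrite -k2 -k1 opprD addrACA subrr addr0 -mirrorB mirror_mirror -addbA addbb addbF.
  by [].
Qed.

End Crossing.

(** * The involution rho_g and connectedness of X_g *)

Section Classify.
Context {R : realType}.
Variable g : nat.
Hypothesis g3 : (3 <= g)%N.
Local Notation a := (alpha R g).
Local Notation P := (@P R g).
Local Notation Q := (@Q R g).
Local Notation W := (@W R g).
Local Notation M := (M g).
Local Notation N := (N g).
Local Notation X := (@X R g g3).
Local Notation T := (@T R g).
Local Notation AY := (@AY_patchwork R g g3).
Local Notation clp := (@clp R g g3).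
Local Notation vplace := (vplace g).
Local Notation tri := (@tri R g).
Implicit Types (p q A B C D : R * R) (i k n : nat) (b : bool) (t : R).

Lemma placeP (c : nat * bool) p : T c p -> exists b pl q,
  [/\ vplace pl, tri pl q & @to_surface R AY c p = clp b pl q].
Proof.
have NM' := NM g3; have MM := M_le g3; have M0 := M_gt0 g3.
case: c => n c Tp.
have [pl vp [pE cE]] : exists2 pl, vplace pl & (pc g pl).1 = n /\ exists b, (pc g pl).2 (+) b = c.
  have hn : (0 < n <= 2 * g)%N by move: Tp; rewrite /Defs.T /=; case: ifP => [|_]; [lia|case: ifP => //; lia].
  have [ng|ng] := leqP n g; first by exists (Fan n); [rewrite /=; lia|split => //; exists c].
  have [ng'|ng'] := leqP (n - g) N.+1.
    by exists (Cap (n - g)); [rewrite /=; lia|split => /=; [lia|exists c]].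
  exists (Att ((2 * g).+1 - n)); first by rewrite /=; lia.
  split; first by rewrite /=; lia.
  by exists (odd ((2 * g).+1 - n) (+) c); rewrite /= addKb.
case: cE => b cE; exists b, pl, (mirror b p + sh g pl).
have e : clp b pl (mirror b p + sh g pl) = @to_surface R AY (n, c) p.
  by rewrite clpE addrK mirrorK pE cE.
split => //; apply/(triE g3) => //; rewrite addrK.
by have := Tp; rewrite -cE -pE -{1}[p](mirrorK b) => /T_mirror; case: (pc g pl).
Qed.

Lemma X_placeP (x : X) : exists b pl q, [/\ vplace pl, tri pl q & x = clp b pl q].
Proof. by have [c [p [Tp ->]]] := surfaceP x; exact: placeP. Qed.

Lemma glued_edges_flip (c d : nat * bool) A B C D : glued_edges g c A B d C D ->
  glued_edges g (c.1, ~~ c.2) (mirror true A) (mirror true B) (d.1, ~~ d.2) (mirror true C) (mirror true D).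
Proof.
have mm b p : mirror true (mirror b p) = mirror (~~ b) p by rewrite mirror_mirror.
case=> {c A B d C D} [b i h|b i h|b|b|b|b|b i h]; rewrite !mm /=.
- exact: glue_spoke.
- exact: glue_rim.
- exact: glue_P0Q0.
- exact: glue_P1Q1.
- exact: glue_P1Q0.
- exact: glue_PgQg.
- exact: glue_PiQi.
Qed.

Lemma glued_T_flip (c d : nat * bool) p q : glued_T g c p d q ->
  glued_T g (c.1, ~~ c.2) (mirror true p) (d.1, ~~ d.2) (mirror true q).
Proof.
move=> [A [B [C [D [ge [[t t01 ->] [u [-> H]]]]]]]].
exists (mirror true A), (mirror true B), (mirror true C), (mirror true D).
split; first exact: glued_edges_flip.
split; first by exists t => //; rewrite mirror_conv.
exists (mirror true u); split; first by rewrite mirrorD.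
by case: H => -[-> ->]; [left|right]; rewrite !mirrorD.
Qed.

Lemma T_flip (c : nat * bool) p : T c p -> T (c.1, ~~ c.2) (mirror true p).
Proof. by case: c => n c Tp; rewrite /= -addbT; apply/T_mirror. Qed.

(** [rho] is computed on a chosen representative; as the reflection maps the list of gluings to
    itself, the choice is immaterial. *)
Lemma rho_to_surface (c : nat * bool) p : T c p ->
  rho (@to_surface R AY c p : X) = @to_surface R AY (c.1, ~~ c.2) (mirror true p).
Proof.
move=> Tp; have hp : p \in T c by rewrite inE.
pose V (z : points AY) : X := @to_surface R AY ((projT1 z).1, ~~ (projT1 z).2) (mirror true (val (projT2 z))).
have VI (x y : points AY) : glue_step x y -> V x = V y.
  case: x y => [c1 [p1 h1]] [c2 [p2 h2]] h; rewrite /V /=.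
  apply: (@eq_to_surface R AY); [| |exact: glued_T_flip h].
    by apply: T_flip; have := h1; rewrite inE.
  by apply: T_flip; have := h2; rewrite inE.
by have := repr_lift VI hp; rewrite /rho.
Qed.

Lemma rho_clp b pl q : vplace pl -> tri pl q -> rho (clp b pl q) = clp (~~ b) pl q.
Proof.
move=> vp tq; rewrite !clpE rho_to_surface; last exact: T_place.
by rewrite mirror_mirror addTb /= addbN.
Qed.

Local Notation joined x y := (exists l, broken_path (x : X) y l).

(** Within a copy every triangle is joined to P_0 through the edges interior to Pi_g, and the two
    copies are joined across P_0Q_0. *)
Lemma X_connected : connected_surface AY.
Proof.
have NM' := NM g3; have MM := M_le g3; have M0 := M_gt0 g3.
have F b i : (0 < i <= g)%N -> clp b (Fan i) (P 0) = clp b (Fan 1) (P 0).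
  case: i => // i; elim: i => // i IH h; transitivity (clp b (Fan i.+1) (P 0)); last by apply: IH; exact: ltnW.
  by symmetry; apply: glue_fan => //; exact: segment_l.
have Jt (x y z : X) : joined x y -> joined y z -> joined x z.
  by move=> [l h] [l' h']; exists (l + l'); exact: broken_path_trans h h'.
have Js (x y : X) : joined x y -> joined y x.
  by move=> [l h]; exists l; exact: broken_path_sym.
have Jr (x : X) : joined x x by exists 0; exact: broken_nil.
have Jp b pl p q : vplace pl -> tri pl p -> tri pl q -> joined (clp b pl p) (clp b pl q).
  by move=> *; eexists; apply: clp_path.
have base b pl q : vplace pl -> tri pl q -> joined (clp b pl q) (clp b (Fan 1) (P 0)).
  have FJ i p : (0 < i <= g)%N -> tri (Fan i) p -> joined (clp b (Fan i) p) (clp b (Fan 1) (P 0)).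
    by move=> h1 h2; rewrite -(F b i h1); apply: Jp => //; have [] := tri_Fan (R:=R) g i.
  have CJ i p : (0 < i <= N.+1)%N -> tri (Cap i) p -> joined (clp b (Cap i) p) (clp b (Fan 1) (P 0)).
    move=> h1 h2; have [_ _ h3] := tri_Cap (R:=R) g i.
    apply: Jt (Jp b (Cap i) p (Q i) h1 h2 h3) _; rewrite -glue_cap//; last exact: segment_r.
    by apply: FJ; [lia|have [] := tri_Fan (R:=R) g i].
  case: pl => [i|i|k] vp tq; [exact: FJ|exact: CJ|].
  have [k1|k1] := eqVneq k 1%N.
    subst k; have [h1 h2 h3] := tri_Att1 (R:=R) g.
    apply: Jt (Jp b (Att 1) q (P 1) vp tq h2) _; rewrite -glue_att1; last exact: segment_l.
    by apply: CJ => //; have [] := tri_Cap (R:=R) g 1.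
  case: k k1 vp tq => [|[|k]] // _; elim: k q => [|k IH] q vp tq.
    have [h1 h2 h3] := @tri_Att R g 2 isT.
    apply: Jt (Jp b (Att 2) q (W 0) vp tq h3) _.
    rewrite -glue_att2; [|by move: vp => /=; lia|exact: segment_l].
    by apply: CJ => //; have [_ h _] := tri_Cap (R:=R) g 1.
  have [h1 h2 h3] := @tri_Att R g k.+3 isT.
  apply: Jt (Jp b (Att k.+3) q (W k.+2) vp tq h1) _.
  rewrite -glue_att; [|by move: vp => /=; lia|exact: segment_r].
  by apply: IH; [by move: vp => /=; lia|have [] := @tri_Att R g k.+2 isT].
have swap b : joined (clp b (Fan 1) (P 0)) (clp (~~ b) (Fan 1) (P 0)).
  have := @crossing R g g3 b (Bot false) 1 isT; rewrite lexx ler01 => /(_ isT).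
  rewrite /gpt /= !subrr !scale0r !scale1r !add0r addbT => ->.
  by apply: base => /=; [lia|have [] := tri_Fan (R:=R) g g].
move=> x y; have [b [pl [p [vp tp ->]]]] := X_placeP x.
have [b' [pl' [p' [vp' tp' ->]]]] := X_placeP y.
apply: (Jt _ _ _ (base b _ _ vp tp)); apply: Js; apply: (Jt _ _ _ (base b' _ _ vp' tp')).
by case: (b) (b') => [] []; [exact: Jr|exact: (swap false)|exact: (swap true)|exact: Jr].
Qed.

End Classify.

(** * Detours through an edge *)

Section CrossingPoint.
Context {R : realType}.
Implicit Types (p q A B m u w : R * R) (t r h : R).

Lemma det2_colinear u w : u != 0 -> det2 u w = 0 -> exists r, w = r *: u.
Proof.
move=> u0 d0; have s0 : u.1 ^+ 2 + u.2 ^+ 2 != 0.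
  apply: contra u0; rewrite paddr_eq0 ?sqr_ge0// !sqrf_eq0 => /andP[/eqP e1 /eqP e2].
  by apply/eqP/pairP.
exists ((u.1 * w.1 + u.2 * w.2) / (u.1 ^+ 2 + u.2 ^+ 2)).
move: d0; rewrite /det2 => d0; apply: pairP; rewrite scaleE /=.
  apply: (mulIf s0); rewrite mulrAC divfK//.
  have -> : (u.1 * w.1 + u.2 * w.2) * u.1 = w.1 * (u.1 ^+ 2 + u.2 ^+ 2) + u.2 * (u.1 * w.2 - u.2 * w.1) by ring.
  by rewrite d0 mulr0 addr0.
apply: (mulIf s0); rewrite mulrAC divfK//.
have -> : (u.1 * w.1 + u.2 * w.2) * u.2 = w.2 * (u.1 ^+ 2 + u.2 ^+ 2) - u.1 * (u.1 * w.2 - u.2 * w.1) by ring.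
by rewrite d0 mulr0 subr0.
Qed.

Lemma segment_split p q m : segment p q m -> enorm (p - m) + enorm (m - q) = enorm (p - q).
Proof.
move=> [t /andP[t0 t1] ->].
have -> : p - ((1 - t) *: p + t *: q) = t *: (p - q) by apply: pairP; rewrite !planeE /=; ring.
have -> : (1 - t) *: p + t *: q - q = (1 - t) *: (p - q) by apply: pairP; rewrite !planeE /=; ring.
by rewrite !enormZ !ger0_norm ?subr_ge0//; ring.
Qed.

(** The segment meets the line AB at a parameter r. If r misses [0, 1] by at most h, clamping it
    moves the crossing point by at most h |AB|, a cost paid once on the way in and once on the way
    out. *)
Lemma crossing_point A B q q' h : B - A != 0 -> 0 <= h ->
  0 <= det2 (B - A) (q - A) -> det2 (B - A) (q' - A) <= 0 ->
  (forall r, segment q q' (A + r *: (B - A)) -> - h <= r <= 1 + h) ->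
  exists2 m, segment A B m & enorm (q - m) + enorm (m - q') <= enorm (q - q') + 2 * h * enorm (B - A).
Proof.
move=> AB h0 d1 d2 H.
have [t t01 dt] : exists2 t, 0 <= t <= 1 &
    (1 - t) * det2 (B - A) (q - A) + t * det2 (B - A) (q' - A) = 0.
  have [e|e] := eqVneq (det2 (B - A) (q - A) - det2 (B - A) (q' - A)) 0.
    by exists 0; rewrite ?lexx ?ler01//; lra.
  exists (det2 (B - A) (q - A) / (det2 (B - A) (q - A) - det2 (B - A) (q' - A))).
    have e0 : 0 < det2 (B - A) (q - A) - det2 (B - A) (q' - A) by rewrite lt_def e; lra.
    by apply/andP; split; [exact: divr_ge0 d1 (ltW e0)|rewrite ler_pdivrMr// mul1r; lra].
  by field.
pose m := (1 - t) *: q + t *: q'.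
have sm : segment q q' m by exists t.
have [r rE] : exists r, m - A = r *: (B - A).
  apply: det2_colinear => //; rewrite -[RHS]dt /det2 /m !planeE /=; ring.
have mE : m = A + r *: (B - A) by rewrite -rE addrC subrK.
have /andP[r1 r2] := H r (eq_ind _ (segment q q') sm _ mE).
pose r' := Num.max 0 (Num.min r 1).
have r'0 : 0 <= r' by rewrite le_max lexx.
have r'1 : r' <= 1 by rewrite ge_max ler01 ge_min lexx orbT.
have rr : `|r - r'| <= h.
  rewrite /r'; have [h1|h1] := leP r 1.
    by have [h2|h2] := leP 0 r; rewrite ?subrr ?normr0// subr0 ler0_norm; lra.
  by rewrite max_r// ger0_norm; lra.
exists (A + r' *: (B - A)).
  by exists r'; [rewrite r'0|rewrite segmentE].
have e : enorm (m - (A + r' *: (B - A))) <= h * enorm (B - A).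
  have -> : m - (A + r' *: (B - A)) = (r - r') *: (B - A).
    by rewrite mE; apply: pairP; rewrite !planeE /=; ring.
  by rewrite enormZ ler_wpM2r ?enorm_ge0.
have := enorm_tri m q (A + r' *: (B - A)); have := enorm_tri m (A + r' *: (B - A)) q'.
rewrite (enormC _ m) -(segment_split sm).
by move: (enorm (m - _)) e => e1 e; lra.
Qed.

End CrossingPoint.

(** * Convexity of the fan around P_0 *)

Section FanConvex.
Context {R : realType}.
Variable g : nat.
Hypothesis g3 : (3 <= g)%N.
Local Notation a := (alpha R g).
Local Notation P := (@P R g).
Local Notation Q := (@Q R g).
Local Notation X := (@X R g g3).
Local Notation clp := (@clp R g g3).
Local Notation tri := (@tri R g).
Implicit Types (p q A B C D : R * R) (i j k n : nat) (b : bool) (t : R).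

(** [Qa] and [Qb] are the offsets of Q_k from the point with both coordinates alpha / (1 - alpha).
    Their product does not depend on k, so the Q_k with 1 <= k <= g lie on a branch of a
    hyperbola. *)
Definition Qa k : R := a ^+ k * (1 + a) / (2 * (1 - a)).
Definition Qb k : R := a ^+ (g - k + 2) / (1 - a).

Lemma Q_hyp k : (0 < k)%N -> Q k = (a / (1 - a) - Qa k, a / (1 - a) - Qb k).
Proof.
have a1 := alpha1_neq0 (R:=R) g3.
move=> k0; rewrite QE// /Qa /Qb; apply: pairP => /=; rewrite ?exprS; field; rewrite ?a1//.
Qed.

Lemma Qa_gt0 k : 0 < Qa k.
Proof.
have h1 := alpha1_gt0 (R:=R) g3; have h2 := alpha_gt0 (R:=R) g3.
by rewrite /Qa divr_gt0 ?mulr_gt0 ?alpha_exp_gt0//; lra.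
Qed.

Lemma Qb_gt0 k : 0 < Qb k.
Proof. by rewrite /Qb divr_gt0 ?alpha_exp_gt0 ?alpha1_gt0. Qed.

Lemma Qa_le k l : (k <= l)%N -> Qa l <= Qa k.
Proof.
have h1 := alpha1_gt0 (R:=R) g3; have h2 := alpha_gt0 (R:=R) g3.
move=> kl; rewrite /Qa -!mulrA ler_wpM2r ?alpha_exp_le//.
by rewrite divr_ge0//; lra.
Qed.

Lemma Qb_le k l : (k <= l)%N -> Qb k <= Qb l.
Proof.
move=> kl; rewrite /Qb ler_wpM2r ?invr_ge0 ?(ltW (alpha1_gt0 g3))//.
by apply: alpha_exp_le => //; lia.
Qed.

Lemma Qab k l : (k <= g)%N -> (l <= g)%N -> Qa k * Qb k = Qa l * Qb l.
Proof.
have a1 := alpha1_neq0 (R:=R) g3.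
suff H j : (j <= g)%N -> Qa j * Qb j = a ^+ (g + 2) * ((1 + a) / (2 * (1 - a) ^+ 2)).
  by move=> kg lg; rewrite !H.
move=> jg; have -> : (g + 2 = j + (g - j + 2))%N by lia.
rewrite /Qa /Qb [a ^+ (j + _)]exprD; move: (a ^+ j) (a ^+ (g - j + 2)) => x y.
by field; rewrite a1.
Qed.

Definition fX k : R := (Q k - P 0).1.
Definition fY k : R := (Q k - P 0).2.

Lemma fXE k : (0 < k)%N -> fX k = a / (1 - a) - (1 - a ^+ g) / 2 - Qa k.
Proof. by move=> k0; rewrite /fX Q_hyp// /= addrAC. Qed.

Lemma fYE k : (0 < k)%N -> fY k = a - Qb k.
Proof.
have a1 := alpha1_neq0 (R:=R) g3.
move=> k0; rewrite /fY Q_hyp//= addrAC; congr (_ - _); field; rewrite ?a1 //.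
Qed.

Lemma fX_le k l : (0 < k)%N -> (k <= l)%N -> fX k <= fX l.
Proof.
move=> k0 kl; rewrite !fXE//; last exact: leq_trans kl.
by rewrite lerD2l lerN2 Qa_le.
Qed.

Lemma fY_le k l : (0 < k)%N -> (k <= l)%N -> fY l <= fY k.
Proof.
move=> k0 kl; rewrite !fYE//; last exact: leq_trans kl.
by rewrite lerD2l lerN2 Qb_le.
Qed.

Lemma alpha_inv : (1 - a)^-1 * (1 - a) = 1.
Proof. by rewrite mulVf// alpha1_neq0. Qed.

Lemma fX_gt0 k : (1 < k)%N -> 0 < fX k.
Proof.
move=> k1; apply: lt_le_trans (fX_le _ k1) => //.
have h1 := alpha_lt55 (R:=R) g3; have h2 := alpha_gt12 (R:=R) g3.
have h3 := alpha_exp_ge0 (R:=R) g3 g.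
have c1 := alpha_inv; rewrite fXE// /Qa invfM.
have -> : 2^-1 = 1 / 2 :> R by rewrite mul1r.
move: (a) (a ^+ g) ((1 - a)^-1) c1 h1 h2 h3 => x u c c1 h1 h2 h3.
rewrite !exprS expr0; nra.
Qed.

Lemma fY_gt0 k : (0 < k < g)%N -> 0 < fY k.
Proof.
move=> /andP[k0 kg]; have g1 : (k <= g.-1)%N by lia.
apply: lt_le_trans (fY_le k0 g1).
have h1 := alpha_lt55 (R:=R) g3; have h2 := alpha_gt12 (R:=R) g3.
have c1 := alpha_inv; rewrite fYE; last by lia.
rewrite /Qb; have -> : (g - g.-1 + 2 = 3)%N by lia.
move: (a) ((1 - a)^-1) c1 h1 h2 => x c c1 h1 h2.
have c0 : 0 < c by nra.
have : c * (x - x ^+ 3 * c) = c * x - c * c * x ^+ 3 by ring.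
rewrite !exprS expr0; nra.
Qed.

(** The line x + 2y = const through P_0 has all Q_k, k >= 1, on one side, so segments joining
    triangles of the fan do not pass behind P_0. *)
Lemma ell_ge0 k : (0 < k <= g)%N -> 0 <= fX k + 2 * fY k.
Proof.
have h1 := alpha_lt55 (R:=R) g3; have h2 := alpha_gt12 (R:=R) g3; have c1 := alpha_inv.
move=> /andP[k0]; rewrite leq_eqVlt => /orP[/eqP ->|kg].
  rewrite /fX /fY -[Q g - P 0]opprB (Qg_diff g3) /=.
  move: (a) ((1 - a)^-1) c1 h1 h2 => x c c1 h1 h2.
  have c0 : 0 < c by nra.
  have cc : c < 9 / 4 by nra.
  rewrite expr2; nra.
have g1 : (k <= g.-1)%N by lia.
have := fX_le (ltn0Sn 0) k0; have := fY_le k0 g1.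
rewrite (fXE (ltn0Sn 0)) (@fYE g.-1); last by lia.
rewrite /Qa /Qb; have -> : (g - g.-1 + 2 = 3)%N by lia.
have h3 := alpha_exp_ge0 (R:=R) g3 g.
rewrite invfM; have -> : 2^-1 = 1 / 2 :> R by rewrite mul1r.
move: (fX k) (fY k) (a) (a ^+ g) ((1 - a)^-1) c1 h1 h2 h3 => X1 Y1 x u c c1 h1 h2 h3.
have c0 : 0 < c by nra.
have cc : c < 9 / 4 by nra.
have E : x * c - x ^+ 1 * (1 + x) * (1 / 2 * c) = x / 2.
  have -> : x * c - x ^+ 1 * (1 + x) * (1 / 2 * c) = x / 2 * (c * (1 - x)) by field.
  by rewrite c1 mulr1.
rewrite !exprS !expr0 in E *; nra.
Qed.

Lemma det_fan i k : (1 < i < g)%N -> (0 < k)%N ->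
  (if (k <= i)%N then 0 <= det2 (Q i - P 0) (Q k - P 0) else det2 (Q i - P 0) (Q k - P 0) <= 0).
Proof.
move=> /andP[i1 ig] k0; have i0 : (0 < i)%N by lia.
have x0 := fX_gt0 i1; have y0 : 0 < fY i by apply: fY_gt0; lia.
rewrite /det2 -!/(fX _) -!/(fY _); case: ifP => ki.
  by have := fX_le k0 ki; have := fY_le k0 ki; nra.
have ik : (i <= k)%N by lia.
by have := fX_le i0 ik; have := fY_le i0 ik; nra.
Qed.

(** The tangent to the hyperbola at Q_i supports all the Q_k: by the inequality of arithmetic and
    geometric means, as the products [Qa k * Qb k] are equal. *)
Lemma fan_support i k : (0 < i <= g)%N -> (0 < k <= g)%N ->
  (Q k).1 * Qb i + (Q k).2 * Qa i <= (Q i).1 * Qb i + (Q i).2 * Qa i.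
Proof.
move=> /andP[i0 ig] /andP[k0 kg]; rewrite !Q_hyp//=.
have := Qab ig kg; have := Qa_gt0 k; have := Qb_gt0 k; have := Qa_gt0 i; have := Qb_gt0 i.
move: (Qa i) (Qb i) (Qa k) (Qb k) => A B A' B' B0 A0 B0' A0' e.
suff : 2 * (A * B) <= A' * B + B' * A by nra.
have sq : (2 * (A * B)) ^+ 2 <= (A' * B + B' * A) ^+ 2.
  have -> : (A' * B + B' * A) ^+ 2 = (A' * B - B' * A) ^+ 2 + 4 * (A * B) * (A' * B') by ring.
  rewrite -e; have := sqr_ge0 (A' * B - B' * A); move: (_ ^+ 2) => z z0.
  by rewrite (_ : (2 * (A * B)) ^+ 2 = 4 * (A * B) * (A * B)); [rewrite lerDr|ring].
by move: sq; rewrite ler_pXn2r ?nnegrE// ?addr_ge0 ?mulr_ge0 ?ltW.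
Qed.

Lemma fan_cross i j q q' : (1 < i < j)%N -> (j <= g)%N -> tri (Fan i) q -> tri (Fan j) q' ->
  exists2 m, segment (P 0) (Q i) m & enorm (q - m) + enorm (m - q') <= enorm (q - q').
Proof.
move=> /andP[i1 ij] jg tq tq'; have ig : (1 < i < g)%N by lia.
have x0 := fX_gt0 i1; have y0 : 0 < fY i by apply: fY_gt0; lia.
have det00 : det2 (Q i - P 0) (P 0 - P 0) = 0 by rewrite subrr /det2 /= !mulr0 subrr.
have [m sm hm] : exists2 m, segment (P 0) (Q i) m &
    enorm (q - m) + enorm (m - q') <= enorm (q - q') + 2 * 0 * enorm (Q i - P 0); last first.
  by exists m => //; rewrite mulr0 mul0r addr0 in hm.
apply: crossing_point => //.
- by apply/eqP => e; move: x0; rewrite /fX e ltxx.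
- apply: (aff_triangle_ge (aff_det (P 0) (Q i - P 0)) _ _ _ tq); rewrite ?det00//.
    by have := @det_fan i i ig ltac:(lia); rewrite leqnn.
  by have := @det_fan i i.-1 ig ltac:(lia); rewrite leq_pred.
- apply: (aff_triangle_le (aff_det (P 0) (Q i - P 0)) _ _ _ tq'); rewrite ?det00//.
    by have := @det_fan i j ig ltac:(lia); rewrite leqNgt ij.
  have [e|ne] := eqVneq j.-1 i; last by have := @det_fan i j.-1 ig ltac:(lia); rewrite ifF //; apply/negbTE; lia.
  by rewrite e /det2 mulrC subrr.
move=> r sr; rewrite oppr0 addr0.
(* On the line through P_0 and Q_i, the supporting line at P_0 forces r >= 0 and the tangent at Q_i
   forces r <= 1, so no overshoot has to be paid for. *)
pose l p : R := 1 * p.1 + 2 * p.2 + - ((P 0).1 + 2 * (P 0).2).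
pose n p : R := Qb i * p.1 + Qa i * p.2 + 0.
have la : aff l by exists 1, 2, (- ((P 0).1 + 2 * (P 0).2)).
have na : aff n by exists (Qb i), (Qa i), 0.
have lQ k : (0 < k <= g)%N -> 0 <= l (Q k).
  by move=> kg; have := ell_ge0 kg; rewrite /l /fX /fY /=; lra.
have l0 : l (P 0) = 0 by rewrite /l; ring.
have nQ k : (0 < k <= g)%N -> n (Q k) <= n (Q i).
  by move=> kg; have := @fan_support i k ltac:(lia) kg; rewrite /n; lra.
have nd : n (Q i) - n (P 0) = Qb i * fX i + Qa i * fY i by rewrite /n /fX /fY /=; ring.
have nd0 : 0 < n (Q i) - n (P 0).
  by rewrite nd addr_gt0// mulr_gt0 ?Qa_gt0 ?Qb_gt0.
have nP : n (P 0) <= n (Q i) by rewrite -subr_ge0 ltW.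
have lq : 0 <= l q.
  by apply: (aff_triangle_ge la _ _ _ tq); rewrite ?l0//; apply: lQ; lia.
have lq' : 0 <= l q'.
  by apply: (aff_triangle_ge la _ _ _ tq'); rewrite ?l0//; apply: lQ; lia.
have n1 : n q <= n (Q i).
  by apply: (aff_triangle_le na _ _ _ tq) => //; apply: nQ; lia.
have n2 : n q' <= n (Q i).
  by apply: (aff_triangle_le na _ _ _ tq') => //; apply: nQ; lia.
have := aff_segment_ge la lq lq' sr; have := aff_segment_le na n1 n2 sr.
have -> : n (P 0 + r *: (Q i - P 0)) = n (P 0) + r * (n (Q i) - n (P 0)).
  by rewrite /n !planeE /=; ring.
have -> : l (P 0 + r *: (Q i - P 0)) = r * (fX i + 2 * fY i).
  by rewrite /l /fX /fY !planeE /=; ring.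
move=> h1 h2; apply/andP; split.
  by move: h2; rewrite pmulr_lge0//; lra.
have : r * (n (Q i) - n (P 0)) <= 1 * (n (Q i) - n (P 0)) by lra.
by rewrite ler_pM2r.
Qed.

(** A segment between two triangles crosses the spokes in between one after the other. The triangle
    with index 1 is left out because its vertex Q_0 is not on the hyperbola. *)
Lemma fan_dist b i j q q' : (1 < i <= j)%N -> (j <= g)%N -> tri (Fan i) q -> tri (Fan j) q' ->
  flat_dist (clp b (Fan i) q) (clp b (Fan j) q') <= enorm (q - q').
Proof.
move=> ij jg; have [n nE] : exists n, (j - i)%N = n by exists (j - i)%N.
elim: n i q ij nE => [|n IH] i q ij nE tq tq'.
  have -> : j = i by lia.
  by apply: clp_dist => //=; [lia|by have <- : j = i by lia].
have ij' : (1 < i < j)%N by lia.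
have [m sm hm] := fan_cross ij' jg tq tq'.
have [h1 h2 h3] := tri_Fan (R:=R) g i; have [k1 k2 k3] := tri_Fan (R:=R) g i.+1.
have tm : tri (Fan i) m by exact: (triangle_convex h1 h2).
have tm' : tri (Fan i.+1) m by exact: (triangle_convex k1 k3).
have TI := flat_dist_tri (@X_connected R g g3) (clp b (Fan i) m) (clp b (Fan i) q) (clp b (Fan j) q').
apply: le_trans TI _.
apply: le_trans hm; apply: lerD; first by apply: clp_dist => //=; lia.
rewrite glue_fan//; last by lia.
by apply: IH => //; lia.
Qed.

End FanConvex.

(** * Distances within a copy of Pi_g *)

Section MainPieces.
Context {R : realType}.
Variable g : nat.
Hypothesis g3 : (3 <= g)%N.
Local Notation a := (alpha R g).
Local Notation P := (@P R g).
Local Notation Q := (@Q R g).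
Local Notation W := (@W R g).
Local Notation M := (M g).
Local Notation N := (N g).
Local Notation X := (@X R g g3).
Local Notation clp := (@clp R g g3).
Local Notation tri := (@tri R g).
Hypothesis small : a ^+ M <= 50^-1.
Implicit Types (p q A B C D : R * R) (i j k n : nat) (b : bool) (t r : R).

Local Notation c := ((1 - a)^-1).
Local Notation th := (2 * a - 1).
Local Notation u := (a ^+ g).
Local Notation v := (a ^+ g.-1).

Lemma th_le : th <= a ^+ M.
Proof.
by rewrite -alpha_eq//; apply: alpha_exp_le => //; have := M_le g3; lia.
Qed.

(** Since 2 alpha - 1 <= alpha^M <= 1/50, alpha and 1 / (1 - alpha) are confined to intervals small
    enough for the polynomial inequalities of this part. *)
Lemma consts : [/\ a <= 51 / 100, 2 < c, c <= 21 / 10 & a * c = c - 1].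
Proof.
have t := th_le; have h2 := alpha_gt12 (R:=R) g3; have c1 := alpha_inv (R:=R) g3.
have a51 : a <= 51 / 100 by have := le_trans t small; lra.
by split; [by []|nra|nra|lra].
Qed.

Lemma uv : [/\ a * u = th, a * v = u, 0 < u & 0 < v].
Proof.
split; [exact: alphaSg|by rewrite -exprS; congr (_ ^+ _); lia|exact: alpha_exp_gt0|exact: alpha_exp_gt0].
Qed.

Lemma uv_le : u <= 1 / 25 /\ v <= 2 / 25.
Proof.
have [e1 e2 u0 v0] := uv; have [h1 h2 h3 h4] := consts; have h5 := alpha_gt12 (R:=R) g3.
have u1 : u <= 1 / 25 by nra.
by split => //; nra.
Qed.

Lemma ac2 : a ^+ 2 * c = c - 1 - a.
Proof. by have [_ _ _ e] := consts; rewrite expr2 -mulrA e mulrBr e mulr1. Qed.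

Lemma cP0 : P 0 = ((1 - u) / 2, c - 1 - a).
Proof. by rewrite -ac2. Qed.

Lemma cQ0 : Q 0 = (- (u / 2), a). Proof. by []. Qed.

Lemma cQ1 : Q 1 = (a / 2, c - 1 - th * c).
Proof.
have a1 := alpha1_neq0 (R:=R) g3; have [_ _ _ e] := consts.
rewrite QE//; have -> : (g - 1 + 2 = g.+1)%N by lia.
rewrite alpha_eq//; apply: pairP; rewrite /= ?exprS ?expr0.
  by field; rewrite ?a1.
by rewrite mulrBl e.
Qed.

Lemma cP1 : P 1 = (- ((v + u) / 2), c - 1 - a ^+ 2).
Proof.
have a1 := alpha1_neq0 (R:=R) g3; have [_ _ _ e] := consts.
by rewrite P1E -e; apply: pairP; rewrite //= ?exprS ?expr0; field; rewrite ?a1.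
Qed.

Lemma cnv1 : new_vertex g 1 = (0, c - 1) :> R * R.
Proof. by have [_ _ _ e] := consts; rewrite (new_vertex1 g3) e. Qed.

Lemma cQk k : (0 < k <= g)%N -> [/\ a / 2 <= (Q k).1, a <= (Q k).2 & (Q k).2 <= c - 1 - th * c].
Proof.
move=> /andP[k0 kg]; have [_ _ _ e] := consts.
have := cQ1; rewrite !Q_hyp// => -[<- <-] /=; rewrite !lerD2l !lerN2 Qa_le ?Qb_le//; split => //.
have := Qb_le (R:=R) g3 kg; rewrite e; have -> : Qb g g = c - 1 - a :> R.
  by rewrite /Qb subnn add0n ac2.
by move: (Qb g k) => z; lra.
Qed.

Lemma thc : th * c = c - 2.
Proof. by have [_ _ _ h4] := consts; rewrite mulrBl mul1r -mulrA h4; ring. Qed.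

Lemma cQ1' : Q 1 = (a / 2, 1).
Proof. by rewrite cQ1 thc; congr (_, _); ring. Qed.

Lemma real_consts : [/\ 2^-1 < a <= 51 / 100, 2 < c <= 21 / 10, a * c = c - 1,
  0 < u <= 1 / 25 & 0 < v <= 2 / 25] /\ a * u = 2 * a - 1.
Proof.
have [h1 h2 h3 h4] := consts; have h5 := alpha_gt12 (R:=R) g3.
have [e1 e2 u0 v0] := uv; have [u1 v1] := uv_le.
by split => //; split => //; apply/andP.
Qed.

Lemma low_aux A p r : A.1 <= r -> A.2 <= 1 -> p.2 <= 1 -> r <= p.1 ->
  det2 ((r, 1) - A) (p - A) <= 0.
Proof.
move=> h1 h2 h3 h4; rewrite /det2 !planeE /=.
have := mulr_ge0 (_ : 0 <= r - A.1) (_ : 0 <= 1 - p.2); have := mulr_ge0 (_ : 0 <= 1 - A.2) (_ : 0 <= p.1 - r).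
by rewrite !subr_ge0 => /(_ h2 h4) e1 /(_ h1 h3) e2; lra.
Qed.

(** The edges from P_0, Q_0 and P_1 to Q_1 separate in turn the rest of the fan, T_1, the triangle
    P_1Q_0Q_1 and the first attached one. Here the Q_k are put on the side of the fan. *)
Lemma main_low_Q k : (0 < k <= g)%N ->
  [/\ det2 (Q 1 - P 0) (Q k - P 0) <= 0, det2 (Q 1 - Q 0) (Q k - Q 0) <= 0 &
      det2 (Q 1 - P 1) (Q k - P 1) <= 0].
Proof.
move=> kg; have [x1 y1 y2] := cQk kg.
have E : [|| k == 1%N, k == g | (1 < k < g)%N] by lia.
have xk : (1 < k)%N -> 0 < fX g k :> R by exact: fX_gt0.
have yk : (1 < k < g)%N -> 0 < fY g k :> R by move=> h; apply: fY_gt0 => //; lia.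
have [[h1 h2 h3 h4 h5] h6] := real_consts.
have {}y2 : (Q k).2 <= 1 by apply: le_trans y2 _; rewrite thc; lra.
split; rewrite cQ1' ?cP0 ?cQ0 ?cP1.
- case/or3P: E => [/eqP ->|/eqP ->|k1].
  + by rewrite cQ1' /det2 !planeE /=; lra.
  + rewrite -cP0 -[Q g - P 0]opprB Qg_diff// ac2 cP0 /det2 !planeE /=.
    by move: (a) (u) (v) c h1 h2 h3 h4 h5 h6 => ? ? ? ? /andP[? ?] /andP[? ?] ? /andP[? ?] /andP[? ?] ?; nra.
  + have /andP[k2 _] := k1; have := xk k2; have := yk k1; rewrite /fX /fY /det2 cP0 !planeE /=.
    move: (Q k) (a) (u) (v) c h1 h2 h3 h4 h5 h6 => [x y] /= ? ? ? ? /andP[? ?] /andP[? ?] ? /andP[? ?] /andP[? ?] ? *; nra.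
- apply: low_aux => //; rewrite /=.
    by move: (a) (u) h1 h4 => ? ? /andP[? ?] /andP[? ?]; lra.
  by move: (a) h1 => ? /andP[? ?]; lra.
- apply: low_aux => //; rewrite /=.
    by move: (a) (u) (v) h1 h4 h5 => ? ? ? /andP[? ?] /andP[? ?] /andP[? ?]; lra.
  by move: (a) c h1 h2 => ? ? /andP[? ?] /andP[? ?]; nra.
Qed.

Lemma main_low : [/\ det2 (Q 1 - Q 0) (P 0 - Q 0) <= 0, det2 (Q 1 - P 1) (P 0 - P 1) <= 0 &
   det2 (Q 1 - P 1) (Q 0 - P 1) <= 0].
Proof.
have [[h1 h2 h3 h4 h5] h6] := real_consts.
rewrite /det2 ?cQ1' ?cP0 ?cQ0 ?cP1 !planeE /=.
move: (a) (u) (v) c h1 h2 h3 h4 h5 h6 => ? ? ? ? /andP[? ?] /andP[? ?] ? /andP[? ?] /andP[? ?] ?; split; nra.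
Qed.

Lemma main_high : [/\ 0 <= det2 (Q 1 - P 0) (Q 0 - P 0), 0 <= det2 (Q 1 - Q 0) (P 1 - Q 0) &
   0 <= det2 (Q 1 - P 1) (new_vertex g 1 - P 1)].
Proof.
have [[h1 h2 h3 h4 h5] h6] := real_consts.
rewrite /det2 ?cQ1' ?cP0 ?cQ0 ?cP1 ?cnv1 !planeE /=.
move: (a) (u) (v) c h1 h2 h3 h4 h5 h6 => ? ? ? ? /andP[? ?] /andP[? ?] ? /andP[? ?] /andP[? ?] ?; split; nra.
Qed.

(** A convex region containing the fan, P_1Q_0Q_1 and the first attached triangle, bounded at
    heights almost equal to those of the edges to be crossed, which limits the overshoot. *)
Definition box q := [/\ a <= q.2, q.2 <= c - 1 & (P 1).1 <= q.1].

Lemma box_Q k : (0 < k <= g)%N -> box (Q k).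
Proof.
move=> kg; have [x1 y1 y2] := cQk kg; have [[h1 h2 h3 h4 h5] h6] := real_consts.
move: y2; rewrite thc => y2; split => //; first by case/andP: h2; lra.
by rewrite cP1 /=; case/andP: h1; case/andP: h4; case/andP: h5; lra.
Qed.

Lemma box_others : [/\ box (P 0), box (Q 0), box (P 1) & box (new_vertex g 1)].
Proof.
have [[h1 h2 h3 h4 h5] h6] := real_consts.
rewrite /box cP1 cP0 cQ0 cnv1 /=.
by move: (a) (u) (v) c h1 h2 h3 h4 h5 h6 => ? ? ? ? /andP[? ?] /andP[? ?] ? /andP[? ?] /andP[? ?] ?;
  split; split; nra.
Qed.

Lemma box_segment p q m : box p -> box q -> segment p q m -> box m.
Proof.
move=> [p1 p2 p3] [q1 q2 q3] s; split.
- exact: (aff_segment_ge aff2 _ _ s).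
- exact: (aff_segment_le aff2 _ _ s).
- exact: (aff_segment_ge aff1 _ _ s).
Qed.

Lemma box_triangle A B C q : box A -> box B -> box C -> triangle A B C q -> box q.
Proof.
move=> [p1 p2 p3] [q1 q2 q3] [r1 r2 r3] s; split.
- exact: (aff_triangle_ge aff2 _ _ _ s).
- exact: (aff_triangle_le aff2 _ _ _ s).
- exact: (aff_triangle_ge aff1 _ _ _ s).
Qed.

Definition foot (s : nat) : R * R := if s == 0%N then P 0 else if s == 1%N then Q 0 else P 1.

Lemma le_twelve (z B h : R) : 0 <= h -> 5^-1 <= B -> z * B <= 21 / 10 * h -> z <= 12 * h.
Proof. by nra. Qed.

(** Along each edge one coordinate has a rate of at least 1/5, while the box exceeds the edge in
    that coordinate by at most 2.1 (2 alpha - 1); the quotient is below 12 (2 alpha - 1). *)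
Lemma foot_range s r : box (foot s + r *: (Q 1 - foot s)) -> - (12 * th) <= r <= 1 + 12 * th.
Proof.
have [[h1 h2 h3 h4 h5] h6] := real_consts; have t := le_trans th_le small; have ct := thc.
have t0 : 0 <= th by move/andP: h1 => [? ?]; lra.
have c2 : c <= 2 + 21 / 500 by case/andP: h2 => ? ?; nra.
have c0 : c - 1 - 2 * a <= 21 / 10 * th by have e := ac2; case/andP: h2 => ? ?; case/andP: h1 => ? ?; nra.
have c1 : c - 2 <= 21 / 10 * th by case/andP: h2 => ? ?; nra.
rewrite /box /foot; case: eqP => _; [|case: eqP => _]; rewrite cQ1' ?cP0 ?cQ0 ?cP1 !planeE /=.
- move=> [b1 b2 _]; move: h1 h2 => /andP[a0 a1] /andP[d0 d1]; clear -t0 c0 c1 c2 b1 b2 a0 a1 d0 d1.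
  apply/andP; split; first by rewrite lerNl; apply: (@le_twelve _ (1 - (c - 1 - a))); lra.
  by rewrite -lerBlDl; apply: (@le_twelve _ (1 - (c - 1 - a))); lra.
- move=> [b1 b2 _]; move: h1 h2 => /andP[a0 a1] /andP[d0 d1]; clear -t0 c0 c1 c2 b1 b2 a0 a1 d0 d1.
  apply/andP; split; first by rewrite lerNl; apply: (@le_twelve _ (1 - a)); lra.
  by rewrite -lerBlDl; apply: (@le_twelve _ (1 - a)); lra.
- move=> [_ b2 b3]; move: h1 h2 h4 h5 => /andP[a0 a1] /andP[d0 d1] /andP[u0 u1] /andP[v0 v1].
  clear -t0 c0 c1 c2 b2 b3 a0 a1 d0 d1 u0 u1 v0 v1.
  apply/andP; split.
    rewrite lerNl; apply: (@le_twelve _ (a / 2 - - ((v + u) / 2))) => //; first by lra.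
    by lra.
  have a4 : 4^-1 <= a ^+ 2 by rewrite expr2; nra.
  by rewrite -lerBlDl; apply: (@le_twelve _ (1 - (c - 1 - a ^+ 2))); lra.
Qed.

(** 48 = 2 * 12 * 2: twice the overshoot 12 (2 alpha - 1) times the length of the edge, which is at
    most 2. *)
Lemma spoke_cross s q q' : box q -> box q' ->
  0 <= det2 (Q 1 - foot s) (q - foot s) -> det2 (Q 1 - foot s) (q' - foot s) <= 0 ->
  exists2 m, segment (foot s) (Q 1) m & enorm (q - m) + enorm (m - q') <= enorm (q - q') + 48 * a ^+ M.
Proof.
move=> bq bq' d1 d2; have t := th_le.
have [[h1 h2 h3 h4 h5] h6] := real_consts.
have t0 : 0 <= th by move/andP: h1 => [? ?]; lra.
have xB : Q 1 - foot s != 0.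
  apply/eqP => /(congr1 snd); rewrite /foot; case: eqP => _; [|case: eqP => _];
    rewrite cQ1' ?cP0 ?cQ0 ?cP1 !planeE /=;
    move: (a) c h1 h2 => ? ? /andP[? ?] /andP[? ?] ?; nra.
have sB : enorm (Q 1 - foot s) <= 2.
  have := enorm_le12 (Q 1 - foot s).
  have B z y : `|z| <= 1 -> `|y| <= 1 -> enorm (Q 1 - foot s) <= `|z| + `|y| -> enorm (Q 1 - foot s) <= 2 by move=> ? ? h; apply: le_trans h _; lra.
  apply: B; rewrite ler_norml /foot; (case: eqP => _; [|case: eqP => _]);
    rewrite cQ1' ?cP0 ?cQ0 ?cP1 !planeE /=;
    move: (a) (u) (v) c h1 h2 h4 h5 => ? ? ? ? /andP[? ?] /andP[? ?] /andP[? ?] /andP[? ?];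
    apply/andP; split; nra.
have [m sm hm] : exists2 m, segment (foot s) (Q 1) m &
    enorm (q - m) + enorm (m - q') <= enorm (q - q') + 2 * (12 * th) * enorm (Q 1 - foot s).
  apply: crossing_point => //.
  - by lra.
  - by move=> r sr; apply: foot_range; exact: (box_segment bq bq' sr).
exists m => //; apply: le_trans hm _; rewrite lerD2l.
have : th * enorm (Q 1 - foot s) <= a ^+ M * 2 by apply: ler_pM => //; exact: enorm_ge0.
by lra.
Qed.

End MainPieces.

Section MainDist.
Context {R : realType}.
Variable g : nat.
Hypothesis g3 : (3 <= g)%N.
Local Notation a := (alpha R g).
Local Notation P := (@P R g).
Local Notation Q := (@Q R g).
Local Notation W := (@W R g).
Local Notation M := (M g).
Local Notation N := (N g).
Local Notation X := (@X R g g3).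
Local Notation clp := (@clp R g g3).
Local Notation tri := (@tri R g).
Hypothesis small : a ^+ M <= 50^-1.
Local Notation box := (@box R g).
Local Notation foot := (@foot R g).
Implicit Types (p q A B C D : R * R) (i j k n s : nat) (b : bool) (t r : R).

Definition main (pl : place) : bool :=
  match pl with Fan i => (0 < i <= g)%N | Cap i => i == 1%N | Att k => k == 1%N end.

(** The order in which the edges at Q_1 are crossed; rank 0 is the convex part of the fan, and
    [foot] of the rank minus one is the other end of the edge leading back to the previous rank. *)
Definition rank (pl : place) : nat :=
  match pl with Fan i => i == 1%N | Cap _ => 2 | Att _ => 3 end.

Lemma main_vplace pl : main pl -> vplace g pl.
Proof. by have M0 := M_gt0 g3; have N0 := N_gt0 g3; case: pl => [i|i|k] //= /eqP ->. Qed.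

Lemma main_box pl q : main pl -> tri pl q -> box q.
Proof.
have [b0 b1 b2 b3] := box_others g3 small; have bQ1 : box (Q 1) by apply: (box_Q g3 small); lia.
case: pl => [i|i|k] /=; last 2 first.
- by move=> /eqP -> /=; exact: box_triangle.
- by move=> /eqP -> /=; exact: box_triangle.
move=> ig; apply: box_triangle => //; first exact: (box_Q g3 small).
by case: i ig => [|[|i]] // ig; apply: (box_Q g3 small) => /=; lia.
Qed.

Lemma main_low_tri s pl q : main pl -> (rank pl <= s < 3)%N -> tri pl q ->
  det2 (Q 1 - foot s) (q - foot s) <= 0.
Proof.
have z (p B : R * R) : det2 B (p - p) = 0 by rewrite subrr /det2 /= !mulr0 subrr.
have z' (B : R * R) : det2 B B = 0 by rewrite /det2 mulrC subrr.
have L k : (0 < k <= g)%N -> det2 (Q 1 - foot s) (Q k - foot s) <= 0.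
  by move=> /(main_low_Q g3 small)[l1 l2 l3]; rewrite /foot; case: eqP => // _; case: eqP.
have [l1 l2 l3] := main_low g3 small; have L1 := L 1%N ltac:(lia).
have L0 : det2 (Q 1 - foot s) (P 0 - foot s) <= 0.
  by rewrite /foot; case: eqP => _; [rewrite z|case: eqP].
move=> mp rs tq; case: pl mp rs tq => [i|i|k] /=.
- move=> ig rs; apply: (aff_triangle_le (aff_det (foot s) (Q 1 - foot s))) => //; first exact: L.
  case: i ig rs => [|[|i]] //=; last by move=> ig _; apply: L; lia.
  by case: s {L L0 L1} => [|[|s]] // _ _; rewrite /foot /= ?z.
- move=> /eqP -> rs; apply: (aff_triangle_le (aff_det (foot s) (Q 1 - foot s))) => //=.
    by case: s {L L0 L1} rs => [|[|s]] //; rewrite /foot /= ?z.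
  by case: s {L L0 L1} rs => [|[|s]] // _; rewrite /foot /= ?z.
- move=> /eqP -> rs; rewrite eqxx; case: s {L L0 L1} rs => [|[|[|s]]] //.
Qed.

Lemma main_high_tri pl q : main pl -> (0 < rank pl)%N -> tri pl q ->
  0 <= det2 (Q 1 - foot (rank pl).-1) (q - foot (rank pl).-1).
Proof.
have z (p B : R * R) : det2 B (p - p) = 0 by rewrite subrr /det2 /= !mulr0 subrr.
have z' (B : R * R) : det2 B B = 0 by rewrite /det2 mulrC subrr.
have [l1 l2 l3] := main_high g3 small.
case: pl => [i|i|k] /=.
- move=> _; case: eqP => //= -> _; apply: (aff_triangle_ge (aff_det (foot 0) (Q 1 - foot 0))) => //=.
    by rewrite z.
  by rewrite z'.
- move=> /eqP -> _; apply: (aff_triangle_ge (aff_det (foot 1) (Q 1 - foot 1))) => //=.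
    by rewrite z.
  by rewrite z'.
- move=> /eqP -> _; rewrite eqxx; apply: (aff_triangle_ge (aff_det (foot 2) (Q 1 - foot 2))) => //=.
    by rewrite z'.
  by rewrite z.
Qed.

Lemma main_step pl pl' q q' : main pl -> main pl' -> (rank pl < rank pl')%N ->
  tri pl q -> tri pl' q' -> exists2 m, segment (foot (rank pl').-1) (Q 1) m &
    enorm (q' - m) + enorm (m - q) <= enorm (q' - q) + 48 * a ^+ M.
Proof.
move=> mp mp' rr tq tq'; have r3 : (rank pl' <= 3)%N by case: (pl') => [i|i|k] //=; case: eqP.
apply: (spoke_cross g3 small); [exact: main_box tq'|exact: main_box tq| |].
  by apply: main_high_tri => //; lia.
by apply: main_low_tri tq => //; lia.
Qed.

Lemma rank_inj pl pl' : main pl -> main pl' -> (0 < rank pl)%N -> rank pl = rank pl' -> pl = pl'.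
Proof.
case: pl => [i|i|k]; case: pl' => [i'|i'|k'] //=; do ? case: eqP => //=.
all: by do ? move=> ->.
Qed.

Lemma main_dist_rank n b pl pl' q q' : main pl -> main pl' -> rank pl' = n -> (rank pl <= n)%N ->
  tri pl q -> tri pl' q' ->
  flat_dist (clp b pl' q') (clp b pl q) <= enorm (q' - q) + n%:R * (48 * a ^+ M).
Proof.
have N0 := N_gt0 g3; have M0 := M_gt0 g3.
have TI := flat_dist_tri (@X_connected R g g3).
have SC A B m : segment A B m -> segment B A m by rewrite segmentC.
elim: n pl' q' => [|n IH] pl' q' mp mp' r' rr tq tq'.
  rewrite mul0r addr0.
  case: pl' r' mp' tq' => [j|j|j] //=; case: (eqVneq j 1%N) => // j1 _ mp' tq'.
  case: pl rr mp tq => [i|i|k] //=; case: (eqVneq i 1%N) => // i1 _ mp tq.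
  have [ij|ij] := leqP i j.
    by rewrite flat_distC enormC; apply: (fan_dist g3) => //; lia.
  by apply: (fan_dist g3) => //; lia.
have [rr'|rr'] := leqP n.+1 (rank pl).
  have E : pl = pl'.
    by apply: rank_inj => //; lia.
  rewrite -E in tq' *; apply: le_trans (@clp_dist R g g3 b pl q' q (main_vplace mp) tq' tq) _.
  by rewrite lerDl mulr_ge0 ?mulr_ge0// alpha_exp_ge0.
have [m sm hm] := main_step mp mp' ltac:(by rewrite r') tq tq'.
rewrite -natr1 mulrDl mul1r.
have step pl0 : main pl0 -> rank pl0 = n -> tri pl0 m -> tri pl' m -> clp b pl' m = clp b pl0 m ->
    flat_dist (clp b pl' q') (clp b pl q) <= enorm (q' - q) + (n%:R * (48 * a ^+ M) + 48 * a ^+ M).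
  move=> mp0 r0 t0 t1 e; apply: le_trans (TI (clp b pl' m) _ _) _.
  have := @clp_dist R g g3 b pl' q' m (main_vplace mp') tq' t1.
  have := IH pl0 m mp mp0 r0 rr' tq t0; rewrite e; lra.
move: r' sm; case: pl' mp' tq' {IH rr} step => [i|i|k] /= mp' tq' step.
- case: (eqVneq i 1%N) step tq' => // -> /= step _ [n0] sm.
  have [h1 h2 h3] := tri_Fan (R:=R) g 2; have [k1 k2 k3] := tri_Fan (R:=R) g 1.
  apply: (step (Fan 2)) => //=; [lia| | |].
  + exact: (triangle_convex h1 h3).
  + exact: (triangle_convex k1 k2).
  + by apply: (glue_fan g3) => //; lia.
- case: (eqVneq i 1%N) step tq' mp' => // -> /= step _ _ [n0] sm.
  have [h1 h2 h3] := tri_Fan (R:=R) g 1; have [k1 k2 k3] := tri_Cap (R:=R) g 1.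
  apply: (step (Fan 1)) => //=; [lia| | |].
  + exact: (triangle_convex h3 h2).
  + exact: (triangle_convex k2 k3).
  + by rewrite (glue_cap g3).
- case: (eqVneq k 1%N) step tq' mp' => // -> /= step _ _ [n0] sm.
  have [h1 h2 h3] := tri_Cap (R:=R) g 1; have [k1 k2 k3] := tri_Att1 (R:=R) g.
  apply: (step (Cap 1)) => //=.
  + exact: (triangle_convex h1 h3).
  + exact: (triangle_convex k2 k1).
  + by rewrite (glue_att1 g3).
Qed.

(** At most three edges at Q_1 are crossed, at a cost of 48 alpha^M each. *)
Lemma main_dist b pl pl' q q' : main pl -> main pl' -> tri pl q -> tri pl' q' ->
  flat_dist (clp b pl q) (clp b pl' q') <= enorm (q - q') + 144 * a ^+ M.
Proof.
move=> mp mp' tq tq'; wlog rr : pl pl' q q' mp mp' tq tq' / (rank pl' <= rank pl)%N.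
  move=> H; have [r|/ltnW r] := leqP (rank pl') (rank pl); first exact: H.
  by rewrite flat_distC enormC; exact: H.
apply: le_trans (main_dist_rank b mp' mp erefl rr tq' tq) _; rewrite lerD2l mulrA ler_wpM2r ?alpha_exp_ge0//.
have : (rank pl)%:R <= 3 :> R by rewrite ler_nat; case: (pl) => [i|i|k] //=; case: eqP.
by lra.
Qed.

End MainDist.

(** * Collapsing the thin triangles *)

Section Retract.
Context {R : realType}.
Variable g : nat.
Hypothesis g3 : (3 <= g)%N.
Local Notation a := (alpha R g).
Local Notation P := (@P R g).
Local Notation Q := (@Q R g).
Local Notation W := (@W R g).
Local Notation M := (M g).
Local Notation N := (N g).
Local Notation X := (@X R g g3).
Local Notation clp := (@clp R g g3).
Local Notation tri := (@tri R g).
Local Notation main := (@main g).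
Hypothesis small : a ^+ M <= 50^-1.
Implicit Types (p q A B C D : R * R) (i j k n s : nat) (b : bool) (t r e : R).

(** The affine map that fixes A and B and sends C to C' moves each point by at most the distance
    from C to C'. *)
Lemma triangle_collapse A B C C' q e : segment A B C' -> enorm (C - C') <= e ->
  triangle A B C q -> exists2 q', segment A B q' & enorm (q - q') <= e.
Proof.
move=> [t /andP[t0 t1] C'E] he [x [y [z [x0 y0 z0 s qE]]]].
have z1 : z <= 1 by lra.
exists (x *: A + y *: B + z *: C').
  exists (y + z * t).
    apply/andP; split; first by rewrite addr_ge0// mulr_ge0.
    by have := mulr_ge0 z0 (_ : 0 <= 1 - t); rewrite subr_ge0 => /(_ t1); lra.
  by rewrite C'E; apply: pairP; rewrite !planeE /= (_ : x = 1 - y - z); [ring|lra|ring|lra].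
have -> : q - (x *: A + y *: B + z *: C') = z *: (C - C').
  by rewrite qE; apply: pairP; rewrite !planeE /=; ring.
rewrite enormZ ger0_norm//; apply: le_trans he.
by rewrite -[leRHS]mul1r ler_wpM2r ?enorm_ge0.
Qed.

Lemma near_cap i q : (1 < i <= N.+1)%N -> tri (Cap i) q ->
  exists2 q', segment (Q i.-1) (Q i) q' & enorm (q - q') <= a ^+ M.
Proof.
move=> iN; have NM' := NM g3; have M0 := M_gt0 g3.
have a1 := alpha1_neq0 (R:=R) g3; have a2 := alphaD1_neq0 (R:=R) g3.
have [Ma e1] : (M + 2 <= g - i + 2)%N /\ (g - i.-1 + 2 = (g - i + 2).+1)%N by split; lia.
have ia : (i = i.-1.+1)%N by lia.
have PiE := @PE R g i ltac:(lia); have Qi := @QE R g i ltac:(lia); have Qi1 := @QE R g i.-1 ltac:(lia).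
have [h1 h2 h3 h4] := consts g3 small; have h5 := alpha_gt12 (R:=R) g3.
rewrite /tri triangleCA triangleC.
(* The point of the edge vertically below P_i. *)
have s : segment (Q i.-1) (Q i) ((1 - (1 + a)^-1) *: Q i.-1 + (1 + a)^-1 *: Q i).
  exists (1 + a)^-1 => //; apply/andP; split; first by rewrite invr_ge0; lra.
  by rewrite invf_le1; lra.
have d : P i - ((1 - (1 + a)^-1) *: Q i.-1 + (1 + a)^-1 *: Q i) =
    (0, a ^+ (g - i + 2) * ((1 + a ^+ 2) / ((1 + a) * (1 - a)))).
  rewrite PiE Qi Qi1 e1 ia /=; move: (g - i.-1.+1 + 2)%N (i.-1) => n j.
  apply: pairP; rewrite !planeE /= ?exprS ?expr0; field.
    by rewrite a2 a1.
  by rewrite a2 a1.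
set z := _ / _ in d; have z0 : 0 <= z.
  rewrite /z divr_ge0//; first by have := sqr_ge0 a; lra.
  by apply: mulr_ge0; lra.
apply: (triangle_collapse s); rewrite d; apply: le_trans (enorm_le12 _) _.
rewrite /= normr0 add0r ger0_norm; last by rewrite mulr_ge0 ?alpha_exp_ge0.
have := @alpha_exp_le R g g3 _ _ Ma; rewrite [a ^+ (M + 2)]exprD.
have : a ^+ 2 * z <= 1.
  rewrite mulrA ler_pdivrMr; last by rewrite mulr_gt0//; lra.
  have y1 : a ^+ 2 <= 27 / 100 by rewrite expr2; nra.
  rewrite (_ : (1 + a) * (1 - a) = 1 - a ^+ 2); last by rewrite expr2; ring.
  by move: (a ^+ 2) (sqr_ge0 a) y1 => y y0 y1; nra.
have a0 := alpha_exp_gt0 (R:=R) g3 M; have a20 := alpha_exp_gt0 (R:=R) g3 2.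
move: (a ^+ M) (a ^+ 2) (a ^+ (_ + _)) (z) z0 a0 a20 => x y w z' z0 x0 y0 h e.
have : w * z' <= x * y * z' by rewrite ler_wpM2r.
by have := ler_wpM2l (ltW x0) h; lra.
Qed.

Lemma near_att k q : (1 < k <= M)%N -> tri (Att k) q ->
  exists2 q', segment (W k.-2) (W k.-1) q' & enorm (q - q') <= 65 / 100 * a ^+ (g - k).
Proof.
move=> kM; have MM := M_le g3.
have a1 := alpha1_neq0 (R:=R) g3; have a2 := alphaD1_neq0 (R:=R) g3.
have [h1 h2 h3 h4] := consts g3 small; have h5 := alpha_gt12 (R:=R) g3.
have k1 : (k == 1)%N = false by apply/negbTE; clear -kM; lia.
have [e1 e2 e3 e4] : [/\ k = k.-2.+2, k.-1 = k.-2.+1, (g - k.-1 = (g - k).+1)%N & (g - k.-2 = (g - k).+2)%N].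
  by clear -kM MM; split; lia.
have [l0 l1 l2] : [/\ k < g, k.-1 < g & k.-2 < g]%N by clear -kM MM g3; split; lia.
have WEk := WE (R:=R) g3 l0; have WEk1 := WE (R:=R) g3 l1; have WEk2 := WE (R:=R) g3 l2.
rewrite /tri k1 triangleC triangleCA.
(* The point of the edge at the height of W_k. *)
have s : segment (W k.-2) (W k.-1) ((1 - (1 - a)) *: W k.-2 + (1 - a) *: W k.-1).
  by exists (1 - a) => //; apply/andP; split; lra.
have d : W k - ((1 - (1 - a)) *: W k.-2 + (1 - a) *: W k.-1) = (- (a ^+ (g - k) * ((1 + a ^+ 2) / 2)), 0).
  rewrite WEk WEk1 WEk2 e3 e4 {2}e1 e2; apply: pairP; rewrite !planeE /= ?exprS; by field; rewrite ?a1.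
apply: (triangle_collapse s); rewrite d; apply: le_trans (enorm_le12 _) _.
rewrite /= normr0 addr0 normrN ger0_norm; last first.
  by rewrite mulr_ge0 ?alpha_exp_ge0//; have := sqr_ge0 a; lra.
by rewrite mulrC ler_wpM2r ?alpha_exp_ge0// expr2; nra.
Qed.

Lemma near_main b pl q : vplace g pl -> tri pl q -> exists pl' q',
  [/\ main pl', tri pl' q', enorm (q - q') <= 3 * a ^+ M &
      flat_dist (clp b pl q) (clp b pl' q') <= 3 * a ^+ M].
Proof.
have NM' := NM g3; have M0 := M_gt0 g3; have MM := M_le g3; have N0 := N_gt0 g3.
have a0 n := alpha_exp_ge0 (R:=R) g3 n.
have same pl0 : main pl0 -> forall q, tri pl0 q -> exists pl' q',
  [/\ main pl', tri pl' q', enorm (q - q') <= 3 * a ^+ M &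
      flat_dist (clp b pl0 q) (clp b pl' q') <= 3 * a ^+ M].
  move=> mp q0 tq; exists pl0, q0; split => //; first by rewrite subrr enorm0 mulr_ge0.
  by apply: le_trans (flat_dist_xx _) _; rewrite mulr_ge0.
case: pl => [i|i|k] vp tq.
- exact: same.
- have [i1|i1] := eqVneq i 1%N; first by apply: same => //; rewrite i1.
  have [q' s h] := @near_cap i q ltac:(by move: vp => /=; lia) tq.
  have [c1 c2 c3] := tri_Cap (R:=R) g i; have [d1 d2 d3] := tri_Fan (R:=R) g i.
  exists (Fan i), q'; split.
  + by move: vp => /=; lia.
  + exact: (triangle_convex d3 d2).
  + by apply: le_trans h _; have := a0 M; lra.
  rewrite (glue_cap g3)//; apply: le_trans (@clp_dist R g g3 b (Cap i) q q' vp tq _) _.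
    exact: (triangle_convex c2 c3).
  by apply: le_trans h _; have := a0 M; lra.
have [k1|k1] := eqVneq k 1%N; first by apply: same => //; rewrite k1.
(* The attached triangles are collapsed one onto the other. Each step down in k multiplies the
   displacement by alpha <= 0.51, and the factor 2 dominates the geometric sum. *)
suff [pl' [q' [mp tq' h1 h2]]] : exists pl' q', [/\ main pl', tri pl' q', enorm (q - q') <= 2 * a ^+ (g - k) &
      flat_dist (clp b (Att k) q) (clp b pl' q') <= 2 * a ^+ (g - k)].
  have h : a ^+ (g - k) <= a ^+ M by apply: alpha_exp_le => //; move: vp => /=; lia.
  exists pl', q'; split => //; [apply: le_trans h1 _|apply: le_trans h2 _]; have := a0 M; lra.
have [h1 _ _ _] := consts g3 small; have h5 := alpha_gt12 (R:=R) g3.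
have k2 : (1 < k)%N by move: vp => /=; lia.
elim: k {k1} k2 q vp tq => // k IH k2 q vp tq.
have [q' s h] := @near_att k.+1 q ltac:(by move: vp => /=; lia) tq.
have [c1 c2 c3] := @tri_Att R g k.+1 k2.
have tq' : tri (Att k.+1) q' by move: c1 c3; rewrite /tri; case: ifP => _ c1 c3; exact: (triangle_convex c3 c1).
have F := @clp_dist R g g3 b (Att k.+1) q q' vp tq tq'.
have [k1|k1] := eqVneq k 1%N.
  subst k; move: s h tq tq' F {c1 c2 c3 IH k2} => /= s h tq tq' F.
  have [d1 d2 d3] := tri_Cap (R:=R) g 1.
  exists (Cap 1), q'; split => //.
  + exact: (triangle_convex d2 d1).
  + by apply: le_trans h _; have := a0 (g - 2)%N; lra.
  + rewrite (glue_att2 g3)//.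
    by apply: le_trans (le_trans F h) _; have := a0 (g - 2)%N; lra.
have k1' : (1 < k)%N by lia.
have [d1 d2 d3] := @tri_Att R g k k1'.
have tk : tri (Att k) q' by move: d1 d2; rewrite /tri; case: ifP => _ d1 d2; exact: (triangle_convex d1 d2).
have [pl' [q2 [mp tq2 h2 h3]]] := IH k1' q' ltac:(by move: vp => /=; lia) tk.
have E : a ^+ (g - k) = a * a ^+ (g - k.+1) by rewrite -exprS; congr (_ ^+ _); clear -vp MM k2; move: vp => /=; lia.
have G : clp b (Att k) q' = clp b (Att k.+1) q' by apply: (glue_att g3) => //; clear -vp k1'; move: vp => /=; lia.
exists pl', q2; split => //.
- apply: le_trans (enorm_tri q' _ _) _; move: h h2; rewrite E.
  have := a0 (g - k.+1)%N; move: (a ^+ _) (enorm _) (enorm _) => x y z ? ? ?; nra.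
- apply: le_trans (flat_dist_tri (@X_connected R g g3) (clp b (Att k.+1) q') _ _) _.
  have {}F := le_trans F h; rewrite G in h3; move: F h3; rewrite E.
  have := a0 (g - k.+1)%N; move: (a ^+ _) (flat_dist _ _) (flat_dist _ _) => x y z ? ? ?; nra.
Qed.

(** Both points are first moved to the main triangles. The constant is 156 = 144 + 4 * 3: each of
    the two moves costs 3 alpha^M once in X_g and once in the plane. *)
Theorem clp_almost_isometric b pl pl' q q' : vplace g pl -> vplace g pl' -> tri pl q -> tri pl' q' ->
  flat_dist (clp b pl q) (clp b pl' q') <= enorm (q - q') + 156 * a ^+ M.
Proof.
move=> vp vp' tq tq'.
have [p1 [q1 [m1 t1 d1 f1]]] := near_main b vp tq.
have [p2 [q2 [m2 t2 d2 f2]]] := near_main b vp' tq'.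
have TI := flat_dist_tri (@X_connected R g g3).
have h := main_dist g3 small b m1 m2 t1 t2.
apply: le_trans (TI (clp b p1 q1) _ _) _.
have i1 := TI (clp b p2 q2) (clp b p1 q1) (clp b pl' q'); rewrite flat_distC in f2.
have i2 := enorm_tri q q1 q2; have i3 := enorm_tri q' q q2; rewrite (enormC q1 q) in i2.
lra.
Qed.

End Retract.

(** * Triangles from P_0 to the boundary of Pi_g *)

Section StarShaped.
Context {R : realType}.
Variable g : nat.
Hypothesis g3 : (3 <= g)%N.
Local Notation a := (alpha R g).
Local Notation P := (@P R g).
Local Notation Q := (@Q R g).
Local Notation W := (@W R g).
Local Notation M := (M g).
Local Notation N := (N g).
Local Notation tri := (@tri R g).
Hypothesis small : a ^+ M <= 50^-1.
Implicit Types (p q A B C D O : R * R) (i j k n : nat) (b : bool) (t : R).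

Local Notation c := ((1 - a)^-1).
Local Notation th := (2 * a - 1).
Local Notation u := (a ^+ g).
Local Notation v := (a ^+ g.-1).

Definition Pi : set (R * R) := [set q | exists2 pl, vplace g pl & tri pl q].

(* B, V, C seen from O in counterclockwise order *)
Definition in_cone O B C V :=
  [/\ 0 < det2 (B - O) (C - O), 0 <= det2 (V - O) (C - O) & 0 <= det2 (B - O) (V - O)].

Lemma in_coneP O B C V : in_cone O B C V ->
  exists s t, [/\ 0 <= s, 0 <= t & V = O + s *: (B - O) + t *: (C - O)].
Proof.
move=> [d0 d1 d2]; exists (det2 (V - O) (C - O) / det2 (B - O) (C - O)), (det2 (B - O) (V - O) / det2 (B - O) (C - O)).
split; [exact: divr_ge0 d1 (ltW d0)|exact: divr_ge0 d2 (ltW d0)|].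
move: d0; rewrite /det2 !planeE /= => d0; have d0' := lt0r_neq0 d0.
by apply: pairP; rewrite ?planeE /=; field.
Qed.

(** In the affine coordinates with origin O and basis B - O, C - O, a point of OBV lies in OBC or
    beyond BC according to whether the sum of its coordinates is at most 1. *)
Lemma in_cone_sub O B C V : in_cone O B C V ->
  triangle O B V `<=` triangle O B C `|` triangle B C V.
Proof.
move=> /in_coneP[s [t [s0 t0 VE]]] q [x [y [z [x0 y0 z0 e qE]]]].
have [h|h] := leP (y + z * (s + t)) 1.
  left; exists (1 - (y + z * (s + t))), (y + z * s), (z * t).
  split; [lra|by rewrite ?addr_ge0 ?mulr_ge0|by rewrite ?addr_ge0 ?mulr_ge0|ring|].
  by rewrite qE VE (_ : x = 1 - y - z); [apply: pairP; rewrite !planeE /=; ring|lra].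
have st : 0 < s + t - 1 by rewrite -(@pmulr_rgt0 _ z); [lra|rewrite lt_def z0 andbT; apply/eqP => ze; rewrite ze in e h; lra].
(* O is eliminated through O = (s B + t C - V) / (s + t - 1). *)
right; exists (y + x * s / (s + t - 1)), (x * t / (s + t - 1)), (z - x / (s + t - 1)).
have st' := lt0r_neq0 st.
split.
- by rewrite addr_ge0// divr_ge0 ?mulr_ge0// ltW.
- by rewrite divr_ge0 ?mulr_ge0// ltW.
- by rewrite subr_ge0 ler_pdivrMr//; lra.
- by rewrite -[RHS]e; field.
by rewrite qE VE; apply: pairP; rewrite !planeE /=; field.
Qed.

Lemma in_cone_sub' O B C V : in_cone O B C V ->
  triangle O C V `<=` triangle O B C `|` triangle B C V.
Proof.
move=> /in_coneP[s [t [s0 t0 VE]]] q [x [y [z [x0 y0 z0 e qE]]]].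
have [h|h] := leP (y + z * (s + t)) 1.
  left; exists (1 - (y + z * (s + t))), (z * s), (y + z * t).
  split; [lra|by rewrite ?addr_ge0 ?mulr_ge0|by rewrite ?addr_ge0 ?mulr_ge0|ring|].
  by rewrite qE VE (_ : x = 1 - y - z); [apply: pairP; rewrite !planeE /=; ring|lra].
have st : 0 < s + t - 1 by rewrite -(@pmulr_rgt0 _ z); [lra|rewrite lt_def z0 andbT; apply/eqP => ze; rewrite ze in e h; lra].
right; exists (x * s / (s + t - 1)), (y + x * t / (s + t - 1)), (z - x / (s + t - 1)).
have st' := lt0r_neq0 st.
split.
- by rewrite divr_ge0 ?mulr_ge0// ltW.
- by rewrite addr_ge0// divr_ge0 ?mulr_ge0// ltW.
- by rewrite subr_ge0 ler_pdivrMr//; lra.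
- by rewrite -[RHS]e; field.
by rewrite qE VE; apply: pairP; rewrite !planeE /=; field.
Qed.

(** Attaching a triangle BCV whose tip is seen from P_0 between B and C keeps the region
    star-shaped. Applied along the boundary of Pi_g, this shows that the triangles on which iota_g
    is affine are mapped into Pi_g. *)
Lemma star_step B C V : in_cone (P 0) B C V -> triangle (P 0) B C `<=` Pi -> triangle B C V `<=` Pi ->
  triangle (P 0) B V `<=` Pi /\ triangle (P 0) V C `<=` Pi.
Proof.
move=> ic h1 h2; split => q.
  by move=> /(in_cone_sub ic)[/h1|/h2].
by rewrite triangleC => /(in_cone_sub' ic)[/h1|/h2].
Qed.

Lemma star_fan i : (0 < i <= g)%N -> triangle (P 0) (Q i) (Q i.-1) `<=` Pi.
Proof. by move=> ig q tq; exists (Fan i). Qed.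

Lemma cone_cap i : (1 < i <= N.+1)%N -> in_cone (P 0) (Q i) (Q i.-1) (P i).
Proof.
move=> iN; have NM' := NM g3; have M0 := M_gt0 g3; have NM2 := N_le g3.
have [j ji] : exists j, i = j.+1 by exists i.-1; lia.
subst i; rewrite /=.
have [n1 n2 n3 n4] : [/\ 1 < j.+1 < g, 0 < j < g.-1, 0 < j < g & 0 < j.+1 < g]%N by split; lia.
have [jM jj j0 j1] : [/\ M + 3 <= g - j + 2, j + 3 <= g - j + 2, 0 < j & 1 < j.+1]%N by split; lia.
have d1 := @QP_diff R g g3 j.+1 n1; have d2 := @PQ_diff R g g3 j n2.
have x1 : 0 < fX g j.+1 :> R by exact: fX_gt0.
have y1 : 0 < fY g j.+1 :> R by exact: fY_gt0.
have y0 : 0 < fY g j :> R by exact: fY_gt0.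
have yle : fY g j.+1 <= fY g j :> R by exact: fY_le.
have [[h1 h2 h3 h4 h5] h6] := real_consts g3 small.
have xle : fX g j <= 62 / 100 :> R.
  rewrite (fXE g3)//.
  by have := Qa_gt0 (R:=R) g3 j; case/andP: h4 => ? ?; case/andP: h2 => ? ?; lra.
have yge : 45 / 100 <= fY g j :> R.
  rewrite (fYE g3)//.
  have aM := @alpha_exp_le R g g3 _ _ jM; rewrite [a ^+ (M + 3)]exprD in aM.
  have a3 : a ^+ 3 <= 1 / 7.
    by case/andP: h1 => l0 l1; clear -l0 l1; rewrite !exprS expr0; nra.
  have aM0 := alpha_exp_gt0 (R:=R) g3 M; have a30 := alpha_exp_gt0 (R:=R) g3 3.
  rewrite /Qb; case/andP: h1 => ? ?; case/andP: h2 => ? ?.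
  move: (a ^+ (_ + _)) (a ^+ M) (a ^+ 3) aM a3 aM0 a30 small => x y z H1 H2 H3 H4 H5.
  have : y * z <= 50^-1 * (1 / 7) by apply: ler_pM => //; exact: ltW.
  by nra.
have pE : P j.+1 - P 0 = (fX g j + a ^+ j / 2, fY g j + a ^+ (g - j + 2) * c) :> R * R.
  by rewrite -(subrKA (Q j)) d2; apply: pairP; rewrite ?planeE /= addrC.
have qE : Q j.+1 - P 0 = P j.+1 - P 0 + (a ^+ j.+1 / 2, - (a ^+ (g - j.+1 + 2) * c)).
  by rewrite -d1 [RHS]addrC subrKA.
have q0E : Q j - P 0 = (fX g j, fY g j) :> R * R by rewrite /fX /fY; case: (Q j - P 0).
have c0 : 0 < c by case/andP: h2 => c2 _; clear -c2; lra.
have al : 0 < a ^+ j / 2 by rewrite divr_gt0 ?ltr0n// alpha_exp_gt0.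
have al' : 0 < a ^+ j.+1 / 2 by rewrite divr_gt0 ?ltr0n// alpha_exp_gt0.
have de' : 0 < a ^+ (g - j.+1 + 2) * c by rewrite mulr_gt0// alpha_exp_gt0.
have de : 0 < a ^+ (g - j + 2) * c by rewrite mulr_gt0// alpha_exp_gt0.
(* The edge Q_jP_(j+1) has slope at most 0.56, while Q_j, seen from P_0, is at height at least 0.45
   and abscissa at most 0.62, a steeper direction. Hence the tip stays in the cone. *)
have dle : a ^+ (g - j + 2) * c <= 28 / 100 * a ^+ j.
  have aj := @alpha_exp_le R g g3 _ _ jj; rewrite [a ^+ (j + 3)]exprD in aj.
  have a3 : a ^+ 3 * c <= 28 / 100.
    have a3 : a ^+ 3 <= 133 / 1000 by case/andP: h1 => l0 l1; clear -l0 l1; rewrite !exprS expr0; nra.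
    by case/andP: h2 => k0 k1; move: (a ^+ 3) (alpha_exp_gt0 (R:=R) g3 3) a3 => z z0 z1; clear -k0 k1 z0 z1; nra.
  apply: (@le_trans _ _ (a ^+ j * a ^+ 3 * c)); first by rewrite ler_wpM2r// ltW.
  by rewrite -mulrA mulrC ler_wpM2r// alpha_exp_ge0.
have eQ : fX g j.+1 = fX g j + a ^+ j / 2 + a ^+ j.+1 / 2 :> R.
  by rewrite {1}/fX qE pE.
have eQ2 : fY g j.+1 = fY g j + a ^+ (g - j + 2) * c - a ^+ (g - j.+1 + 2) * c :> R.
  by rewrite {1}/fY qE pE.
have aj0 := alpha_exp_gt0 (R:=R) g3 j.
rewrite /in_cone qE pE q0E /det2 !planeE /=.
move: (fX g j.+1) (fY g j.+1) eQ eQ2 x1 y1 yle => X1 Y1 eQ eQ2 x1 y1 yle.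
move: (fX g j) (fY g j) (a ^+ j) (a ^+ j.+1) (a ^+ (g - j + 2) * c) (a ^+ (g - j.+1 + 2) * c)
  eQ eQ2 xle yge yle al al' de de' dle aj0 => X Y A A' D D' eQ eQ2 xle yge yle al al' de de' dle aj0.
rewrite -eQ -eQ2; clear -eQ eQ2 xle yge yle al al' de de' dle aj0 x1 y1.
have D1 : 0 < A * (Y - 45 / 100) + 1 by have : 0 <= A * (Y - 45 / 100) by [apply: mulr_ge0; lra]; lra.
split; nra.
Qed.

Lemma cone_cap1 : in_cone (P 0) (Q 1) (Q 0) (P 1).
Proof.
have [[h1 h2 h3 h4 h5] h6] := real_consts g3 small.
rewrite /in_cone /det2 (cQ1' g3 small) (cP0 g3 small) (cQ0 g) (cP1 g3 small) !planeE /=.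
move: (a) (u) (v) c h1 h2 h3 h4 h5 h6 => ? ? ? ? /andP[? ?] /andP[? ?] ? /andP[? ?] /andP[? ?] ?; split; nra.
Qed.

Lemma cone_new : in_cone (P 0) (Q 1) (P 1) (new_vertex g 1).
Proof.
have [[h1 h2 h3 h4 h5] h6] := real_consts g3 small.
rewrite /in_cone /det2 (cQ1' g3 small) (cP0 g3 small) (cP1 g3 small) (cnv1 g3 small) !planeE /=.
move: (a) (u) (v) c h1 h2 h3 h4 h5 h6 => ? ? ? ? /andP[? ?] /andP[? ?] ? /andP[? ?] /andP[? ?] ?; split; nra.
Qed.

End StarShaped.

(** * The strip of attached triangles seen from P_0 *)

Section StripInequality.
Context {R : realType}.

(** The three determinants of [in_cone] for W_(k-2), W_(k-1), W_k with k even, where r is alpha, y =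
    alpha^(k-2), x = alpha^(g-k) / (2 (1 - alpha)), f = [C0 g], and s, e are [stripX], [stripY]. The
    negative terms in e are absorbed using x <= 3y/10 and e <= f; for k odd, in [strip_ineq'], these
    terms are positive. *)
Lemma strip_ineq (x y s e f r : R) : 2^-1 < r <= 51 / 100 -> 43 / 100 <= s -> 0 < y -> 0 <= x <= 3 / 10 * y ->
  0 < f -> 0 <= e <= f ->
  [/\ 0 < f * (1 + r) * y * s + x * (e * (r ^+ 2 - r) + f * y * (r ^+ 3 + r)),
      0 <= f * (1 - r ^+ 2) * y * s + x * (- (1 - r ^+ 2) * e + f * y * (1 - r ^+ 4)) &
      0 <= f * (r + r ^+ 2) * y * s + x * (- (1 - r) * e + f * y * (r ^+ 3 + r))].
Proof.
move=> /andP[r0 r1] s0 y0 /andP[x0 x1] f0 /andP[e0 e1].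
have fy : 0 < f * y by rewrite mulr_gt0.
have xe0 : 0 <= x * e by rewrite mulr_ge0.
have xe1 : x * e <= 3 / 10 * (f * y).
  by apply: (@le_trans _ _ (3 / 10 * y * f)); [apply: ler_pM|lra].
have fys : 43 / 100 * (f * y) <= f * y * s by rewrite mulrC ler_wpM2l// ltW.
have xfy : 0 <= x * (f * y) by rewrite mulr_ge0// ltW.
have r2 : 4^-1 < r ^+ 2 <= 261 / 1000 by rewrite expr2; apply/andP; split; nra.
have r3 : 0 < r ^+ 3 by rewrite exprn_gt0//; clear -r0; lra.
have r4 : r ^+ 4 <= 1 by rewrite exprn_ile1//; clear -r0 r1; lra.
case/andP: r2 => r2 r2'.
have -> : f * (1 + r) * y * s = (1 + r) * (f * y * s) by ring.
have -> : f * (1 - r ^+ 2) * y * s = (1 - r ^+ 2) * (f * y * s) by ring.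
have -> : f * (r + r ^+ 2) * y * s = (r + r ^+ 2) * (f * y * s) by ring.
move: (f * y) fy fys xfy xe1 => Y fy fys xfy xe1; move: (Y * s) fys => Z fys.
have -> : x * (e * (r ^+ 2 - r) + Y * (r ^+ 3 + r)) = x * e * (r ^+ 2 - r) + x * Y * (r ^+ 3 + r) by ring.
have -> : x * (- (1 - r ^+ 2) * e + Y * (1 - r ^+ 4)) = - (1 - r ^+ 2) * (x * e) + x * Y * (1 - r ^+ 4) by ring.
have -> : x * (- (1 - r) * e + Y * (r ^+ 3 + r)) = - (1 - r) * (x * e) + x * Y * (r ^+ 3 + r) by ring.
have p3 : 0 <= x * Y * (r ^+ 3 + r) by rewrite mulr_ge0//; clear -r0 r3; lra.
have p4 : 0 <= x * Y * (1 - r ^+ 4) by rewrite mulr_ge0//; clear -r4; lra.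
move: (x * e) (x * Y * _) (x * Y * _) (r ^+ 2) r2 r2' p3 p4 xe0 xe1 => V A B r' q1 q2 q3 q4 q5 q6.
by clear -r0 r1 fy fys q1 q2 q3 q4 q5 q6; split; nra.
Qed.

Lemma strip_ineq' (x y s e f r : R) : 2^-1 < r <= 51 / 100 -> 43 / 100 <= s -> 0 < y -> 0 <= x ->
  0 < f -> 0 <= e ->
  [/\ 0 < f * (1 + r) * y * s + x * (r * (1 - r) * e + f * y * (r ^+ 3 + r)),
      0 <= f * (1 - r ^+ 2) * y * s + x * ((1 - r ^+ 2) * e + f * y * (1 - r ^+ 4)) &
      0 <= f * (r + r ^+ 2) * y * s + x * ((1 - r) * e + f * y * (r ^+ 3 + r))].
Proof.
move=> /andP[r0 r1] s0 y0 x0 f0 e0.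
have r' : 0 < r by lra.
have r'' : 0 <= 1 - r by lra.
have p2 : 0 < r ^+ 2 by rewrite exprn_gt0.
have p3 : 0 < r ^+ 3 by rewrite exprn_gt0.
have r2 : 0 <= 1 - r ^+ 2 by rewrite subr_ge0 exprn_ile1//; lra.
have r4 : 0 <= 1 - r ^+ 4 by rewrite subr_ge0 exprn_ile1//; lra.
have s0' : 0 < s by lra.
have q1 : 0 <= r ^+ 3 + r by lra.
have q2 : 0 <= r + r ^+ 2 by lra.
have q3 : 0 < 1 + r by lra.
split.
- apply: ltr_wpDr; last by rewrite !mulr_gt0.
  by apply: mulr_ge0 => //; apply: addr_ge0; rewrite !mulr_ge0 ?(ltW r') ?(ltW f0) ?(ltW y0).
- apply: addr_ge0; first by rewrite !mulr_ge0 ?(ltW f0) ?(ltW y0) ?(ltW s0').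
  by apply: mulr_ge0 => //; apply: addr_ge0; rewrite !mulr_ge0 ?(ltW f0) ?(ltW y0).
- apply: addr_ge0; first by rewrite !mulr_ge0 ?(ltW f0) ?(ltW y0) ?(ltW s0').
  by apply: mulr_ge0 => //; apply: addr_ge0; rewrite !mulr_ge0 ?(ltW f0) ?(ltW y0).
Qed.

End StripInequality.

Section Strip.
Context {R : realType}.
Variable g : nat.
Hypothesis g3 : (3 <= g)%N.
Local Notation a := (alpha R g).
Local Notation P := (@P R g).
Local Notation Q := (@Q R g).
Local Notation W := (@W R g).
Local Notation M := (M g).
Local Notation N := (N g).
Local Notation tri := (@tri R g).
Hypothesis small : a ^+ M <= 50^-1.
Implicit Types (p q A B C D O : R * R) (i j k n : nat) (b : bool) (t : R).

Local Notation c := ((1 - a)^-1).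
Local Notation th := (2 * a - 1).
Local Notation u := (a ^+ g).
Local Notation v := (a ^+ g.-1).

Local Notation in_cone := (@in_cone R).
Local Notation Pi := (@Pi R g).

(** [stripY] is the height, relative to P_0, of the axis about which the W_k oscillate; [stripX] is
    the part of their horizontal distance to P_0 that does not depend on k. *)
Definition stripX : R := (1 - u - th * c) / 2.
Definition stripY : R := C0 g - (c - 1 - 2 * a).

Lemma W_P0 k : (k < g)%N ->
  W k - P 0 = (- (stripX + a ^+ (g - k) * (c / 2)), stripY - C0 g * (- a) ^+ k).
Proof.
move=> kg; rewrite WE// (cP0 g3 small) alpha_eq// /stripX /stripY invfM.
by apply: pairP; rewrite !planeE /=; field; rewrite ?alpha1_neq0.
Qed.

Lemma strip_bounds : [/\ 43 / 100 <= stripX, 0 < C0 g :> R & 0 <= stripY <= C0 g].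
Proof.
have [[h1 h2 h3 h4 h5] h6] := real_consts g3 small; have t := le_trans (th_le g3 small) small.
case/andP: h1 => a0 a1; case/andP: h2 => c0 c1; case/andP: h4 => u0 u1.
have tc : th * c <= 42 / 1000.
  by apply: (@le_trans _ _ (50^-1 * (21 / 10))); [apply: ler_pM => //; lra|lra].
have C0E : C0 g = a ^+ 3 * (c / (1 + a)) by rewrite /C0 invfM.
have c16 : 130 / 100 <= c / (1 + a) by rewrite ler_pdivlMr; clear -a0 a1 c0; lra.
have a3 : 125 / 1000 <= a ^+ 3 by rewrite !exprS expr0; nra.
have C1 : 16 / 100 <= C0 g :> R.
  by rewrite C0E; move: (a ^+ 3) (c / (1 + a)) a3 c16 => z w; clear; move=> ? ?; nra.
have e1 : c - 1 - 2 * a = th * c * a.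
  have -> : th * c * a = th * (a * c) by ring.
  rewrite h3; have -> : th * (c - 1) = 2 * (a * c) - 2 * a - c + 1 by ring.
  by rewrite h3; ring.
have th0 : 0 <= th by clear -a0; lra.
have a0' : 0 <= a by clear -a0; lra.
have c0' : 0 <= c by clear -c0; lra.
have t0 : 0 <= th * c * a := mulr_ge0 (mulr_ge0 th0 c0') a0'.
have t1 : th * c * a <= 42 / 1000 * 1 by apply: ler_pM => //; [exact: mulr_ge0|clear -a1; lra].
split; [by rewrite /stripX; clear -u1 tc; lra|by clear -C1; lra|].
by rewrite /stripY e1; clear -t0 t1 C1; apply/andP; split; lra.
Qed.

(** The W_k lie alternately above and below their axis, so the parity of k decides in which order
    W_(k-2) and W_(k-1) are seen from P_0. *)
Lemma cone_strip k : (1 < k <= M)%N ->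
  if odd k then in_cone (P 0) (W k.-2) (W k.-1) (W k) else in_cone (P 0) (W k.-1) (W k.-2) (W k).
Proof.
have MM := M_le g3; case: k => [|[|j]]//= jM.
have [k0 k1 k2] : [/\ j < g, j.+1 < g & j.+2 < g]%N by split; lia.
have [e0 e1 jj] : [/\ g - j = (g - j.+2).+2, g - j.+1 = (g - j.+2).+1 & j + 2 <= g - j.+2]%N by split; lia.
have w0 := W_P0 k0; have w1 := W_P0 k1; have w2 := W_P0 k2.
have [s0 f0 E01] := strip_bounds; have [[h1 h2 h3 h4 h5] h6] := real_consts g3 small.
have y0 := alpha_exp_gt0 (R:=R) g3 j; have x0 := alpha_exp_gt0 (R:=R) g3 (g - j.+2).
have xy := @alpha_exp_le R g g3 _ _ jj; rewrite [a ^+ (j + 2)]exprD in xy.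
have x01 : 0 <= a ^+ (g - j.+2) * (c / 2) <= 3 / 10 * a ^+ j.
  case/andP: h1 => a0 a1; case/andP: h2 => c0 c1.
  have a2 : a ^+ 2 <= 261 / 1000 by rewrite expr2; nra.
  apply/andP; split; first by rewrite mulr_ge0 ?alpha_exp_ge0//; clear -c0; lra.
  apply: (@le_trans _ _ (a ^+ j * a ^+ 2 * (105 / 100))); first by apply: ler_pM; rewrite ?alpha_exp_ge0//; [clear -c0|clear -c1]; lra.
  have ja : a ^+ j * a ^+ 2 <= a ^+ j * (261 / 1000) by rewrite ler_wpM2l// ltW.
  by clear -ja y0; lra.
have [i1 i2 i3] := strip_ineq h1 s0 y0 x01 f0 E01.
have x1 : 0 <= a ^+ (g - j.+2) * (c / 2) by case/andP: x01.
have ee : 0 <= stripY by case/andP: E01.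
have [j1 j2 j3] := strip_ineq' h1 s0 y0 x1 f0 ee.
rewrite -signE in w0; rewrite -signE in w1; rewrite -signE in w2.
rewrite e0 in w0; rewrite e1 in w1; rewrite ![a ^+ (_).+1]exprS /= in w0 w1 w2.
move: i1 i2 i3 j1 j2 j3; clear x01 E01 s0 y0 x0 xy f0 x1 ee h1 h2 h3 h4 h5 h6.
case: (odd j) w0 w1 w2 => /= w0 w1 w2; rewrite /in_cone w0 w1 w2 /det2 /=;
  move: stripX stripY (a ^+ (g - j.+2)) (a ^+ j) (C0 g) c => s e x y f d; clear;
  rewrite ?expr1 ?expr0 !exprS !expr0 => i1 i2 i3 j1 j2 j3; split; lra.
Qed.

Lemma star_cap i : (0 < i <= N.+1)%N ->
  triangle (P 0) (Q i) (P i) `<=` Pi /\ triangle (P 0) (P i) (Q i.-1) `<=` Pi.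
Proof.
move=> iN; have NM' := NM g3; have M0 := M_gt0 g3.
apply: (star_step).
- have [->|i1] := eqVneq i 1%N; first exact: (cone_cap1 g3 small).
  by apply: (cone_cap g3 small); lia.
- by apply: star_fan; lia.
- by move=> q tq; exists (Cap i) => //=; rewrite triangleC triangleCA triangleC in tq.
Qed.

Lemma star_new : triangle (P 0) (Q 1) (new_vertex g 1) `<=` Pi /\ triangle (P 0) (new_vertex g 1) (P 1) `<=` Pi.
Proof.
have N0 := N_gt0 g3; have M0 := M_gt0 g3.
apply: (star_step); first exact: (cone_new g3 small).
  by have [] := @star_cap 1 isT.
by move=> q tq; exists (Att 1).
Qed.

Lemma star_strip k : (0 < k <= M)%N -> triangle (P 0) (W k.-1) (W k) `<=` Pi /\
  ((1 < k)%N -> triangle (P 0) (W k.-2) (W k) `<=` Pi).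
Proof.
case: k => // k; elim: k => [_|k IH kM].
  by split => //=; rewrite triangleC; have [] := @star_cap 1 isT.
have [/= IH1 _] := IH ltac:(lia).
have tA : triangle (W k) (W k.+1) (W k.+2) `<=` Pi.
  by move=> q tq; exists (Att k.+2) => //=; rewrite triangleCA triangleC in tq.
have := @cone_strip k.+2 ltac:(lia); rewrite /=; case: ifP => _ ic.
  have [h1 h2] := star_step ic IH1 tA.
  by split => //; rewrite triangleC.
have [h1 h2] := star_step ic ltac:(by rewrite triangleC) ltac:(by rewrite triangleCA).
by split => // _; rewrite triangleC.
Qed.

End Strip.

(** * Matched vertices are close *)

Section Nearness.
Context {R : realType}.
Variable g : nat.
Hypothesis g3 : (3 <= g)%N.
Local Notation a := (alpha R g).
Local Notation P := (@P R g).
Local Notation Q := (@Q R g).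
Local Notation W := (@W R g).
Local Notation M := (M g).
Local Notation N := (N g).
Hypothesis small : a ^+ M <= 50^-1.
Implicit Types (p q A B C D O d e : R * R) (i j k n : nat) (b : bool) (t x y z : R).

Local Notation c := ((1 - a)^-1).
Local Notation th := (2 * a - 1).
Local Notation h n := (2 ^- n : R).

Definition near d e := enorm (d - e) <= 20 * a ^+ M.

Lemma nearP d e : `|d.1 - e.1| <= 10 * a ^+ M -> `|d.2 - e.2| <= 10 * a ^+ M -> near d e.
Proof. by move=> h1 h2; apply: le_trans (enorm_le12 _) _; rewrite /=; lra. Qed.

Lemma limits : [/\ 0 <= th <= a ^+ M, 0 <= c - 2 <= 21 / 10 * a ^+ M, 2 < c <= 21 / 10,
   a / (1 - a) = c - 1 & 2^-1 < a <= 51 / 100] /\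
   (forall n, 0 <= a ^+ n - h n <= 2 * a ^+ M /\ 0 <= h n <= 1).
Proof.
have t := th_le g3 small; have [[h1 h2 h3 h4 h5] h6] := real_consts g3 small.
have t0 : 0 <= th by case/andP: h1 => ? ?; lra.
have c2 : th * c = c - 2 by exact: thc.
have c0 : 0 <= c - 2 by case/andP: h2 => ? ?; lra.
split.
  split => //; apply/andP; split => //; rewrite -c2; case/andP: h2 => ? ?.
  by rewrite mulrC; apply: ler_pM => //; lra.
move=> n; split.
  apply/andP; split; first by rewrite subr_ge0 alpha_exp_half.
  have := alpha_exp_approx (R:=R) g3 n; rewrite alpha_eq//.
  by move=> /(le_trans (ler_norm _)) H; apply: le_trans H _; lra.
by rewrite (ltW (half_gt0 n)) -[leRHS](half0 (R:=R)) half_le.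
Qed.

Lemma near_center : near center (P 0).
Proof.
have [[/andP[t0 t1] /andP[c0 c1] _ _ /andP[a0 a1]] _] := limits.
have uM : 0 <= a ^+ g <= a ^+ M.
  by rewrite alpha_exp_ge0 //=; apply: alpha_exp_le => //; rewrite /Defs.M; lia.
apply: nearP; rewrite (cP0 g3 small) /center /= ler_norml; case/andP: uM => u0 u1.
  by apply/andP; split; lra.
by apply/andP; split; lra.
Qed.

Lemma near_right n : (n <= M)%N -> near (1, 1 - h n.+1) (Q (g - n)).
Proof.
move=> nM; have MM := M_le g3; have NM' := NM g3.
have [n1 n2 n3 n4] : [/\ 0 < g - n, M <= g - n, g - (g - n) + 2 = n.+2 & 0 <= n]%N by split; lia.
have aM := @alpha_exp_le R g g3 _ _ n2; have ag := alpha_exp_ge0 (R:=R) g3 (g - n).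
have [[/andP[t0 t1] /andP[c0 c1] /andP[c2 c3] ac /andP[a0 a1]] /(_ n.+2)[/andP[y0 y1] /andP[h0 h1]]] := limits.
rewrite Q_hyp// /Qa /Qb ac n3 invfM; rewrite (halfS n.+1) in h0 h1 y0 y1.
have qa : 0 <= a ^+ (g - n) * (1 + a) * (2^-1 * c) <= 2 * a ^+ M.
  have K0 : 0 <= (1 + a) * (2^-1 * c) by rewrite !mulr_ge0//; clear -a0 c2; lra.
  have K1 : (1 + a) * (2^-1 * c) <= 2 by rewrite mulrC; apply: (@le_trans _ _ ((105 / 100) * (151 / 100))); [by apply: ler_pM; clear -a0 a1 c2 c3; lra|lra].
  rewrite -mulrA; apply/andP; split; first exact: mulr_ge0.
  by rewrite [leRHS]mulrC; apply: ler_pM.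
apply: nearP; rewrite /= ler_norml; case/andP: qa => qa0 qa1.
  by clear -qa0 qa1 c0 c1; apply/andP; split; lra.
move: (a ^+ n.+2) (h n.+1) c (a ^+ M) h0 h1 y0 y1 c0 c1 c2 c3 => Y H C E h0 h1 y0 y1 c0 c1 c2 c3.
by clear -h0 h1 y0 y1 c0 c1 c2 c3; apply/andP; split; nra.
Qed.

Lemma near_top'' n : (0 < n <= N)%N -> near (1 - 3 * h n.+1, 1) (Q n).
Proof.
move=> nN; have MM := M_le g3; have NM' := NM g3.
have [n1 n2] : [/\ 0 < n & M <= g - n + 2]%N by split; lia.
have aM := @alpha_exp_le R g g3 _ _ n2; have ag := alpha_exp_ge0 (R:=R) g3 (g - n + 2).
have [[/andP[t0 t1] /andP[c0 c1] /andP[c2 c3] ac /andP[a0 a1]] /(_ n)[/andP[y0 y1] /andP[h0 h1]]] := limits.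
rewrite Q_hyp// /Qa /Qb ac (halfS n).
have -> : a ^+ n * (1 + a) / (2 * (1 - a)) = a ^+ n * (c - 2^-1).
  have -> : a ^+ n * (1 + a) / (2 * (1 - a)) = a ^+ n * ((c + a / (1 - a)) / 2) by field; rewrite alpha1_neq0.
  by rewrite ac; congr (_ * _); lra.
apply: nearP; rewrite /= ler_norml; last first.
  move: (a ^+ _) c (a ^+ M) aM ag c0 c1 c2 c3 => Y C E aM ag c0 c1 c2 c3.
  by clear -aM ag c0 c1 c2 c3; apply/andP; split; nra.
move: (a ^+ n) (h n) c (a ^+ M) h0 h1 y0 y1 c0 c1 c2 c3 => Y H C E h0 h1 y0 y1 c0 c1 c2 c3.
by clear -h0 h1 y0 y1 c0 c1 c2 c3; apply/andP; split; nra.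
Qed.

Lemma near_top' n : (1 < n <= N.+1)%N -> near (1 - 2 * h n, 1) (P n).
Proof.
move=> nN; have MM := M_le g3; have NM' := NM g3; have M0 := M_gt0 g3.
have PEn := @PE R g n ltac:(lia).
have [[/andP[t0 t1] /andP[c0 c1] /andP[c2 c3] ac /andP[a0 a1]] /(_ n)[/andP[y0 y1] /andP[h0 h1]]] := limits.
rewrite PEn ac mulrBl ac; apply: nearP; rewrite /= ler_norml; last first.
  by apply/andP; split; lra.
move: (a ^+ n) (h n) c (a ^+ M) h0 h1 y0 y1 c0 c1 c2 c3 => Y H C E h0 h1 y0 y1 c0 c1 c2 c3.
by clear -h0 h1 y0 y1 c0 c1 c2 c3; apply/andP; split; nra.
Qed.

Lemma near_new : near (0, 1) (new_vertex g 1).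
Proof.
have [[/andP[t0 t1] /andP[c0 c1] /andP[c2 c3] ac /andP[a0 a1]] _] := limits.
by rewrite new_vertex1// ac; apply: nearP; rewrite /= ?subrr ?normr0 ?ler_norml; [lra|apply/andP; split; lra].
Qed.

(** The height of the vertex of the square matched with W_k. The formula also covers k = 0, where it
    is 1/2 and the vertex is matched with Q_0. *)
Definition left_y k : R := if odd k then h k.+1 + s R k else 1 - h k.+1 - s R k.

Lemma left_yE k : left_y k = 2 / 3 + (-1) ^+ (~~ odd k) * (h k / 6).
Proof. by rewrite /left_y sE halfS; case: (odd k); rewrite /= ?expr0 ?expr1; lra. Qed.

Lemma near_left k : (k <= M)%N -> near (0, left_y k) (W k).
Proof.
move=> kM; have MM := M_le g3; have M0 := M_gt0 g3.
have [k1 k2 k3] : [/\ k < g, M <= g - k & g - k <= g.+1]%N by split; lia.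
have aM := @alpha_exp_le R g g3 _ _ k2; have ag := @alpha_exp_le R g g3 _ _ k3.
have ag0 := alpha_exp_ge0 (R:=R) g3 g.+1.
have [[/andP[t0 t1] /andP[c0 c1] /andP[c2 c3] ac /andP[a0 a1]] /(_ k)[/andP[y0 y1] /andP[h0 h1]]] := limits.
have C0E : C0 g * (1 + a) = c - 1 - a - a ^+ 2.
  have -> : c - 1 - a - a ^+ 2 = a * (a * (a * c)).
    by rewrite ac [a * (c - 1)]mulrBr ac !mulrBr ac !mulr1 expr2.
  have a2 := alphaD1_neq0 (R:=R) g3; have a1' := alpha1_neq0 (R:=R) g3.
  by rewrite /C0; field; rewrite a2 a1'.
(* 1/6 is the value of [C0] at alpha = 1/2, the amplitude appearing in [left_yE]. *)
have C01 : - (4 * a ^+ M) <= C0 g - 6^-1 <= 4 * a ^+ M.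
  have t2 : th <= 50^-1 by exact: le_trans t1 small.
  rewrite expr2 in C0E; clear small; move: (C0 g) (a) c (a ^+ M) C0E t0 t1 t2 a0 a1 c0 c1 => C x z E C0E t0 t1 t2 a0 a1 c0 c1.
  clear -C0E t0 t1 t2 a0 a1 c0 c1.
  by apply/andP; split; nra.
case/andP: C01 => C1 C2.
rewrite WE// left_yE -signE; apply: nearP; rewrite /= ler_norml.
  rewrite sub0r opprK invfM.
  move: (a ^+ (g - k)) (a ^+ g.+1) (a ^+ M) c aM ag ag0 c2 c3 => X Y E C aM ag ag0 c2 c3.
  by clear -aM ag ag0 c2 c3; apply/andP; split; nra.
case: (odd k) => /=; rewrite ?expr0 ?expr1.
  move: (a ^+ k) (h k) (a) (a ^+ M) (C0 g) (small) h0 h1 y0 y1 a0 a1 t0 t1 C1 C2 => Y H x E C sm h0 h1 y0 y1 a0 a1 t0 t1 C1 C2.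
  by clear -sm h0 h1 y0 y1 a0 a1 t0 t1 C1 C2; apply/andP; split; nra.
move: (a ^+ k) (h k) (a) (a ^+ M) (C0 g) (small) h0 h1 y0 y1 a0 a1 t0 t1 C1 C2 => Y H x E C sm h0 h1 y0 y1 a0 a1 t0 t1 C1 C2.
by clear -sm h0 h1 y0 y1 a0 a1 t0 t1 C1 C2; apply/andP; split; nra.
Qed.

End Nearness.

(** * The map iota_g *)

Section Boundary.
Context {R : realType}.
Implicit Types (p q A B C D O d e : R * R) (i j k n : nat) (b : bool) (t x y z : R).

(* The sides x = 1, y = 1, x = 0 of D^+, parametrized counterclockwise. *)
Definition boundary z : R * R := if z <= 0 then (1, 1 + z) else if z <= 1 then (1 - z, 1) else (0, 2 - z).

Definition param p : R := if p.1 == 1 then p.2 - 1 else if p.1 == 0 then 2 - p.2 else 1 - p.1.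

Lemma between x y z : x <= z <= y -> exists2 t, 0 <= t <= 1 & z = (1 - t) * x + t * y.
Proof.
move=> /andP[h1 h2]; have [e|e] := eqVneq x y; first by exists 0; rewrite ?lexx ?ler01//; lra.
have w : 0 < y - x by rewrite subr_gt0 lt_neqAle e (le_trans h1).
exists ((z - x) / (y - x)); last by field; rewrite gt_eqF.
apply/andP; split; first by rewrite divr_ge0 ?(ltW w) ?subr_ge0.
by rewrite ler_pdivrMr// mul1r lerD2r.
Qed.

Lemma segment_vertical x y1 y2 y : y1 <= y <= y2 -> segment (x, y1) (x, y2) (x, y).
Proof. by move=> /between[t t01 ->]; exists t => //; apply: pairP; rewrite !planeE /=; ring. Qed.

Lemma segment_horizontal y x1 x2 x : x1 <= x <= x2 -> segment (x1, y) (x2, y) (x, y).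
Proof. by move=> /between[t t01 ->]; exists t => //; apply: pairP; rewrite !planeE /=; ring. Qed.

(** Between two matched vertices the boundary of the square is the segment joining them, except at
    the cut corner AB, where it makes a detour through (1, 1). *)
Definition consecutive A B v w := forall z, param v <= z <= param w ->
  segment v w (boundary z) \/
  [/\ v = A, w = B & segment v (1, 1) (boundary z) \/ segment (1, 1) w (boundary z)].

Lemma consecutive_right A B y1 y2 : y1 <= y2 <= 1 -> consecutive A B (1, y1) (1, y2).
Proof.
move=> /andP[h1 h2] z; rewrite /param /= eqxx => /andP[z1 z2]; left.
rewrite /boundary ifT; last by lra.
by apply: segment_vertical; apply/andP; split; lra.
Qed.

Lemma consecutive_top A B x1 x2 : 0 <= x2 -> x2 <= x1 < 1 -> consecutive A B (x1, 1) (x2, 1).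
Proof.
move=> h0 /andP[h1 h2] z.
have P x : 0 <= x < 1 -> param (x, 1) = 1 - x.
  move=> /andP[x0 x1']; rewrite /param /= lt_eqF//; case: eqP => // ->; lra.
rewrite !P; [|lra|lra]; move=> /andP[z1 z2]; left.
rewrite /boundary ifF; last by apply/negbTE; rewrite -ltNge; lra.
rewrite ifT; last by lra.
by rewrite segmentC; apply: segment_horizontal; lra.
Qed.

Lemma consecutive_left A B y1 y2 : y2 <= y1 <= 1 -> consecutive A B (0, y1) (0, y2).
Proof.
move=> /andP[h1 h2] z; rewrite /param /= eqxx (@eq_sym _ 0 1) oner_eq0 => /andP[z1 z2]; left; rewrite segmentC.
have -> : boundary z = (0, 2 - z).
  rewrite /boundary ifF; last by apply/negbTE; rewrite -ltNge; lra.
  by case: leP => // z3; apply: pairP => /=; lra.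
by apply: segment_vertical; lra.
Qed.

Lemma consecutive_corner y x : 0 < x < 1 -> y < 1 -> consecutive (1, y) (x, 1) (1, y) (x, 1).
Proof.
move=> /andP[x0 x1] y1 z; rewrite /param /= eqxx lt_eqF// gt_eqF// => /andP[z1 z2]; right; split => //.
rewrite /boundary; case: leP => z0; [left|right].
  by apply: segment_vertical; lra.
rewrite ifT; last by lra.
by rewrite segmentC; apply: segment_horizontal; lra.
Qed.

(** Radial projection from the center onto the three sides other than the bottom: with (X, Y) the
    position relative to the center, the top is hit when |X| <= Y, and otherwise the side given by
    the sign of X. *)
Lemma boundary_ray p : Dplus p ->
  exists2 z, - 2^-1 <= z <= 3 / 2 & segment center (boundary z) p.
Proof.
case: p => px py; rewrite /Dplus /center /= => -[/andP[x0 x1] /andP[y0 y1]].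
pose X := px - 2^-1; pose Y := py - 2^-1.
have E l q : 0 <= l <= 1 -> px - 2^-1 = l * (q.1 - 2^-1) -> py - 2^-1 = l * (q.2 - 2^-1) ->
    segment (2^-1, 2^-1) q (px, py).
  by move=> l01 e1 e2; exists l => //; apply: pairP; rewrite !planeE /=; lra.
have xE : px = X + 2^-1 by rewrite /X; lra.
have yE : py = Y + 2^-1 by rewrite /Y; lra.
have [h|h] := leP `|X| Y.
  have [Y0|Y0] := eqVneq Y 0.
    have X0 : X = 0 by apply/eqP; rewrite -normr_le0 -Y0.
    exists 0; first by lra.
    by apply: (E 0); rewrite ?lexx ?ler01// mul0r; [rewrite -X0|rewrite -Y0].
  have Yp : 0 < Y by rewrite lt_neqAle eq_sym Y0 (le_trans _ h).
  have hX : - (1 / 2) <= X / (2 * Y) <= 1 / 2.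
    rewrite ler_pdivlMr ?ler_pdivrMr; [|lra|lra].
    by move: h; rewrite ler_norml => /andP[? ?]; lra.
  exists (1 / 2 - X / (2 * Y)); first by lra.
  have -> : boundary (1 / 2 - X / (2 * Y)) = (1 / 2 + X / (2 * Y), 1).
    rewrite /boundary; case: leP => z0; first by apply: pairP => /=; lra.
    by rewrite ifT; [apply: pairP => /=; lra|lra].
  apply: (E (2 * Y)); [by apply/andP; split; lra|rewrite /= -/X; field; by []|by rewrite /= -/Y; lra].
have XY : `|Y / (2 * X)| <= 1 / 2 /\ X != 0.
  have Y0 : 0 <= Y by lra.
  have X0 : 0 < `|X| by exact: le_lt_trans h.
  split; last by rewrite -normr_gt0.
  rewrite normrM normfV normrM (ger0_norm Y0) (ger0_norm (_ : 0 <= 2))// ler_pdivrMr; [lra|].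
  by rewrite mulr_gt0.
case: XY => XY Xn; have [X0|X0] := leP 0 X.
  have hY : 0 <= Y / (2 * X) by rewrite divr_ge0//; lra.
  rewrite ger0_norm// in XY.
  exists (- (1 / 2) + Y / (2 * X)); first by lra.
  have -> : boundary (- (1 / 2) + Y / (2 * X)) = (1, 1 / 2 + Y / (2 * X)).
    by rewrite /boundary ifT; [apply: pairP => /=; lra|lra].
  by apply: (E (2 * X)); [apply/andP; split; lra|rewrite /= -/X; lra|rewrite /= -/Y; field].
have hY : Y / (2 * X) <= 0.
  by rewrite -oppr_ge0 -mulrN -invrN divr_ge0//; lra.
rewrite ler0_norm// in XY.
exists (3 / 2 + Y / (2 * X)); first by lra.
have -> : boundary (3 / 2 + Y / (2 * X)) = (0, 1 / 2 - Y / (2 * X)).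
  rewrite /boundary ifF; last by apply/negbTE; rewrite -ltNge; lra.
  by case: leP => z0; apply: pairP => /=; lra.
by apply: (E (- (2 * X))); [apply/andP; split; lra|rewrite /= -/X; lra|rewrite /= -/Y; field].
Qed.

Lemma sequence_ivt (T : Type) (x0 : T) (f : T -> R) (x : T) (l : seq T) z : (0 < size l)%N ->
  f x <= z <= f (last x l) -> exists2 j, (j < size l)%N & f (nth x0 (x :: l) j) <= z <= f (nth x0 l j).
Proof.
elim: l x => // y l IH x _ /andP[h1 h2]; have [h|h] := leP z (f y).
  by exists 0%N => //=; rewrite h1.
case: l IH h2 => [|y' l] IH h2; first by rewrite /= in h2; lra.
have [j jl jz] := IH y isT ltac:(by rewrite (ltW h)).
by exists j.+1.
Qed.

End Boundary.

Section PathLemmas.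
Context {T : Type} (r : rel T) (f : nat -> T).

Lemma path_iota m k : (forall n, (m <= n < m + k)%N -> r (f n) (f n.+1)) ->
  path r (f m) [seq f n | n <- iota m.+1 k].
Proof.
elim: k m => // k IH m H; rewrite /= H ?IH//; first by move=> n h; apply: H; lia.
by lia.
Qed.

Lemma last_iota m k : last (f m) [seq f n | n <- iota m.+1 k] = f (m + k)%N.
Proof. by elim: k m => [|k IH] m; rewrite ?addn0//= IH addSnnS. Qed.

Lemma iotaSr m k : iota m k.+1 = iota m k ++ [:: (m + k)%N].
Proof. by rewrite -addn1 iotaD. Qed.

Lemma path_down (h : nat -> T) k : (forall n, (0 < n <= k)%N -> r (f n.+1) (h n) && r (h n) (f n)) ->
  path r (f k.+1) (flatten [seq [:: h n; f n] | n <- rev (iota 1 k)]).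
Proof.
elim: k => // k IH H; rewrite iotaSr rev_cat add1n /=.
have /andP[-> ->] := H k.+1 ltac:(lia).
by apply: IH => n hn; apply: H; lia.
Qed.

Lemma last_down (h : nat -> T) k :
  last (f k.+1) (flatten [seq [:: h n; f n] | n <- rev (iota 1 k)]) = f 1%N.
Proof. by elim: k => // k IH; rewrite iotaSr rev_cat add1n /=. Qed.

Lemma path_odd x k : r x (f 1%N) -> (forall n, odd n -> (n.+2 <= k)%N -> r (f n) (f n.+2)) ->
  path r x [seq f n | n <- iota 1 k & odd n] /\
  last x [seq f n | n <- iota 1 k & odd n] = if k == 0%N then x else f (if odd k then k else k.-1).
Proof.
move=> h1; elim: k => // k IH H; have [IH1 IH2] := IH (fun n o h => H n o (leqW h)).
rewrite iotaSr filter_cat map_cat cat_path last_cat add1n IH1 IH2 /=.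
have [ok|ok] := boolP (odd k); rewrite /=; first by split => //; case: (k) ok.
split => //; rewrite andbT; case: k ok H {IH IH1 IH2} => //= k; rewrite negbK => ok H.
exact: H.
Qed.

Lemma path_even x k : r x (f (if odd k then k.-1 else k)) ->
  (forall n, ~~ odd n -> (n.+2 <= k)%N -> r (f n.+2) (f n)) ->
  path r x ([seq f n | n <- rev (iota 1 k) & ~~ odd n] ++ [:: f 0%N]) .
Proof.
elim: k x => [|k IH] x h H; first by rewrite /= h.
rewrite iotaSr rev_cat add1n /= in h *.
have [ok|ok] := boolP (odd k); rewrite ?ok ?(negbTE ok) /= in h *.
  rewrite h; apply: IH; last by move=> n o l; apply: H => //; lia.
  by rewrite ok; case: k ok H {h} => //= k ok H; apply: H.
by apply: IH; rewrite ?(negbTE ok) // => n o l; apply: H => //; lia.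
Qed.

End PathLemmas.

(** * The matching of vertices *)

Section Iota.
Context {R : realType}.
Variable g : nat.
Hypothesis g3 : (3 <= g)%N.
Local Notation a := (alpha R g).
Local Notation P := (@P R g).
Local Notation Q := (@Q R g).
Local Notation W := (@W R g).
Local Notation M := (M g).
Local Notation N := (N g).
Local Notation tri := (@tri R g).
Local Notation Pi := (@Pi R g).
Local Notation near := (@near R g).
Local Notation clp := (@clp R g g3).
Hypothesis small : a ^+ M <= 50^-1.
Implicit Types (p q A B C D O d e : R * R) (i j k n : nat) (b : bool) (t x y z lam : R).
Local Notation h n := (2 ^- n : R).
Local Notation cutv := ((1, 1 - h M.+1) : R * R).
Local Notation cutw := ((1 - h N, 1) : R * R).

Definition fan_step (v w : (R * R) * (R * R)) : Prop :=
  [/\ triangle (P 0) v.2 w.2 `<=` Pi, near v.1 v.2, near w.1 w.2 & consecutive cutv cutw v.1 w.1].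

Let r v w := `[< fan_step v w >].
Let fR n : (R * R) * (R * R) := ((1, 1 - h n.+1), Q (g - n)).
Let fP n : (R * R) * (R * R) := ((1 - 2 * h n, 1), if n == 1%N then new_vertex g 1 else P n).
Let fQ n : (R * R) * (R * R) := ((1 - 3 * h n.+1, 1), Q n).
Let fW k : (R * R) * (R * R) := ((0, left_y k), W k).

Lemma matchingE : matching g = fR 0%N :: [seq fR n | n <- iota 1 M] ++ fP N.+1 ::
  flatten [seq [:: fQ n; fP n] | n <- rev (iota 1 N)] ++ [seq fW k | k <- iota 1 M & odd k] ++
  ([seq fW k | k <- rev (iota 1 M) & ~~ odd k] ++ [:: fW 0%N]).
Proof.
have N0 := N_gt0 g3.
rewrite /matching /=; congr (_ :: _ ++ _ :: _ ++ _).
  rewrite /fP eqSS (negbTE (lt0n_neq0 N0)); congr ((_, _), _).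
  by rewrite halfS; lra.
congr (_ ++ _).
  apply/eq_in_map => k; rewrite mem_filter /fW /left_y /W => /andP[ok]; rewrite mem_iota => /andP[k0 _].
  by rewrite ok (negbTE (lt0n_neq0 k0)).
congr (_ ++ _).
  apply/eq_in_map => k; rewrite mem_filter /fW /left_y /W => /andP[ok]; rewrite mem_rev mem_iota => /andP[k0 _].
  rewrite (negbTE ok) (negbTE (lt0n_neq0 k0)).
  by case: eqP ok => // ->.
by rewrite /fW /left_y /= /s big_geq// half1; congr [:: ((_, _), _)]; lra.
Qed.

Lemma near_fR n : (n <= M)%N -> near (fR n).1 (fR n).2.
Proof. exact: near_right. Qed.
Lemma near_fQ n : (0 < n <= N)%N -> near (fQ n).1 (fQ n).2.
Proof. exact: near_top''. Qed.
Lemma near_fW k : (k <= M)%N -> near (fW k).1 (fW k).2.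
Proof. exact: near_left. Qed.
Lemma near_fP n : (0 < n <= N.+1)%N -> near (fP n).1 (fP n).2.
Proof.
move=> nN; rewrite /fP; have [->|n1] := eqVneq n 1%N.
  by have := near_new g3 small; rewrite /= half1; congr near; congr (_, _); lra.
by apply: (near_top' g3 small); lia.
Qed.

Lemma left_y_le k : left_y k <= 1 :> R.
Proof.
have := half_le (R:=R) (leq0n k); have := half_gt0 (R:=R) k; rewrite half0 left_yE.
by case: (odd k); rewrite /= ?expr0 ?expr1; lra.
Qed.

(** The blocks of the list are handled separately and then joined. Two of the seams are the free
    edges: from the right side to the top at the cut corner, and from the odd to the even vertices
    on the left, where W_(M-1) meets W_M. *)
Lemma matching_path : path r (fR 0%N) (behead (matching g)).
Proof.
have M0 := M_gt0 g3; have N0 := N_gt0 g3; have NM' := NM g3; have MM := M_le g3.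
have hp n := half_gt0 (R:=R) n; have h1 n := half_le (R:=R) (leq0n n).
have S k := @star_strip R g g3 small k.
rewrite matchingE /= cat_path last_iota add0n /= cat_path last_down cat_path.
have PR : path r (fR 0%N) [seq fR n | n <- iota 1 M].
  apply: path_iota => n nM; apply/asboolP; split.
  - rewrite /fR /=; have -> : (g - n.+1 = (g - n).-1)%N by lia.
    by apply: star_fan; lia.
  - by apply: near_fR; lia.
  - by apply: near_fR; lia.
  - by apply: consecutive_right; rewrite /= (halfS n.+1); have := hp n.+1; lra.
have CL k k' : left_y k' <= left_y k :> R -> consecutive cutv cutw (0, left_y k) (0, left_y k').
  by move=> l; apply: consecutive_left; rewrite l left_y_le.
have [p1 p2] : path r (fP 1) [seq fW n | n <- iota 1 M & odd n] /\
    last (fP 1) [seq fW n | n <- iota 1 M & odd n] = if M == 0%N then fP 1 else fW (if odd M then M else M.-1).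
  apply: path_odd.
    apply/asboolP; split.
    - by have [] := star_new g3 small.
    - by apply: near_fP; lia.
    - by apply: near_fW; lia.
    - rewrite /= half1; have -> : 1 - 2 * 2^-1 = 0 :> R by lra.
      by apply: consecutive_left; rewrite left_y_le lexx.
  move=> n on nM; apply/asboolP; split.
  - have [_] := S n.+2 ltac:(lia); exact.
  - by apply: near_fW; lia.
  - by apply: near_fW; lia.
  - by apply: CL; rewrite !left_yE /= on /= !halfS; have := hp n; lra.
rewrite PR p1 p2 (negbTE (lt0n_neq0 M0)) andTb; apply/and3P; split; last (apply/andP; split => //).
- have NE : N.+1 = (g - M)%N by lia.
  apply/asboolP; split.
  + rewrite /fR /fP /= eqSS (negbTE (lt0n_neq0 N0)) NE.
    by have [] := @star_cap R g g3 small (g - M)%N ltac:(lia).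
  + by apply: near_fR.
  + by apply: near_fP; lia.
  + have -> : (fP N.+1).1 = cutw by rewrite /fP /= (halfS N); congr (_, _); lra.
    have [k Nk] : exists k, N = k.+1 by exists N.-1; lia.
    have := hp N; have := hp M.+1; have := h1 k; rewrite half0 Nk (halfS k) => *.
    by apply: consecutive_corner; lra.
- apply: path_down => n nN; have hn := hp n; have h1n := h1 n; rewrite half0 in h1n.
  have [k nk] : exists k, n = k.+1 by exists n.-1; lia.
  have h1k := h1 k; rewrite half0 in h1k.
  apply/andP; split; apply/asboolP; split.
  + rewrite /fP /fQ /= eqSS (negbTE (lt0n_neq0 _)); last by lia.
    by have [] := @star_cap R g g3 small n.+1 ltac:(lia).
  + by apply: near_fP; lia.
  + by apply: near_fQ; lia.
  + by rewrite /fP /fQ /= (halfS n) nk (halfS k); rewrite nk (halfS k) in hn; apply: consecutive_top; lra.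
  + rewrite /fP /fQ /=; case: eqP => [->|_].
      by have [] := star_new g3 small.
    by have [] := @star_cap R g g3 small n ltac:(lia).
  + by apply: near_fQ; lia.
  + by apply: near_fP; lia.
  + by rewrite /fP /fQ /= (halfS n) nk (halfS k); rewrite nk (halfS k) in hn; apply: consecutive_top; lra.
- apply: path_even.
  apply/asboolP; split.
  - have [St _] := S M ltac:(lia); case: (odd M) => //; by rewrite triangleC.
  - by apply: near_fW; case: odd; lia.
  - by apply: near_fW; case: odd; lia.
  - apply: CL; have [k Mk] : exists k, M = k.+1 by exists M.-1; lia.
    rewrite Mk /= !left_yE; case: (boolP (odd k)) => ok /=; rewrite ?ok ?(negbTE ok) /= halfS; have := hp k; lra.
move=> n on nM; apply/asboolP; split.
- by rewrite triangleC; have [_] := S n.+2 ltac:(lia); exact.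
- by apply: near_fW; lia.
- by apply: near_fW; lia.
- by apply: CL; rewrite !left_yE /= (negbTE on) /= !halfS; have := hp n; lra.
Qed.

Local Notation mm := (@matching R g).
Local Notation mnth j := (nth (0, 0) mm j).

Lemma matching_cons : mm = fR 0%N :: behead mm.
Proof. by rewrite matchingE. Qed.

Lemma matching_step j : (j.+1 < size mm)%N -> fan_step (mnth j) (mnth j.+1).
Proof.
have /(pathP (0, 0)) H := matching_path; rewrite matching_cons /= ltnS => js.
exact: (asboolW (H j js)).
Qed.

(** A discrete intermediate value argument: the parameter runs from -1/2 at (1, 1/2) to 3/2 at (0,
    1/2) along the list. *)
Lemma matching_cover z : - 2^-1 <= z <= 3 / 2 -> exists2 j, (j.+1 < size mm)%N &
  param (mnth j).1 <= z <= param (mnth j.+1).1.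
Proof.
move=> /andP[z1 z2].
have l0 : last (fR 0%N) (behead mm) = fW 0%N.
  by rewrite matchingE /= !(last_cat, last_cons).
have [||j js jz] := @sequence_ivt R _ (0, 0) (fun v => param v.1) (fR 0%N) (behead mm) z.
- rewrite lt0n size_eq0; apply/eqP => e; move: l0; rewrite e /= /fR /fW => /(congr1 (fun v => v.1.1)) /=.
  by move/eqP; rewrite oner_eq0.
- rewrite l0 /param /= eqxx eq_sym oner_eq0 eqxx left_yE /= half1 half0 expr1.
  by apply/andP; split; lra.
by exists j; rewrite matching_cons /= ?ltnS.
Qed.

Lemma matching_corner : [/\ (M.+1 < size mm)%N, (mnth M).1 = cutv & (mnth M.+1).1 = cutw].
Proof.
have E : mm = [seq fR n | n <- iota 0 M.+1] ++ fP N.+1 :: drop M.+2 mm.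
  rewrite matchingE -cat_cons -[X in X ++ _]/([seq fR n | n <- iota 0 M.+1]).
  congr (_ ++ _ :: _); rewrite -[M.+2]/((M.+1).+1) drop_cat size_map size_iota ifF ?subSnn /= ?drop0//.
  by apply/negbTE; rewrite -leqNgt.
have E1 : size [seq fR n | n <- iota 0 M.+1] = M.+1 by rewrite size_map size_iota.
split.
- by rewrite E size_cat E1 /= addnS ltnS leq_addr.
- by rewrite E nth_cat E1 ltnSn (nth_map 0%N) ?size_iota// nth_iota.
- rewrite E nth_cat E1 ltnn subnn /= /fP /= (halfS N); congr (_, _); lra.
Qed.

End Iota.

(** * Displacement of points by the maps composing iota_g *)

Section IotaPoint.
Context {R : realType}.
Variable g : nat.
Hypothesis g3 : (3 <= g)%N.
Local Notation a := (alpha R g).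
Local Notation P := (@P R g).
Local Notation Q := (@Q R g).
Local Notation W := (@W R g).
Local Notation M := (M g).
Local Notation N := (N g).
Local Notation tri := (@tri R g).
Local Notation Pi := (@Pi R g).
Local Notation near := (@near R g).
Local Notation clp := (@clp R g g3).
Local Notation mm := (@matching R g).
Local Notation mnth j := (nth (0, 0) mm j).
Local Notation Esq := (@Dplus R).
Hypothesis small : a ^+ M <= 50^-1.
Implicit Types (p q A B C D O d e : R * R) (i j k n : nat) (b : bool) (t x y z : R).
Local Notation h n := (2 ^- n : R).
Local Notation cutv := ((1, 1 - h M.+1) : R * R).
Local Notation cutw := ((1 - h N, 1) : R * R).
Variable lam : R.
Hypothesis lam01 : 0 < lam < 1.
Local Notation cut := ((1 - lam) *: cutv + lam *: cutw).

Lemma cut_close : enorm ((1, 1) - cut) <= 5 * a ^+ M.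
Proof.
apply: le_trans (enorm_le12 _) _; rewrite !planeE /=; case/andP: lam01 => l0 l1.
have hN : h N <= 2 * a ^+ M.
  have -> : h N = 2 * h N.+1 by rewrite halfS; lra.
  rewrite ler_pM2l//; apply: le_trans (half_le (M_le_N g3)) _.
  exact: alpha_exp_half.
have hM : h M.+1 <= a ^+ M by apply: le_trans (half_le (leqnSn M)) _; exact: alpha_exp_half.
have hN0 := half_gt0 (R:=R) N; have hM0 := half_gt0 (R:=R) M.+1.
rewrite !ger0_norm.
- by move: (h N) (h M.+1) (a ^+ M) hN hM hN0 hM0 => x y z *; nra.
- by move: (h M.+1) hM0 => y *; nra.
- by move: (h N) hN0 => y *; nra.
Qed.

(** Only (1, 1) is displaced among the vertices of the two cut triangles, and by at most 5 alpha^M;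
    the image lies over the cut edge, which joins two consecutive matched vertices. *)
Lemma retractionP p : Esq p -> enorm (retraction g lam p - p) <= 5 * a ^+ M /\
  exists2 j, (j.+1 < size mm)%N & triangle center (mnth j).1 (mnth j.+1).1 (retraction g lam p).
Proof.
move=> Ep; have aM := alpha_exp_ge0 (R:=R) g3 M; have [c1 c2 c3] := matching_corner (R:=R) g3.
case/andP: lam01 => l0 l1.
have corner q : triangle center cutv cutw q ->
    exists2 j, (j.+1 < size mm)%N & triangle center (mnth j).1 (mnth j.+1).1 q.
  by move=> tq; exists M => //; rewrite c2 c3.
have z0 q : enorm (q - q) <= 5 * a ^+ M by rewrite subrr enorm0 mulr_ge0.
rewrite /retraction /fan_map; case: xgetP => [q _ /= [j [x [y [z]]]]|none].
  case: j => [|[|j]] /=; last by case.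
    move=> [_ [x0 y0 zz0] s -> ->]; split.
      by apply: triangle_dist => //; rewrite enormC; exact: cut_close.
    apply: corner; exists x, (y + z * (1 - lam)), (z * lam); split.
    - by [].
    - by rewrite addr_ge0// mulr_ge0//; lra.
    - by rewrite mulr_ge0//; lra.
    - by rewrite -[RHS]s; ring.
    - by apply: pairP; rewrite !planeE /=; ring.
  move=> [_ [x0 y0 zz0] s -> ->]; split.
    by apply: triangle_dist => //; rewrite enormC; exact: cut_close.
  apply: corner; exists x, (y * (1 - lam)), (y * lam + z); split.
  - by [].
  - by rewrite mulr_ge0//; lra.
  - by rewrite addr_ge0// mulr_ge0//; lra.
  - by rewrite -[RHS]s; ring.
  - by apply: pairP; rewrite !planeE /=; ring.
(* Outside the two cut triangles [fan_map] returns its default, the point itself. It then lies over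
   an ordinary boundary edge, since lying over the cut corner would contradict the choice of the
   default. *)
split => //.
have [z zr sz] := boundary_ray Ep.
have [j js jz] := matching_cover g3 zr.
have [_ _ _ /(_ _ jz)] := matching_step g3 small js.
have T u v s : segment u v s -> segment center s p -> triangle center u v p.
  move=> h1; apply: triangle_convex; first exact: triangle_v1.
  exact: triangle_seg.
case=> [h1|[e1 e2 []h1]].
- by exists j => //; exact: T h1 sz.
- have [x [y [w [x0 y0 w0 s pE]]]] := T _ _ _ h1 sz; exfalso; rewrite e1 in pE.
  by apply: (none (x *: center + y *: cutv + w *: cut)); exists 0%N, x, y, w.
- have [x [y [w [x0 y0 w0 s pE]]]] := T _ _ _ h1 sz; exfalso; rewrite e2 in pE.
  by apply: (none (x *: center + y *: cut + w *: cutw)); exists 1%N, x, y, w.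
Qed.

(** 25 = 5 + 20: the retraction, then the displacement of matched vertices. *)
Lemma Dplus_to_PiP p : Esq p -> Pi (Dplus_to_Pi g lam p) /\ enorm (Dplus_to_Pi g lam p - p) <= 25 * a ^+ M.
Proof.
move=> Ep; have [h1 [j js [x [y [z [x0 y0 z0 s pE]]]]]] := retractionP Ep.
rewrite /Dplus_to_Pi; move: (retraction g lam p) pE h1 => p' pE h1.
rewrite /fan_map; case: xgetP => [q _ /= [i [x' [y' [z' [il [x1 y1 z1] s1 p'E qE]]]]]|none]; last first.
  by exfalso; apply: (none (x *: P 0 + y *: (mnth j).2 + z *: (mnth j.+1).2)); exists j, x, y, z.
have [i1 i2 i3 _] := matching_step g3 small il; split.
  by apply: i1; exists x', y', z'.
have : enorm (q - p') <= 20 * a ^+ M.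
  by rewrite qE p'E; apply: triangle_dist => //; rewrite enormC//; exact: near_center.
by have := enorm_tri p' q p; lra.
Qed.

(** Whichever triangle [xget] selects is a legitimate place; which one does not matter, as
    [clp_almost_isometric] compares points of arbitrary places. *)
Lemma Pi_to_XP q : Pi q -> exists2 pl, vplace g pl /\ tri pl q & Pi_to_X g3 q = clp false pl q.
Proof.
move=> [pl vp tq]; rewrite /Pi_to_X; case: xgetP => [y _ /= [c [t [pc' Tc ->]]]|none]; last first.
  exfalso; apply: (none (clp false pl q)); exists (pc g pl), (sh g pl); split.
  - by apply/(placedP g3); exists pl.
  - exact/(triE g3).
  - by rewrite clpE addbF; case: (pc g pl).
move: Tc; have /(placedP g3)[pl' vp' [-> ->]] := pc' => Tc.
exists pl'; first by split => //; apply/(triE g3).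
by rewrite clpE addbF; case: (pc g pl').
Qed.

End IotaPoint.

(** * The map iota_g on each copy of the square *)

Section Display.
Context {R : realType}.
Variable g : nat.
Hypothesis g3 : (3 <= g)%N.
Local Notation a := (alpha R g).
Local Notation M := (M g).
Local Notation N := (N g).
Local Notation tri := (@tri R g).
Local Notation near := (@near R g).
Local Notation clp := (@clp R g g3).
Local Notation X := (@X R g g3).
Local Notation Esq := (@Dplus R).
Hypothesis small : a ^+ M <= 50^-1.
Implicit Types (p q : R * R) (e : bedge) (b : bool) (t x y z : R).
Local Notation h n := (2 ^- n : R).

Lemma gA_close e : gvalid g e -> near (eA e) (gA g e).
Proof.
have M0 := M_gt0 g3; have N0 := N_gt0 g3; have NM' := NM g3; have MM := M_le g3.
case: e => [[]|n|n|n|n] /=; rewrite /eA /onside /=.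
- by move=> _; exact: near_center.
- by move=> _; have := near_left g3 small (leq0n M); rewrite left_yE /= half0 expr1; congr near; congr (_, _); lra.
- move=> nN; case: eqP => [->|n1].
    by have := near_new g3 small; rewrite half1; congr near; congr (_, _); lra.
  by apply: (near_top' g3 small); lia.
- by move=> nN; exact: near_top''.
- move=> nM; have := @near_right R g g3 small n.-1 ltac:(lia).
  by have -> : n.-1.+1 = n by lia.
- move=> nM; case: eqP => [->|n1].
    by have := near_new g3 small; rewrite /= sE /= half1; congr near; congr (_, _); lra.
  have := @near_left R g g3 small n.-2 ltac:(lia).
  have [k ->] : exists k, n = k.+2 by exists n.-2; lia.
  rewrite left_yE /= negbK sE !halfS /=; congr near; congr (_, _).
  by case: (odd k); rewrite /= ?expr0 ?expr1; lra.
Qed.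

Lemma gB_close e : gvalid g e -> near (eB e) (gB g e).
Proof.
have M0 := M_gt0 g3; have N0 := N_gt0 g3; have NM' := NM g3; have MM := M_le g3.
case: e => [[]|n|n|n|n] /=; rewrite /eB /onside /=.
- move=> _; have := @near_right R g g3 small 0 isT; rewrite subn0 half1.
  by congr near; congr (_, _); lra.
- by move=> _; exact: near_center.
- by move=> nN; exact: near_top''.
- move=> nN; have := @near_top' R g g3 small n.+1 ltac:(lia).
  by rewrite halfS; congr near; congr (_, _); lra.
- by move=> nM; apply: (near_right g3 small); lia.
- move=> nM; have := @near_left R g g3 small n ltac:(lia).
  rewrite left_yE sE halfS; congr near; congr (_, _).
  by case: (odd n); rewrite /= ?expr0 ?expr1; lra.
Qed.

Lemma conv_close p q p' q' t d : 0 <= t <= 1 -> enorm (p - p') <= d -> enorm (q - q') <= d ->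
  enorm ((1 - t) *: p + t *: q - ((1 - t) *: p' + t *: q')) <= d.
Proof.
move=> /andP[t0 t1] h1 h2.
have -> : (1 - t) *: p + t *: q - ((1 - t) *: p' + t *: q') = (1 - t) *: (p - p') + t *: (q - q').
  by apply: pairP; rewrite !planeE /=; ring.
apply: le_trans (enormD _ _) _; rewrite !enormZ !ger0_norm//; last by lra.
have := ler_wpM2l t0 h2; have := ler_wpM2l (_ : 0 <= 1 - t) h1; rewrite subr_ge0 => /(_ t1).
by lra.
Qed.

Lemma gpt_close e t : gvalid g e -> 0 <= t <= 1 -> near (ept e t) (gpt g e t).
Proof. by move=> ve t01; apply: conv_close => //; [exact: gA_close|exact: gB_close]. Qed.

Variable lam : R.
Hypothesis lam01 : 0 < lam < 1.

(** What iota_g prescribes at the point [p] of the copy [b], freed from the choice of a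
    representative in D that enters [iota_g]. *)
Definition display b p : X :=
  if b then rho (Pi_to_X g3 (Dplus_to_Pi g lam p)) else Pi_to_X g3 (Dplus_to_Pi g lam p).

Lemma displayP b p : Esq p -> exists pl q,
  [/\ vplace g pl, tri pl q, enorm (q - p) <= 25 * a ^+ M & display b p = clp b pl q].
Proof.
move=> Ep; have [h1 h2] := Dplus_to_PiP g3 small lam01 Ep.
have [pl [vp tq] E] := Pi_to_XP g3 h1; exists pl, (Dplus_to_Pi g lam p); split => //.
by rewrite /display E; case: b => //; rewrite (rho_clp g3).
Qed.

(** 181 = 156 + 25, from [clp_almost_isometric] and the displacement of the point; one more
    displacement gives 206 in the next lemma. *)
Lemma display_clp b p pl q : Esq p -> vplace g pl -> tri pl q ->
  flat_dist (display b p) (clp b pl q) <= enorm (p - q) + 181 * a ^+ M.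
Proof.
move=> Ep vp tq; have [pl' [q' [vp' tq' hq ->]]] := displayP b Ep.
have := clp_almost_isometric g3 small b vp' vp tq' tq; have := enorm_tri p q' q.
by move: (enorm _) (enorm _) (enorm _) hq => *; lra.
Qed.

Lemma display_dist b p q : Esq p -> Esq q ->
  flat_dist (display b p) (display b q) <= enorm (p - q) + 206 * a ^+ M.
Proof.
move=> Ep Eq; have [pl [r [vp tr hr ->]]] := displayP b Eq.
have := display_clp b Ep vp tr; have := enorm_tri q p r; rewrite (enormC q r).
by move: (enorm _) (enorm _) (enorm _) hr => *; lra.
Qed.

(** Both displays are compared with the same point of the glued edge in X_g, at a cost of 20 + 181
    on each side. *)
Lemma display_glue b e t : gvalid g e -> 0 <= t <= 1 ->
  flat_dist (display b (ept e t)) (display (b (+) flips e) (ept (partner e) t)) <= 402 * a ^+ M.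
Proof.
move=> ve t01; have ve' : gvalid g (partner e) by rewrite gvalid_partner.
have E1 : Esq (ept e t) by apply: ept_Esq => //; exact: gvalid_valid ve.
have E2 : Esq (ept (partner e) t) by apply: ept_Esq => //; exact: gvalid_valid ve'.
have h1 := display_clp b E1 (vplace_home g3 ve) (tri_gpt g3 ve t01).
have h2 := display_clp (b (+) flips e) E2 (vplace_home g3 ve') (tri_gpt g3 ve' t01).
have n1 := gpt_close ve t01; have n2 := gpt_close ve' t01.
rewrite (crossing g3)// in h1; rewrite flat_distC in h2; rewrite /near in n1 n2.
apply: le_trans (flat_dist_tri (@X_connected R g g3) (clp (b (+) flips e) (home g (partner e)) (gpt g (partner e) t)) _ _) _.
by lra.
Qed.

Lemma chart_inj b : injective (@chart R b).
Proof.
by case: b => // p q [h1 h2]; apply: pairP; [move: h1|move: h2] => /=; lra.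
Qed.

(** A point of D with two descriptions lies on the middle segment, which is treated as the gluing of
    the two bottom edges. *)
Lemma display_chart b p b' p' : Esq p -> Esq p' -> chart b p = chart b' p' ->
  flat_dist (display b p) (display b' p') <= 402 * a ^+ M.
Proof.
have a0 : 0 <= 402 * a ^+ M by rewrite mulr_ge0 ?ler0n ?alpha_exp_ge0.
wlog bb : b p b' p' / b = false.
  move=> H Ep Ep' E; case: b E => E; last exact: (H false).
  case: b' E => E; last by rewrite flat_distC; apply: H.
  have <- := chart_inj E; exact: le_trans (flat_dist_xx _) a0.
subst b; case: b' => /= Ep Ep' E; last first.
  by rewrite -E; exact: le_trans (flat_dist_xx _) a0.
have [/andP[x0 x1] /andP[y0 y1]] := Ep; have [/andP[x0' x1'] /andP[y0' y1']] := Ep'.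
have e1 := congr1 fst E; have e2 := congr1 snd E; rewrite /= in e1 e2.
have pE : p = ept (Bot false) (2 * p.1).
  by rewrite eptE /onside /=; apply: pairP => /=; lra.
have pE' : p' = ept (Bot true) (2 * p.1).
  by rewrite eptE /onside /=; apply: pairP => /=; lra.
by rewrite pE pE'; apply: (@display_glue false (Bot false)) => //; apply/andP; split; lra.
Qed.

Lemma iota_display (x : Xoo R) b p : val (projT2 (repr x)) = chart b p -> Esq p ->
  flat_dist (iota_g g3 lam x) (display b p) <= 402 * a ^+ M.
Proof.
move=> E Ep; rewrite /iota_g.
case: (repr x) E => -[] [r hr] /= E; have Dr : Doo r by have := hr; rewrite inE.
have [Er|Er] := boolP (r \in @Dplus R).
  have Er' : Esq r by move: Er; rewrite inE.
  exact: (@display_chart false r b p Er' Ep E).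
have [Er' rE] : Esq (tau_inv r) /\ chart true (tau_inv r) = r.
  have [[] [e [Ee pE]]] := D_chart (Doo_D Dr); last by exfalso; move/negP: Er; apply; rewrite inE pE.
  have -> : tau_inv r = e by rewrite pE; apply: pairP; rewrite /tau_inv /=; lra.
  by rewrite pE.
have E' : chart true (tau_inv r) = chart b p by rewrite rE.
exact: (@display_chart true (tau_inv r) b p Er' Ep E').
Qed.

End Display.

(** * Upper bound *)

Section Upper.
Context {R : realType}.
Implicit Types (p q : R * R) (e : bedge) (b : bool) (t l d : R) (n : nat).
Local Notation Esq := (@Dplus R).
Local Notation cl p := (@to_surface R (oo_patchwork R) tt p).
Local Notation eps g := (alpha R g ^+ M g).

Definition family := forall g (g3 : (3 <= g)%N), R -> @X R g g3.

(** The constants [c] and [G] may depend on the two families but not on g or the parameter of the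
    retraction. Such bounds add up along finite chains, which is all that a broken path requires. *)
Definition far (A B : family) l := exists c G, forall g (g3 : (3 <= g)%N) (lam : R),
  0 < lam < 1 -> (G <= g)%N -> eps g <= 50^-1 ->
  flat_dist (A g g3 lam) (B g g3 lam) <= l + c * eps g.

Definition displays b p : family := fun g g3 lam => @display R g g3 lam b p.
Definition iotas (x : Xoo R) : family := fun g g3 lam => @iota_g R g g3 lam x.

Lemma far_tri A B D l l' : far A B l -> far B D l' -> far A D (l + l').
Proof.
move=> [c [G H]] [c' [G' H']]; exists (c + c'), (maxn G G') => g g3 lam lam01.
rewrite geq_max => /andP[h h'] sm.
apply: le_trans (flat_dist_tri (@X_connected R g g3) (B g g3 lam) _ _) _.
by have := H g g3 lam lam01 h sm; have := H' g g3 lam lam01 h' sm; lra.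
Qed.

Lemma far_sym A B l : far A B l -> far B A l.
Proof. by move=> [c [G H]]; exists c, G => *; rewrite flat_distC; exact: H. Qed.

Lemma far_refl A : far A A 0.
Proof. by exists 0, 0%N => *; rewrite mul0r addr0; exact: flat_dist_xx. Qed.

Lemma far_display b p q : Esq p -> Esq q -> far (displays b p) (displays b q) (enorm (p - q)).
Proof. by move=> Ep Eq; exists 206, 0%N => g g3 lam l01 _ sm; exact: display_dist. Qed.

Lemma far_chart b p b' p' : Esq p -> Esq p' -> chart b p = chart b' p' ->
  far (displays b p) (displays b' p') 0.
Proof.
move=> Ep Ep' E; exists 402, 0%N => g g3 lam l01 _ sm; rewrite add0r; exact: display_chart.
Qed.

Lemma far_glue b e t : valid e -> 0 <= t <= 1 ->
  far (displays b (ept e t)) (displays (b (+) flips e) (ept (partner e) t)) 0.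
Proof.
move=> ve t01.
have [G HG] : exists G, forall g, (3 <= g)%N -> (G <= g)%N -> gvalid g e.
  case: e ve => [h|n|n|n|n] /= n0; first by exists 0%N.
  - by exists n.*2.+1 => g g3 gn; rewrite n0 /= /N; lia.
  - by exists n.*2.+1 => g g3 gn; rewrite n0 /= /N; lia.
  - by exists n.*2.+1 => g g3 gn; rewrite n0 /= /M; lia.
  - by exists n.*2.+1 => g g3 gn; rewrite n0 /= /M; lia.
exists 402, G => g g3 lam l01 gG sm; rewrite add0r; apply: display_glue => //.
exact: HG.
Qed.

Lemma far_iota x b p : val (projT2 (repr (x : Xoo R))) = chart b p -> Esq p ->
  far (iotas x) (displays b p) 0.
Proof.
move=> E Ep; exists 402, 0%N => g g3 lam l01 _ sm; rewrite add0r; exact: iota_display.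
Qed.

Lemma far_identified (z w : points (oo_patchwork R)) : clos_refl_sym_trans _ (@glue_step R _) z w ->
  forall b p b' p', Esq p -> Esq p' -> val (projT2 z) = chart b p -> val (projT2 w) = chart b' p' ->
  far (displays b p) (displays b' p') 0.
Proof.
elim=> {z w} [z w h|z|z w _ IH|z w v _ IH1 _ IH2] b p b' p' Ep Ep' E E'.
- case: z w h E E' => [[] [r hr]] [[] [r' hr']] [e [ee /= es rE]] /= E E'.
  have [t ti pE] := edge_sourceP ee es; have ve := valid_bedge_of ee; have t01 := inner_le ti.
  have h := far_glue (bedge_of e).1 ve t01.
  have E1 : Esq (ept (bedge_of e).2 t) by exact: ept_Esq.
  have E2 : Esq (ept (partner (bedge_of e).2) t) by apply: ept_Esq; rewrite ?valid_partner.
  have h1 := far_chart Ep E1 (etrans (esym E) pE).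
  have h2 : chart ((bedge_of e).1 (+) flips (bedge_of e).2) (ept (partner (bedge_of e).2) t) = chart b' p'.
    by rewrite -E' rE pE edge_imageE.
  by have := far_tri (far_tri h1 h) (far_chart E2 Ep' h2); rewrite !addr0.
- by apply: far_chart => //; rewrite -E.
- by apply: far_sym; exact: IH.
- have Dw : Doo (val (projT2 w)) by case: (w) => [[] [r hr]] /=; have := hr; rewrite inE.
  have [b0 [p0 [E0 wE]]] := D_chart (Doo_D Dw).
  by have := far_tri (IH1 _ _ _ _ Ep E0 E wE) (IH2 _ _ _ _ E0 Ep' wE E'); rewrite addr0.
Qed.

Lemma far_class b p : Esq p -> Doo (chart b p) -> far (iotas (cl (chart b p))) (displays b p) 0.
Proof.
move=> Ep Dp; have hp : chart b p \in region (oo_patchwork R) tt by rewrite inE.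
have h := repr_to_surface hp.
have [b0 [p0 [E0 D0 rE _]]] := Xoo_chart (cl (chart b p)).
rewrite -[0]addr0; apply: far_tri (far_iota rE E0) _.
exact: (far_identified h).
Qed.

(** A segment of X_oo that passes from D^+ to D^- inside D must cross the middle segment; it is cut
    there and each part is measured in its own copy. *)
Lemma far_middle b p q : Esq p -> Esq q -> segment (chart b p) (chart (~~ b) q) `<=` (@Doo R) ->
  far (displays b p) (displays (~~ b) q) (enorm (chart b p - chart (~~ b) q)).
Proof.
wlog bb : b p q / b = false.
  move=> H; case: b => Ep Eq s; last exact: H.
  rewrite enormC; apply: far_sym; apply: (H false) => //.
  by rewrite segmentC.
subst b => /=; move=> Ep Eq s.
have [/andP[x0 x1] /andP[y0 y1]] := Ep; have [/andP[x0' x1'] /andP[y0' y1']] := Eq.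
have [m sm [m2 m1]] : exists2 m, segment p (tau q) m & m.2 = 2^-1 /\ 0 <= m.1 <= 2^-1.
  (* If both ends are at height 1/2 and the first lies to the right of 1/2, the segment would
     contain the removed point (1/2, 1/2). *)
  have [/andP[/eqP e /eqP e']|ne] := boolP ((p.2 == 2^-1) && (q.2 == 2^-1)).
    have [h|h] := leP p.1 (2^-1).
      by exists p; [exact: segment_l|rewrite x0 h].
    exfalso; have vc : vertices (2^-1, 2^-1 : R) by exact: (@vertices_eA R (Bot true) isT).
    apply: (@vertex_notin R false _ vc); apply: s.
    have [t t01 tE] : exists2 t, 0 <= t <= 1 & 2^-1 = (1 - t) * p.1 + t * (tau q).1.
      have /between[t t01 tE] : (tau q).1 <= 2^-1 <= p.1 by rewrite /tau /=; lra.
      by exists (1 - t); [case/andP: t01 => ? ?; apply/andP; split; lra|lra].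
    by exists t => //; apply: pairP; rewrite !planeE /=; [exact: tE|rewrite e e'; lra].
  have d0 : 0 < p.2 - (1 - q.2).
    have [e|e] := eqVneq p.2 (2^-1).
      have : 0 < q.2 - 2^-1 by rewrite subr_gt0 lt_def y0' andbT; move: ne; rewrite e eqxx.
      by lra.
    have : 0 < p.2 - 2^-1 by rewrite subr_gt0 lt_def e.
    by lra.
  pose v := (p.2 - 2^-1) / (p.2 - (1 - q.2)); pose m := (1 - v) *: p + v *: tau q.
  have v01 : 0 <= v <= 1.
    apply/andP; split; first by rewrite divr_ge0//; lra.
    by rewrite ler_pdivrMr//; lra.
  have sm : segment p (tau q) m by exists v.
  have m2 : m.2 = 2^-1 by rewrite /m /v !planeE /=; field; rewrite gt_eqF.
  have sub (t : R) r : 0 <= t <= 1 -> segment p (tau q) r -> Doo ((1 - t) *: m + t *: r).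
    move=> t01 sr; apply: s; move: sr => [w w01 ->]; exists ((1 - t) * v + t * w).
      case/andP: t01 => t0 t1; case/andP: v01 => u0 u1; case/andP: w01 => v0 v1.
      by apply/andP; split; nra.
    by apply: pairP; rewrite /m !planeE /=; ring.
  have mb : - 2^-1 <= m.1 <= 1.
    by rewrite /m !planeE /=; case/andP: v01 => v0 v1; apply/andP; split; nra.
  case/andP: mb => mb0 mb1.
  have hp : p.2 = 2^-1 -> m = p.
    by move=> e; rewrite /m /v e subrr mul0r subr0 scale1r scale0r addr0.
  have hq : q.2 = 2^-1 -> m = tau q.
    move=> e; rewrite /m (_ : v = 1) ?subrr ?scale1r ?scale0r ?add0r//.
    by rewrite /v (_ : p.2 - 2^-1 = p.2 - (1 - q.2)) ?divff ?gt_eqF//; lra.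
  clearbody m; clear v v01.
  (* Were m outside the middle segment, a point slightly further on, towards p or towards the other
     end, would lie neither in D^+ nor in D^-. *)
  exists m => //; split => //; apply/andP; split; rewrite leNgt; apply/negP => h.
    have pn : 2^-1 < p.2.
      by rewrite lt_def y0 andbT; apply/eqP => /hp mE; move: h; rewrite mE; lra.
    have /Doo_D := sub (- m.1 / 4) p ltac:(clear -h mb0; apply/andP; split; lra) (segment_l _ _).
    by case=> -[/andP[+ _] /andP[_ +]]; rewrite !planeE /= m2; clear -h mb0 x1 pn; nra.
  have qn : 2^-1 < q.2.
    by rewrite lt_def y0' andbT; apply/eqP => /hq mE; move: h; rewrite mE /tau /=; lra.
  have /Doo_D := sub ((m.1 - 2^-1) / 4) (tau q) ltac:(clear -h mb1; apply/andP; split; lra) (segment_r _ _).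
  by case=> -[/andP[_ +] /andP[+ _]]; rewrite !planeE /= m2; clear -h mb1 x0' qn; nra.
case/andP: m1 => m0 m1.
have Em : Esq m by split; apply/andP; split; lra.
have Em' : Esq (m.1 + 2^-1, 2^-1) by split => /=; apply/andP; split; lra.
have mE : chart false m = chart true (m.1 + 2^-1, 2^-1).
  by apply: pairP; rewrite /= /tau /= ?m2; lra.
rewrite -(segment_split sm) -[enorm (p - m)]addr0.
apply: far_tri (far_tri (far_display false Ep Em) (far_chart Em Em' mE)) _.
have -> : enorm (m - tau q) = enorm ((m.1 + 2^-1, 2^-1) - q).
  by rewrite -[m in LHS]/(chart false m) mE -[tau q]/(chart true q) chartB.
exact: far_display.
Qed.

Lemma far_segment p q : segment p q `<=` (@Doo R) -> far (iotas (cl p)) (iotas (cl q)) (enorm (q - p)).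
Proof.
move=> s; have Dp := s _ (segment_l p q); have Dq := s _ (segment_r p q).
have [b [p' [Ep pE]]] := D_chart (Doo_D Dp); have [b' [q' [Eq qE]]] := D_chart (Doo_D Dq).
rewrite enormC pE qE in s Dp Dq *.
have h1 := far_class Ep Dp; have h2 := far_sym (far_class Eq Dq).
suff h : far (displays b p') (displays b' q') (enorm (chart b p' - chart b' q')).
  by have := far_tri (far_tri h1 h) h2; rewrite add0r addr0.
have [e|ne] := eqVneq b' b; first by rewrite e chartB; exact: far_display.
have e : b' = ~~ b by case: (b) (b') ne => [] [].
by rewrite e in s *; exact: far_middle.
Qed.

Lemma far_path (x y : Xoo R) l : broken_path x y l -> far (iotas x) (iotas y) l.
Proof.
elim=> [{}x|i p q {}y {}l s _ IH]; first exact: far_refl.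
by case: i s IH => s IH; apply: far_tri IH; exact: far_segment.
Qed.

Lemma iota_upper (x y : Xoo R) d : 0 < d -> exists G, forall g (g3 : (3 <= g)%N) (lam : R),
  0 < lam < 1 -> (G <= g)%N -> flat_dist (iota_g g3 lam x) (iota_g g3 lam y) <= flat_dist x y + d.
Proof.
move=> d0; have d2 : 0 < d / 2 by lra.
have [l xyl hl] := flat_dist_approx Xoo_connected x y d2.
have [c [G H]] := far_path xyl.
have c0 : 0 < d / 2 / (`|c| + 1) by rewrite divr_gt0// ltr_wpDl.
have [G1 H1] := alpha_cvg c0; have [G2 H2] := @alpha_cvg R 50^-1 ltac:(by rewrite invr_gt0).
exists (maxn G (maxn G1 G2)) => g g3 lam l01; rewrite !geq_max => /and3P[h h1 h2].
apply: le_trans (H g g3 lam l01 h (H2 g g3 h2)) _.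
have := H1 g g3 h1; rewrite ler_pdivlMr ?ltr_wpDl// => H3.
have : c * eps g <= d / 2.
  apply: le_trans H3; rewrite mulrC ler_wpM2l ?alpha_exp_ge0//.
  by apply: le_trans (ler_norm _) _; rewrite lerDl.
by lra.
Qed.

Lemma eventually_all (T : finType) (E : T -> nat -> Prop) :
  (forall c, exists G, forall g, (G <= g)%N -> E c g) -> exists G, forall g, (G <= g)%N -> forall c, E c g.
Proof.
move=> /choice[f Hf]; exists (\max_c f c) => g gG c; apply: Hf; apply: leq_trans gG.
exact: leq_bigmax.
Qed.

Lemma grid n t : 0 <= t <= 1 -> exists i : 'I_n.+2, `|t - i%:R / n.+1%:R| <= n.+1%:R^-1.
Proof.
move=> /andP[t0 t1]; have n0 : 0 < n.+1%:R :> R by rewrite ltr0n.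
have /truncn_itv/andP[h1 h2] : 0 <= t * n.+1%:R by rewrite mulr_ge0// ltW.
have il : (Num.truncn (t * n.+1%:R) < n.+2)%N.
  rewrite ltnS -(ler_nat R); apply: le_trans h1 _.
  by rewrite -[leRHS]mul1r ler_wpM2r// ltW.
exists (Ordinal il); rewrite /= -[t in t - _](mulfK (lt0r_neq0 n0)) -mulrBl normrM (ger0_norm (_ : 0 <= _^-1)); last by rewrite invr_ge0 ltW.
rewrite -[leRHS]mul1r ler_wpM2r ?invr_ge0 ?(ltW n0)// ger0_norm ?subr_ge0//.
by move: h2; rewrite -natr1; lra.
Qed.

End Upper.

Lemma flat_dist4 (R : realType) (S : patchwork R) (w x y z : surface S) (l1 l2 l3 : R) :
  connected_surface S -> flat_dist w x <= l1 -> flat_dist x y <= l2 -> flat_dist y z <= l3 ->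
  flat_dist w z <= l1 + l2 + l3.
Proof.
move=> cS h1 h2 h3; have TI := flat_dist_tri cS; apply: le_trans (TI y _ _) _.
apply: lerD h3; apply: le_trans (TI x _ _) _; exact: lerD.
Qed.

(** * Uniformity through finitely many cells *)

Section UpperUniform.
Context {R : realType}.
Implicit Types (p q : R * R) (b : bool) (t l d : R) (n : nat).
Local Notation Esq := (@Dplus R).
Local Notation cl p := (@to_surface R (oo_patchwork R) tt p).
Local Notation eps g := (alpha R g ^+ M g).

(** 1010 = 402 + 206 + 402: both images are replaced by displays in the common copy. *)
Lemma iota_same b p q g (g3 : (3 <= g)%N) (lam : R) (x y : Xoo R) : 0 < lam < 1 -> eps g <= 50^-1 ->
  Esq p -> Esq q -> val (projT2 (repr x)) = chart b p -> val (projT2 (repr y)) = chart b q ->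
  flat_dist (iota_g g3 lam x) (iota_g g3 lam y) <= enorm (p - q) + 1010 * eps g.
Proof.
move=> l01 sm Ep Eq xE yE.
have h1 := @iota_display R g g3 sm lam l01 x b p xE Ep.
have h2 := @iota_display R g g3 sm lam l01 y b q yE Eq; rewrite flat_distC in h2.
have h3 := @display_dist R g g3 sm lam l01 b p q Ep Eq.
apply: le_trans (flat_dist4 (@X_connected R g g3) h1 h3 h2) _.
by move: (enorm _) (eps g); clear => z w; lra.
Qed.

Definition in_cell n (c : bool * 'I_n.+2 * 'I_n.+2) (x : Xoo R) := exists p,
  [/\ val (projT2 (repr x)) = chart c.1.1 p, Esq p,
      `|p.1 - c.1.2%:R / n.+1%:R| <= n.+1%:R^-1 & `|p.2 - c.2%:R / n.+1%:R| <= n.+1%:R^-1].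

Lemma in_cellP n x : exists c, @in_cell n c x.
Proof.
have [b [p [Ep _ pE _]]] := Xoo_chart x; have [h1 h2] := Ep.
have [i hi] := grid n h1; have [j hj] := @grid R n p.2 ltac:(case/andP: h2 => ? ?; apply/andP; split; lra).
by exists (b, i, j), p.
Qed.

Lemma in_cell_close n c x y : @in_cell n c x -> @in_cell n c y -> exists b p q,
  [/\ Esq p, Esq q, val (projT2 (repr x)) = chart b p, val (projT2 (repr y)) = chart b q &
      enorm (p - q) <= 4 * n.+1%:R^-1].
Proof.
move=> [p [pE Ep p1 p2]] [q [qE Eq q1 q2]]; exists c.1.1, p, q; split => //.
apply: le_trans (enorm_le12 _) _ => /=.
have D (u v w : R) : `|u - v| <= `|u - w| + `|v - w| by rewrite (distrC v w) ler_distD.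
have := D p.1 q.1 (c.1.2%:R / n.+1%:R); have := D p.2 q.2 (c.2%:R / n.+1%:R).
by move: n.+1%:R^-1 p1 p2 q1 q2 => z *; lra.
Qed.

Lemma repr_dist b p q x y : Esq p -> Esq q ->
  val (projT2 (repr (x : Xoo R))) = chart b p -> val (projT2 (repr (y : Xoo R))) = chart b q ->
  flat_dist x y <= enorm (p - q).
Proof.
have K z r : val (projT2 (repr (z : Xoo R))) = chart b r -> Doo (chart b r) /\ z = cl (chart b r).
  by move=> E; have [b' [r' [_ D E' ->]]] := Xoo_chart z; rewrite -E E'.
by move=> Ep Eq /K[Dp ->] /K[Dq ->]; exact: chart_dist.
Qed.

Lemma iota_upper_uniform d : 0 < d -> exists G, forall g (g3 : (3 <= g)%N) (lam : R),
  0 < lam < 1 -> (G <= g)%N -> forall x y : Xoo R,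
  flat_dist (iota_g g3 lam x) (iota_g g3 lam y) <= flat_dist x y + d.
Proof.
move=> d0.
(* The error budget: d/4 for the pair of cell representatives, d/4 for the powers of alpha, and at
   most d/4 for the cell diameters, each at most d/16 and entering four times in all. *)
have [n nd] : exists n, n.+1%:R^-1 <= d / 64.
  exists (Num.truncn (64 / d)); have /truncn_itv/andP[_ h] : 0 <= 64 / d by rewrite divr_ge0// ltW.
  rewrite invf_ple ?posrE ?ltr0n//; last by rewrite divr_gt0.
  by apply: ltW; rewrite invf_div.
pose x0 : Xoo R := surface_base (oo_patchwork R).
pose rep c : Xoo R := xget x0 [set x | @in_cell n c x].
have repP c x : in_cell c x -> in_cell c (rep c).
  by move=> h; rewrite /rep; case: xgetP => [y _ //|/(_ x)]; case.
have d4 : 0 < d / 4 by lra.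
pose E (cc : (bool * 'I_n.+2 * 'I_n.+2) * (bool * 'I_n.+2 * 'I_n.+2)) g := forall (g3 : (3 <= g)%N) (lam : R),
  0 < lam < 1 -> flat_dist (iota_g g3 lam (rep cc.1)) (iota_g g3 lam (rep cc.2)) <=
    flat_dist (rep cc.1) (rep cc.2) + d / 4.
have [G HG] : exists G, forall g, (G <= g)%N -> forall cc, E cc g.
  apply: eventually_all => -[c c']; have [G HG] := iota_upper (rep c) (rep c') d4.
  by exists G => g gG g3 lam l01; exact: HG.
have p2020 : 0 < 2020 :> R by rewrite ltr0n.
have e0 : 0 < d / 4 / 2020 by exact: divr_gt0.
have [G1 H1] := alpha_cvg e0; have [G2 H2] := @alpha_cvg R 50^-1 ltac:(by rewrite invr_gt0 ltr0n).
exists (maxn G (maxn G1 G2)) => g g3 lam l01; rewrite !geq_max => /and3P[h h1 h2] x y.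
have sm := H2 g g3 h2; have {}H1 := H1 g g3 h1; rewrite (ler_pdivlMr _ _ p2020) in H1.
have [c xc] := in_cellP n x; have [c' yc] := in_cellP n y.
have [b [p [q [Ep Eq xE rE pq]]]] := in_cell_close xc (repP _ _ xc).
have [b' [p' [q' [Ep' Eq' yE rE' pq']]]] := in_cell_close (repP _ _ yc) yc.
have i1 := iota_same g3 l01 sm Ep Eq xE rE.
have i2 := iota_same g3 l01 sm Ep' Eq' yE rE'.
have i3 := HG g h (c, c') g3 lam l01; rewrite /= in i3.
have o1 := repr_dist Ep Eq xE rE; have o2 := repr_dist Ep' Eq' yE rE'.
rewrite flat_distC in o1; rewrite flat_distC in o2.
apply: le_trans (flat_dist4 (@X_connected R g g3) i1 i3 i2) _.
have o3 := flat_dist4 (@Xoo_connected R) o1 (lexx (flat_dist x y)) o2.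
move: (flat_dist (rep c) (rep c')) (flat_dist x y) o3 pq pq' nd H1 d0.
move: (enorm _) (enorm _) (n.+1%:R^-1) (eps g); clear => *; lra.
Qed.

End UpperUniform.

(** * Lower bound *)

Section Control.
Context {R : realType}.
Variable g : nat.
Hypothesis g3 : (3 <= g)%N.
Local Notation a := (alpha R g).
Local Notation M := (M g).
Local Notation Esq := (@Dplus R).
Local Notation eta := (a ^+ M).
Hypothesis small : eta <= 50^-1.
Variables (s sigma : R) (w : bool -> R * R -> R).
Hypotheses (s0 : 0 < s) (s1 : s <= 8^-1) (eta_s : 80 * eta <= s).
Hypothesis wL : forall b, nonexpanding (w b).
Hypothesis wI : edge_invariant w.
Hypothesis wS : forall b p, distZ p <= 2 * s -> w b p = sigma.
Implicit Types (p q : R * R) (e : bedge) (b : bool) (t y z : R).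

(** If two points at distance at least s are each displaced by at most 20 eta, their distance
    changes by at most 40 eta and stays at least s/2; the relative change is at most 80 eta / s. *)
Definition slope : R := 1 + 80 * eta / s.

Definition core p := (s <= p.1 <= 1 - s /\ 2^-1 + s <= p.2 <= 1 - s) \/ distZ p <= s.

(** The prescribed values: those of [w] in the core, and on an edge of Pi_g the values of [w] at the
    corresponding points of the edge of the square. The latter make the extension respect the
    gluings of X_g exactly, not just approximately. *)
Definition control b p y := (core p /\ y = w b p) \/
  exists e t, [/\ gvalid g e, 0 <= t <= 1, p = gpt g e t & y = w b (ept e t)].

Lemma eta0 : 0 <= eta. Proof. exact: alpha_exp_ge0. Qed.

Lemma slope_bounds : 1 <= slope <= 2.
Proof.
move: (s0) (s1) (eta_s) => s_gt0 s_le eta_le.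
rewrite /slope; have h : 0 <= 80 * eta / s by rewrite divr_ge0 ?mulr_ge0 ?ler0n ?eta0 ?ltW.
have : 80 * eta / s <= 1 by rewrite ler_pdivrMr// mul1r.
by lra.
Qed.

Lemma lip_apart b p q p' q' : enorm (p' - p) <= 20 * eta -> enorm (q' - q) <= 20 * eta ->
  s <= enorm (p' - q') -> w b p' - w b q' <= slope * enorm (p - q).
Proof.
move: (s0) (s1) (eta_s) => s_gt0 s_le eta_le.
move=> hp hq h; have e0 := eta0; apply: le_trans (wL _ _ _) _.
have h1 := enorm_tri p p' q'; have h2 := enorm_tri q p q'; rewrite (enormC q q') in h2.
have h3 : enorm (p' - q') <= enorm (p - q) + 40 * eta by lra.
have h4 : s / 2 <= enorm (p - q) by lra.
apply: le_trans h3 _; rewrite /slope; set k := 80 * eta / s.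
have k0 : 0 <= k by rewrite divr_ge0 ?mulr_ge0 ?ler0n ?(ltW s_gt0).
have ks : k * s = 80 * eta by rewrite divfK// gt_eqF.
by have := ler_wpM2l k0 h4; lra.
Qed.

(** Near a vertex the distance to the vertices is compared: being 1-Lipschitz, it either is at most
    2s at the edge point too or forces a gap of s. *)
Lemma core_ept p e t : core p -> valid e -> 0 <= t <= 1 ->
  s <= enorm (p - ept e t) \/ distZ p <= 2 * s /\ distZ (ept e t) <= 2 * s.
Proof.
move: (s0) (s1) (eta_s) => s_gt0 s_le eta_le.
move=> cp ve t01; case: cp => [[/andP[x0 x1] /andP[y0 y1]]|dp].
  left; have h1 := ler_enorm1 (p - ept e t); have h2 := ler_enorm2 (p - ept e t).
  rewrite eptE /onside in h1 h2 *; case: e {ve} h1 h2 => [h|n|n|n|n] /= h1 h2.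
  - by apply: le_trans h2; rewrite ger0_norm; lra.
  - by apply: le_trans h2; rewrite ler0_norm; lra.
  - by apply: le_trans h2; rewrite ler0_norm; lra.
  - by apply: le_trans h1; rewrite ler0_norm; lra.
  - by apply: le_trans h1; rewrite ger0_norm; lra.
have := setdist_nonexpanding (@vertices_neq0 R) (ept e t) p; rewrite -/distZ enormC.
have [h|h] := leP (distZ (ept e t)) (2 * s); first by right; split => //; lra.
by left; lra.
Qed.

(** Points of one edge may be arbitrarily close, so the lengths of the edge and of its counterpart
    are compared instead. They differ by at most 40 eta, a small proportion once the edge is at
    least 2s long. *)
Lemma ept_gpt_same b e t t' : gvalid g e -> 0 <= t <= 1 -> 0 <= t' <= 1 -> 2 * s <= len e ->
  w b (ept e t) - w b (ept e t') <= slope * enorm (gpt g e t - gpt g e t').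
Proof.
move: (s0) (s1) (eta_s) => s_gt0 s_le eta_le.
move=> ve t01 t01' ls; apply: le_trans (wL _ _ _) _; rewrite ept_sub enormZ enorm_edge.
have -> : gpt g e t - gpt g e t' = (t - t') *: (gB g e - gA g e).
  by rewrite /gpt; apply: pairP; rewrite !planeE /=; ring.
rewrite enormZ mulrCA ler_wpM2l//.
have hA := gA_close g3 small ve; have hB := gB_close g3 small ve.
have h : len e <= enorm (gB g e - gA g e) + 40 * eta.
  rewrite -enorm_edge.
  have -> : eB e - eA e = (eB e - gB g e) + (gB g e - gA g e) - (eA e - gA g e) :> R * R.
    by apply: pairP; rewrite !planeE /=; ring.
  have h1 := enormD ((eB e - gB g e) + (gB g e - gA g e)) (- (eA e - gA g e) : R * R).
  have h2 := enormD (eB e - gB g e : R * R) (gB g e - gA g e); rewrite enormN in h1.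
  rewrite /near in hA hB; lra.
have e0 := eta0; have /andP[L1 L2] := slope_bounds.
have k : s * (slope - 1) = 80 * eta by rewrite /slope; field; rewrite gt_eqF.
move: (len e) (enorm _) (slope) h ls L1 L2 k => x y z h ls L1 L2 k.
by nra.
Qed.

(** If both points come from within 2s of the vertices, both values are [sigma]. Otherwise the
    original points are at least s apart, or both lie in the core, or they lie on one edge, whose
    length then exceeds 4s. *)
Lemma control_lip b p y q z : control b p y -> control b q z -> y - z <= slope * enorm (p - q).
Proof.
move: (s0) (s1) (eta_s) => s_gt0 s_le eta_le.
have e0 := eta0; have /andP[L1 L2] := slope_bounds.
have z0 p' : enorm (p' - p') <= 20 * eta by rewrite subrr enorm0 mulr_ge0 ?ler0n.
have le0 (r r' : R * R) : sigma - sigma <= slope * enorm (r - r').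
  by rewrite subrr mulr_ge0 ?enorm_ge0//; lra.
have gc e t : gvalid g e -> 0 <= t <= 1 -> enorm (ept e t - gpt g e t) <= 20 * eta by exact: gpt_close.
case=> [[cp ->]|[e [t [ve t01 -> ->]]]]; case=> [[cq ->]|[e' [t' [ve' t01' -> ->]]]].
- apply: le_trans (wL _ _ _) _.
  by rewrite -[leLHS]mul1r ler_wpM2r ?enorm_ge0.
- case: (core_ept cp (gvalid_valid ve') t01') => [h|[h1 h2]]; last by rewrite !wS.
  by apply: (@lip_apart b _ _ p (ept e' t')) => //; exact: gc.
- case: (core_ept cq (gvalid_valid ve) t01) => [h|[h1 h2]]; last by rewrite !wS.
  by apply: (@lip_apart b _ _ (ept e t) q) => //; [exact: gc|rewrite enormC].
have v1 := gvalid_valid ve; have v2 := gvalid_valid ve'.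
have [d1|d1] := leP (distZ (ept e t)) (2 * s); have [d2|d2] := leP (distZ (ept e' t')) (2 * s).
- by rewrite !wS.
- have [ee|ne] := pselect (e' = e).
    subst e'; apply: ept_gpt_same => //; move: d2; rewrite distZ_ept//.
    by have := tent_le t'; have := len_gt0 (R:=R) v1; nra.
  apply: (@lip_apart b _ _ (ept e t) (ept e' t')); [exact: gc|exact: gc|].
  rewrite enormC; apply: le_trans (ept_apart v2 v1 ne t01' t01).
  by rewrite -distZ_ept//; lra.
- have [ee|ne] := pselect (e = e').
    subst e'; apply: ept_gpt_same => //; move: d1; rewrite distZ_ept//.
    by have := tent_le t; have := len_gt0 (R:=R) v1; nra.
  apply: (@lip_apart b _ _ (ept e t) (ept e' t')); [exact: gc|exact: gc|].
  apply: le_trans (ept_apart v1 v2 ne t01 t01').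
  by rewrite -distZ_ept//; lra.
- have [ee|ne] := pselect (e = e').
    subst e'; apply: ept_gpt_same => //; move: d1; rewrite distZ_ept//.
    by have := tent_le t; have := len_gt0 (R:=R) v1; nra.
  apply: (@lip_apart b _ _ (ept e t) (ept e' t')); [exact: gc|exact: gc|].
  apply: le_trans (ept_apart v1 v2 ne t01 t01').
  by rewrite -distZ_ept//; lra.
Qed.

Lemma control_neq0 b : exists p y, control b p y.
Proof.
move: (s0) (s1) (eta_s) => s_gt0 s_le eta_le.
exists (2^-1, 3 / 4), (w b (2^-1, 3 / 4)); left; split => //; left => /=.
by split; apply/andP; split; lra.
Qed.

Definition smooth b : R * R -> R := mcshane slope (control b).

Lemma slope_ge0 : 0 <= slope. Proof. by have /andP[? _] := slope_bounds; lra. Qed.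

Lemma smooth_lip b p q : smooth b p - smooth b q <= slope * enorm (p - q).
Proof. exact: (mcshane_lip slope_ge0 (@control_lip b) (control_neq0 b)). Qed.

Lemma smoothE b p y : control b p y -> smooth b p = y.
Proof. exact: (mcshaneE slope_ge0 (@control_lip b) (control_neq0 b)). Qed.

Lemma smooth_cross b e t : gvalid g e -> 0 <= t <= 1 ->
  smooth b (gpt g e t) = smooth (b (+) flips e) (gpt g (partner e) t).
Proof.
move: (s0) (s1) (eta_s) => s_gt0 s_le eta_le.
move=> ve t01; rewrite (@smoothE _ _ (w b (ept e t))); last by right; exists e, t.
rewrite wI ?(gvalid_valid ve)//; symmetry; apply: smoothE; right; exists (partner e), t.
by rewrite gvalid_partner.
Qed.

Lemma smooth_vertex b p (z : R * R) : vertices z -> enorm (p - z) <= s -> smooth b p = sigma.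
Proof.
move: (s0) (s1) (eta_s) => s_gt0 s_le eta_le.
move=> vz hz; have d : distZ p <= s by apply: le_trans hz; apply: setdist_le; [exact: vertices_neq0|].
rewrite (@smoothE _ _ (w b p)); first by apply: wS; lra.
by left; split => //; right.
Qed.

(** The point p is clamped into the core at a cost of 2s. Then [w] varies by at most 2s, and
    [smooth], with slope at most 2, by at most 2 (2s + s/2) = 5s. *)
Lemma smooth_close b p q : Esq p -> enorm (q - p) <= 25 * eta ->
  `|smooth b q - w b p| <= 7 * s.
Proof.
move: (s0) (s1) (eta_s) => s_gt0 s_le eta_le.
move=> Ep qp; have [/andP[x0 x1] /andP[y0 y1]] := Ep; have /andP[L1 L2] := slope_bounds.
have K c lo hi : 0 <= hi - lo - 4 * s -> lo <= c <= hi -> exists2 c', lo + s <= c' <= hi - s & `|c - c'| <= s.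
  move=> lh /andP[c0 c1]; have [h|h] := leP (lo + s) c; last first.
    by exists (lo + s); [apply/andP; split; lra|rewrite ler0_norm; lra].
  have [h'|h'] := leP c (hi - s).
    by exists c; [apply/andP|rewrite subrr normr0 ltW].
  by exists (hi - s); [apply/andP; split; lra|rewrite ger0_norm; lra].
have [x hx px] := K p.1 0 1 ltac:(lra) ltac:(by apply/andP).
have [y hy py] := K p.2 2^-1 1 ltac:(lra) ltac:(by apply/andP).
have pr : enorm (p - (x, y)) <= 2 * s.
  by apply: le_trans (enorm_le12 _) _; rewrite /=; lra.
have E : smooth b (x, y) = w b (x, y).
  by apply: smoothE; left; split => //; left; rewrite /= add0r in hx *.
have h1 := wL b p (x, y); have h2 := wL b (x, y) p; rewrite (enormC (x, y)) in h2.
have h3 := smooth_lip b q (x, y); have h4 := smooth_lip b (x, y) q; rewrite (enormC (x, y) q) in h4.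
have h5 : enorm (q - (x, y)) <= 5 / 2 * s.
  by apply: le_trans (enorm_tri p q (x, y)) _; lra.
have h6 : slope * enorm (q - (x, y)) <= 2 * (5 / 2 * s).
  by apply: ler_pM => //; [exact: slope_ge0|exact: enorm_ge0].
rewrite E in h3 h4; rewrite ler_norml; move: h1 h2 h3 h4 h6 pr.
move: (smooth b q) (w b p) (w b (x, y)) (slope * _) (enorm _) => z1 z2 z3 z4 z5.
clear E wL wI wS K L1 L2 h5 qp; move=> h1 h2 h3 h4 h6 pr; apply/andP; split; lra.
Qed.

End Control.

(** * Functions on two copies of Pi_g that descend to X_g *)

Section Descent.
Context {R : realType}.
Variable g : nat.
Hypothesis g3 : (3 <= g)%N.
Local Notation a := (alpha R g).
Local Notation P := (@P R g).
Local Notation Q := (@Q R g).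
Local Notation W := (@W R g).
Local Notation M := (M g).
Local Notation N := (N g).
Local Notation T := (@T R g).
Local Notation AY := (@AY_patchwork R g g3).
Local Notation tri := (@tri R g).
Local Notation clp := (@clp R g g3).
Local Notation sh := (@sh R g).
Local Notation pc := (pc g).
Hypothesis M1 : (1 < M)%N.
Variables (L sigma : R) (v : bool -> R * R -> R).
Hypothesis L0 : 0 <= L.
Hypothesis vL : forall b p q, v b p - v b q <= L * enorm (p - q).
Hypothesis vC : forall b e t, gvalid g e -> 0 <= t <= 1 ->
  v b (gpt g e t) = v (b (+) flips e) (gpt g (partner e) t).
(* The edge P_(N+1)Q_(N+1) is glued to an edge that has no counterpart in the
   limit. *)
Hypothesis vP : forall b p, segment (P N.+1) (Q N.+1) p -> v b p = sigma.
Hypothesis vW : forall b p, segment (W M) (W M.-1) p -> v b p = sigma.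
Implicit Types (p q A B C D : R * R) (i k n : nat) (b : bool) (t : R) (c d : nat * bool).

Definition place_of n : place :=
  if (n <= g)%N then Fan n else if (n - g <= N.+1)%N then Cap (n - g) else Att ((2 * g).+1 - n).

Lemma place_of_pc pl : vplace g pl -> place_of (pc pl).1 = pl.
Proof.
have NM' := NM g3; rewrite /place_of; case: pl => [i|i|k] /= h.
- by rewrite ifT; [|lia].
- by rewrite ifF ?ifT ?addKn//; [lia|apply/negbTE; lia].
- rewrite ifF; last by apply/negbTE; lia.
  by rewrite ifF; [congr Att; lia|apply/negbTE; lia].
Qed.

(** The function on the triangles of X_g induced by the pair [v]. Adding the orientation of the
    triangle to that of its place in Pi_g recovers the copy in which it lies. *)
Definition piecewise c p : R :=
  v (c.2 (+) (pc (place_of c.1)).2) (mirror (c.2 (+) (pc (place_of c.1)).2) p + sh (place_of c.1)).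

Lemma piecewise_clp b pl q : vplace g pl ->
  piecewise ((pc pl).1, (pc pl).2 (+) b) (mirror b (q - sh pl)) = v b q.
Proof.
move=> vp; rewrite /piecewise /= place_of_pc// (addbC _ b) -addbA addbb addbF.
by rewrite mirrorK subrK.
Qed.

Lemma by_translation_conv A B C D p q : by_translation A B C D p q -> D - C = B - A ->
  exists t, [/\ 0 <= t <= 1, p = (1 - t) *: A + t *: B & q = (1 - t) *: C + t *: D].
Proof.
move=> [[t t01 pE] [u [qE H]]] e; exists t; split => //; rewrite qE pE.
case: H => -[CE DE].
  by rewrite CE DE; apply: pairP; rewrite !planeE /=; ring.
(* Reversing the ends reverses the edge vector, so with equal vectors the edge is degenerate. *)
have AB : A = B.
  move: e; rewrite CE DE => e; have := congr1 fst e; have := congr1 snd e; rewrite !planeE /= => e1 e2.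
  by apply: pairP; lra.
by rewrite CE DE AB; apply: pairP; rewrite !planeE /=; ring.
Qed.

Lemma piecewise_glue b pl A B b' pl' C D A' B' C' D' c d p q :
  vplace g pl -> vplace g pl' -> c = ((pc pl).1, (pc pl).2 (+) b) -> d = ((pc pl').1, (pc pl').2 (+) b') ->
  A' = mirror b (A - sh pl) -> B' = mirror b (B - sh pl) ->
  (C' = mirror b' (C - sh pl') /\ D' = mirror b' (D - sh pl')) \/
  (C' = mirror b' (D - sh pl') /\ D' = mirror b' (C - sh pl')) ->
  mirror b (B - A) = mirror b' (D - C) ->
  (forall t, 0 <= t <= 1 -> v b ((1 - t) *: A + t *: B) = v b' ((1 - t) *: C + t *: D)) ->
  by_translation A' B' C' D' p q -> piecewise c p = piecewise d q.
Proof.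
move=> vp vp' -> -> AE BE CE tr H bt.
have {}bt : by_translation A' B' (mirror b' (C - sh pl')) (mirror b' (D - sh pl')) p q.
  case: CE => -[CE DE]; rewrite CE DE in bt => //.
  by move: bt => [sg [u [qE h]]]; split => //; exists u; split => //; case: h => -[? ?]; [right|left].
have [|t [t01 pE qE]] := by_translation_conv bt.
  have sB (U V S : R * R) : (V - S) - (U - S) = V - U by rewrite opprD addrACA subrr addr0.
  by rewrite AE BE -!mirrorB !sB tr.
have sE t' U V S : (1 - t') *: (U - S) + t' *: (V - S) = (1 - t') *: U + t' *: V - S :> R * R.
  by apply: pairP; rewrite !planeE /=; ring.
rewrite pE qE AE BE -!mirror_conv !sE !piecewise_clp//.
exact: H.
Qed.

(** Gluings interior to Pi_g compare [v] with itself at one point, those matched with edges of the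
    square are covered by [vC], and a single pair is left, on which [v] is constant. *)
Lemma glued_edges_piecewise c A' B' d C' D' p q : glued_edges g c A' B' d C' D' ->
  by_translation A' B' C' D' p q -> piecewise c p = piecewise d q.
Proof.
have NM' := NM g3; have MM := M_le g3; have M0 := M_gt0 g3; have N0 := N_gt0 g3.
have rev b e t : gvalid g e -> 0 <= t <= 1 -> v b ((1 - t) *: gB g e + t *: gA g e) =
    v (b (+) flips e) ((1 - t) *: gB g (partner e) + t *: gA g (partner e)).
  move=> ve t01; rewrite !(conv_rev t); apply: (vC _ ve).
  by case/andP: t01 => ? ?; apply/andP; split; lra.
case=> {c A' B' d C' D'} [b i h|b i h|b|b|b|b|b i h].
- apply: (piecewise_glue (b := b) (pl := Fan i) (A := P 0) (B := Q i) (b' := b) (pl' := Fan i.+1)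
    (C := P 0) (D := Q i)) => //=; rewrite ?subr0 //; [lia|lia|by left].
(* For i <= N + 1 the rim edge is interior to Pi_g; the others are the right boundary edges, glued
   to the attached triangles. *)
- have [iN|iN] := leqP i N.+1.
    apply: (piecewise_glue (b := b) (pl := Fan i) (A := Q i.-1) (B := Q i) (b' := b) (pl' := Cap i)
      (C := Q i.-1) (D := Q i)) => //=; rewrite ?subr0 //; [lia|by left].
  have [k [k0 kM ik ik1 gi]] : exists k, [/\ (0 < k)%N, (k <= M)%N, i = (g - k.-1)%N, i.-1 = (g - k)%N & (g + i = (2 * g - k).+1)%N].
    by exists (g.+1 - i)%N; split; lia.
  have [k1 k2] : mirror (odd k) (Q (g - k)) + sh (Att k) = W k /\
      mirror (odd k) (Q (g - k.-1)) + sh (Att k) = gA g (Lft k).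
    have [n1|n1] := eqVneq k 1%N.
      rewrite n1 /sh /= subn0 (new_vertex1 g3) -(shift1' g3) subn1; split => //.
      exact: shift1''.
    by have [? ? ?] := @shift_vertices R g g3 k ltac:(lia); rewrite /= (negbTE n1).
  apply: (piecewise_glue (b := b) (pl := Fan i) (A := Q (g - k)) (B := Q (g - k.-1)) (b' := b (+) odd k) (pl' := Att k)
      (C := W k) (D := gA g (Lft k))) => //; rewrite /= ?subr0 ?ik1 -?ik //.
  + by rewrite k0.
  + by rewrite (addbC b) addKb gi.
  + left; rewrite -(addrE k1) -(addrE k2) !mirror_mirror -!addbA addbb !addbF ?ik.
    by [].
  + rewrite /= in k2; rewrite -k2 -k1 ik opprD addrACA subrr addr0 -mirrorB mirror_mirror -addbA addbb addbF.
    by [].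
  + by move=> t t01; have := rev b (Rgt k) t; rewrite /= k0 kM -ik => /(_ isT t01).
- apply: (piecewise_glue (b := b) (pl := Fan 1) (A := P 0) (B := Q 0) (b' := ~~ b) (pl' := Fan g)
    (C := Q g) (D := P 0)) => //=; rewrite ?subr0 //; [lia|lia|by right| |].
  + by rewrite (Q0_diff g3) (Qg_diff g3); case: (b); rewrite /mirror /= ?opprK.
  + by move=> t t01; have := rev b (Bot false) t isT t01; rewrite /= addbT.
- apply: (piecewise_glue (b := b) (pl := Cap 1) (A := P 1) (B := Q 1) (b' := b) (pl' := Att 1)
    (C := P 1) (D := Q 1)) => //; rewrite /= ?subr0 //.
  + by rewrite addn1.
  + by have -> : ((2 * g - 1).+1 = 2 * g)%N by lia.
  + right; rewrite -(addrE (shift1 g3)) -(addrE (shift1'' g)) !mirror_mirror addbT.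
    by [].
- have [e1 e2 e3] := @shift_vertices R g g3 2 M1.
  apply: (piecewise_glue (b := b) (pl := Cap 1) (A := P 1) (B := Q 0) (b' := b) (pl' := Att 2)
    (C := P 1) (D := Q 0)) => //; rewrite /= ?subr0 //.
  + by rewrite addn1.
  + by have -> : ((2 * g - 2).+1 = (2 * g).-1)%N by lia.
  + left; rewrite /= subn1 in e1 e3.
    by rewrite -[P 1]/(W 1) -[Q 0]/(W 0) -(addrE e1) -(addrE e3).
- apply: (piecewise_glue (b := ~~ b) (pl := Att 1) (A := Q 1) (B := new_vertex g 1) (b' := b) (pl' := Cap 2)
    (C := P 2) (D := Q 1)) => //; rewrite ?subr0 //.
  + rewrite /=; have -> : ((2 * g - 1).+1 = 2 * g)%N by lia.
    by case: b.
  + by rewrite /= addn2.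
  + by rewrite /= -(addrE (shift1 g3)) mirror_mirror addbT negbK.
  + by rewrite /= (new_vertex1 g3) -(addrE (shift1' g3)) mirror_mirror addbT negbK.
  + by right.
  + rewrite (new_vertex1_diff g3) -[Q 1 - P 2]opprB PQ_diff//; last by lia.
    by case: b; rewrite /mirror ?planeE /= ?opprK.
  + by move=> t t01; have := rev (~~ b) (Top' 1) t; rewrite /= N0 addbT negbK => /(_ isT t01).
(* For i <= N these are the top edges; larger i correspond to attached triangles through i = g -
   k. *)
have [iN|iN] := leqP i N.
  apply: (piecewise_glue (b := b) (pl := Cap i) (A := P i) (B := Q i) (b' := ~~ b) (pl' := Cap i.+1)
    (C := Q i) (D := P i.+1)) => //; rewrite /= ?subr0 //.
  + by lia.
  + by rewrite addnS.
  + by left.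
  + rewrite (QP_diff g3) ?(PQ_diff g3); [|lia|lia].
    by case: b; rewrite /mirror ?planeE /= ?opprK.
  + move=> t t01; have := @vC b (Top' i) t; rewrite /gpt /= ifF ?addbT; last by apply/negbTE; lia.
    by apply => //; lia.
have [k [kM k1 ik gi gi']] : exists k, [/\ (k <= M)%N, (1 < k)%N, i = (g - k)%N, (g + i).+1 = (2 * g - k).+1 & (g + i = (2 * g - k.+1).+1)%N].
  by exists (g - i)%N; split; lia.
have [d1 d2 d3] := @shift_vertices R g g3 k ltac:(lia).
have Ek : (g - k.-1 = i.+1)%N by lia.
rewrite Ek in d1; rewrite -ik in d2.
have tr : Q i - P i = mirror true (P i.+1 - Q i).
  rewrite (QP_diff g3) ?(PQ_diff g3); [|lia|lia].
  by rewrite /mirror.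
(* At k = M the last attached triangle meets P_(N+1)Q_(N+1), and both edges carry the constant
   value; for smaller k the edge is interior to Pi_g. *)
have [kM'|kM'] := leqP M k.
  have {kM kM'} kM : k = M by lia.
  have iN1 : i = N.+1 by lia.
  apply: (piecewise_glue (b := b) (pl := Cap i) (A := P i) (B := Q i) (b' := ~~ b (+) odd k) (pl' := Att k)
    (C := W k) (D := W k.-1)) => //; rewrite /= ?subr0 //.
  + by rewrite iN1 ltnSn.
  + by rewrite kM M0 leqnn.
  + by rewrite gi (addbC (~~ b)) addKb.
  + left; rewrite /sh -(addrE d1) -(addrE d2) !mirror_mirror -!addbA addbb addbF.
    by [].
  + rewrite tr -d1 -d2 opprD addrACA subrr addr0 -mirrorB !mirror_mirror -addbA addbb addbF addbT.
    by [].
  + by move=> t t01; rewrite vP ?vW//; [rewrite kM; exists t|rewrite iN1; exists t].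
have [e1 e2 e3] := @shift_vertices R g g3 k.+1 ltac:(lia).
have {}e1 : mirror (odd k.+1) (P i) + sh (Att k.+1) = W k by rewrite ik; exact: e1.
have {}e3 : mirror (odd k.+1) (Q i) + sh (Att k.+1) = W k.-1 by rewrite ik; exact: e3.
apply: (piecewise_glue (b := b (+) odd k.+1) (pl := Att k.+1) (A := W k) (B := W k.-1) (b' := b (+) odd k.+1) (pl' := Att k)
    (C := W k) (D := W k.-1)) => //; rewrite ?subr0 //.
+ by rewrite /=; lia.
+ by rewrite /= gi' (addbC b) addKb.
+ by rewrite /= gi; congr (_, _); case: (b); case: (odd k).
+ by rewrite -(addrE e1) mirror_mirror -addbA addbb addbF.
+ by rewrite -(addrE e3) mirror_mirror -addbA addbb addbF.
left; rewrite /sh -(addrE d1) -(addrE d2) !mirror_mirror /= -addbA addNb addbb addbT.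
by [].
Qed.

Lemma piecewise_glue_step (x y : points AY) : glue_step x y ->
  piecewise (projT1 x) (val (projT2 x)) = piecewise (projT1 y) (val (projT2 y)).
Proof. by move=> [A [B [C [D [ge bt]]]]]; exact: (glued_edges_piecewise ge bt). Qed.

Lemma lipschitz_clp b pl q b' pl' q' : vplace g pl -> vplace g pl' -> tri pl q -> tri pl' q' ->
  v b' q' - v b q <= L * flat_dist (clp b pl q) (clp b' pl' q').
Proof.
move=> vp vp' tq tq'.
pose V (x : points AY) := piecewise (projT1 x) (val (projT2 x)).
pose F (x : @X R g g3) := V (repr (x : surface AY)).
have FE c p : T c p -> F (@to_surface R AY c p) = piecewise c p.
  move=> Tp; have hp : p \in T c by rewrite inE.
  exact: (repr_lift piecewise_glue_step hp).
have FC b0 pl0 q0 : vplace g pl0 -> tri pl0 q0 -> F (clp b0 pl0 q0) = v b0 q0.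
  by move=> vp0 tq0; rewrite clpE FE ?piecewise_clp//; exact: T_place.
rewrite -(FC b pl q)// -(FC b' pl' q')//; apply: (@le_flat_dist R AY (@X_connected R g g3) F L L0) => c p r s.
rewrite !FE; [|exact: s (segment_l _ _)|exact: s (segment_r _ _)].
rewrite /piecewise; apply: le_trans (vL _ _ _) _.
have sB (U V' S : R * R) : (V' + S) - (U + S) = V' - U by rewrite opprD addrACA subrr addr0.
by rewrite sB -mirrorB enorm_mirror.
Qed.

End Descent.

(** * The test function and the lower estimate *)

Section Lower.
Context {R : realType}.
Implicit Types (p q : R * R) (b : bool) (t d : R) (n : nat).
Local Notation Esq := (@Dplus R).
Local Notation cl p := (@to_surface R (oo_patchwork R) tt p).
Local Notation eps g := (alpha R g ^+ M g).

Definition soft_threshold (c z : R) : R := Num.max (z - c) 0 + Num.min (z + c) 0.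

Lemma soft_threshold_lip (c z y : R) : 0 <= c -> soft_threshold c z - soft_threshold c y <= `|z - y|.
Proof.
move=> c0; have h := ler_norm (z - y); have h0 := normr_ge0 (z - y); rewrite /soft_threshold.
have [h1|h1] := leP (z - c) 0; have [h2|h2] := leP (z + c) 0;
  have [h3|h3] := leP (y - c) 0; have [h4|h4] := leP (y + c) 0; lra.
Qed.

Lemma soft_threshold_close (c z : R) : 0 <= c -> `|soft_threshold c z - z| <= c.
Proof.
move=> c0; rewrite /soft_threshold ler_norml.
by have [h1|h1] := leP (z - c) 0; have [h2|h2] := leP (z + c) 0; apply/andP; split; lra.
Qed.

Lemma soft_threshold0 (c z : R) : `|z| <= c -> soft_threshold c z = 0.
Proof.
rewrite ler_norml => /andP[h1 h2]; rewrite /soft_threshold.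
by have [h3|h3] := leP (z - c) 0; have [h4|h4] := leP (z + c) 0; lra.
Qed.

Section Potential.
Variables (x : Xoo R) (s : R).
Hypothesis s0 : 0 < s.

Definition cluster_value : R := potential x false (1, 1).
Definition flattened b p := cluster_value + soft_threshold (2 * s) (potential x b p - cluster_value).

Lemma flattened_nonexpanding b : nonexpanding (flattened b).
Proof.
move=> p q; rewrite /flattened opprD addrACA subrr add0r.
have c0 : 0 <= 2 * s by rewrite mulr_ge0// ltW.
apply: le_trans (soft_threshold_lip _ _ c0) _.
rewrite opprB addrA subrK; apply: nonexpanding_abs; exact: potential_nonexpanding.
Qed.

Lemma flattened_invariant : edge_invariant flattened.
Proof. by move=> b e t ve t01; rewrite /flattened potential_invariant. Qed.

(** The potential takes the cluster value at every vertex and is 1-Lipschitz, so within 2s of the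
    vertices it differs from that value by at most the threshold. *)
Lemma flattened_cluster b p : distZ p <= 2 * s -> flattened b p = cluster_value.
Proof.
move=> dp; rewrite /flattened soft_threshold0 ?addr0//; apply: le_trans dp.
apply: (le_setdist (@vertices_neq0 R)) => z vz.
rewrite /cluster_value -(vertices_const (potential_invariant x) (@potential_nonexpanding R x) b vz).
by apply: nonexpanding_abs; exact: potential_nonexpanding.
Qed.

Lemma flattened_close b p : `|flattened b p - potential x b p| <= 2 * s.
Proof.
have c0 : 0 <= 2 * s by rewrite mulr_ge0// ltW.
have := soft_threshold_close (potential x b p - cluster_value) c0; rewrite /flattened.
by congr (`|_| <= _); lra.
Qed.

End Potential.

Lemma segment_close p q (z : R * R) c r : segment p q r -> enorm (z - p) <= c -> enorm (z - q) <= c ->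
  enorm (r - z) <= c.
Proof.
move=> [t t01 ->] h1 h2.
have := conv_close t01 h1 h2; rewrite enormC; congr (enorm (_ - _) <= _).
by apply: pairP; rewrite !planeE /=; ring.
Qed.

(** This unmatched edge sits at the cut corner: both of its ends are close to the vertex (1, 1 -
    2^-(M+1)), as the corner itself has size O(alpha^M). *)
Lemma cut_edge g (g3 : (3 <= g)%N) p : eps g <= 50^-1 ->
  segment (P R g (N g).+1) (Q R g (N g).+1) p -> exists2 z, vertices z & enorm (p - z) <= 25 * eps g.
Proof.
have NM' := NM g3; have MN := M_le_N g3; have N0 := N_gt0 g3; have M0 := M_gt0 g3.
move=> sm sp; exists (eB (Rgt (M g))); first by apply: vertices_eB.
have h1 := near_right g3 sm (leqnn (M g)).
have h2 := @near_top' R g g3 sm (N g).+1 ltac:(lia).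
have gN : (g - M g = (N g).+1)%N by lia.
rewrite gN in h1; apply: (segment_close sp); last first.
  by apply: le_trans h1 _; rewrite ler_wpM2r ?alpha_exp_ge0//; lra.
apply: le_trans (enorm_tri (1 - 2 * 2 ^- (N g).+1, 1) _ _) _.
have hN : 2 ^- (N g).+1 <= eps g by apply: le_trans (half_le MN) _; exact: alpha_exp_half.
have hM : 2 ^- (M g).+1 <= eps g by apply: le_trans (half_le (leqnSn _)) _; exact: alpha_exp_half.
have hN0 := half_gt0 (R:=R) (N g).+1; have hM0 := half_gt0 (R:=R) (M g).+1.
have h3 := enorm_le12 (eB (Rgt (M g)) - (1 - 2 * 2 ^- (N g).+1, 1) : R * R).
have h4 : `|(eB (Rgt (M g)) - (1 - 2 * 2 ^- (N g).+1, 1) : R * R).1| <= 2 * eps g.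
  by rewrite /eB /onside /= ger0_norm; lra.
have h5 : `|(eB (Rgt (M g)) - (1 - 2 * 2 ^- (N g).+1, 1) : R * R).2| <= eps g.
  by rewrite /eB /onside /= ler0_norm; lra.
rewrite /near in h2; lra.
Qed.

(** The partner of the previous edge joins the last two vertices of the zigzag, both close to the
    accumulation point of the left side at height 2/3 and hence to each other. *)
Lemma last_attached_edge g (g3 : (3 <= g)%N) p : eps g <= 50^-1 -> (1 < M g)%N ->
  segment (@W R g (M g)) (@W R g (M g).-1) p -> exists2 z, vertices z & enorm (p - z) <= 25 * eps g.
Proof.
move=> sm M1 sp; have [k Mk] : exists k, M g = k.+1 by exists (M g).-1; lia.
have zE : eB (Lft (M g)) = (0, left_y (M g)) :> R * R.
  rewrite /eB /onside left_yE /= sE halfS; congr (_, _).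
  by case: (odd (M g)); rewrite /= ?expr0 ?expr1; lra.
exists (0, left_y (M g)); first by rewrite -zE; apply: vertices_eB; exact: ltnW.
have h1 := near_left g3 sm (leqnn (M g)); have h2 := near_left g3 sm (leq_pred (M g)).
have e0 := alpha_exp_ge0 (R:=R) g3 (M g).
apply: (segment_close sp); first by apply: le_trans h1 _; lra.
apply: le_trans (enorm_tri (0, left_y (M g).-1) _ _) _.
have h3 := enorm_le12 ((0, left_y (M g)) - (0, left_y (M g).-1) : R * R).
have hM : 2 ^- (M g) <= eps g by exact: alpha_exp_half.
have hM0 := half_gt0 (R:=R) (M g).
have h4 : `|((0, left_y (M g)) - (0, left_y (M g).-1) : R * R).2| <= eps g.
  move: (eps g) hM hM0 => z; rewrite /= !left_yE Mk (halfS k) ler_norml /=.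
  by case: (odd k); rewrite /= ?expr0 ?expr1 => *; apply/andP; split; lra.
rewrite /= subrr normr0 in h3; rewrite /near in h2; lra.
Qed.

(** D is the distance in X_oo, I that of the images, J that of the displays, h = alpha^M; the values
    v, w, u are those of [smooth], [flattened] and [potential]. The losses are 9s at each end, 0.48s
    from the slope and 804h, below 20s <= d in total. *)
Lemma lower_arith (D I J L s d h vq vq' wp wp' up up' : R) : 0 < s -> s <= 8^-1 -> s <= d / 20 ->
  0 <= h -> 8000 * h <= s -> 1 <= L -> L - 1 <= 8 / 100 * s -> vq' - vq <= L * J ->
  J <= 402 * h + I + 402 * h -> I <= D + 1 -> D <= 4 -> `|vq - wp| <= 7 * s -> `|vq' - wp'| <= 7 * s ->
  `|wp - up| <= 2 * s -> `|wp' - up'| <= 2 * s -> up <= 0 -> up' = D -> D <= I + d.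
Proof.
move=> s0 s1 sd h0 hs L1 Ls k1 k2 k3 k4 c1 c2 c3 c4 u1 u2.
have J6 : J <= 6 by clear -hs s1 h0 k2 k3 k4; lra.
have kJ : (L - 1) * J <= 8 / 100 * s * 6.
  apply: (@le_trans _ _ ((L - 1) * 6)); first by rewrite ler_wpM2l// subr_ge0.
  by rewrite ler_wpM2r// ler0n.
move: c1 c2 c3 c4; rewrite !ler_norml u2 => /andP[a1 a2] /andP[b1 b2] /andP[c1 c2] /andP[d1 d2].
have v1 : vq <= 9 * s by clear -a2 c2 u1; lra.
have v2 : D - 9 * s <= vq' by clear -b1 d1; lra.
by clear -s0 sd h0 hs k1 k2 kJ v1 v2; lra.
Qed.

Lemma iota_lower_uniform d : 0 < d -> exists G, forall g (g3 : (3 <= g)%N) (lam : R),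
  0 < lam < 1 -> (G <= g)%N -> forall x y : Xoo R,
  flat_dist x y <= flat_dist (iota_g g3 lam x) (iota_g g3 lam y) + d.
Proof.
move=> d0; pose s := Num.min 8^-1 (d / 20).
have s0 : 0 < s by rewrite lt_min; apply/andP; split; lra.
have s1 : s <= 8^-1 by rewrite ge_min lexx.
have s2 : s <= d / 20 by rewrite ge_min lexx orbT.
clearbody s.
(* Makes the excess 80 alpha^M / s of the slope over 1 at most 0.08 s. *)
have e0 : 0 < s * s / 1000 by rewrite divr_gt0 ?mulr_gt0 ?ltr0n.
(* The upper bound with error 1 keeps the distance of the images bounded, so that the factor [slope]
   amounts to an additive error. *)
have [G1 H1] := alpha_cvg e0; have [G2 H2] := @iota_upper_uniform R 1 ltr01.
exists (maxn G1 G2) => g g3 lam l01; rewrite geq_max => /andP[h1 h2] x y.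
have ee := H1 g g3 h1; have eg0 := alpha_exp_ge0 (R:=R) g3 (M g).
have ss : s * s <= 8^-1 * s by rewrite ler_wpM2r// ltW.
have es : 8000 * eps g <= s by clear -ee ss; lra.
have sm : eps g <= 50^-1 by clear -es s1; lra.
have M1 : (1 < M g)%N.
  rewrite ltnNge; apply/negP => M1; have := alpha_exp_le (R:=R) g3 M1; rewrite expr1.
  by have := alpha_gt12 (R:=R) g3; clear -sm => a12 a_le; lra.
have es' : 80 * eps g <= s by clear -es eg0; lra.
pose sg := cluster_value x; pose w := flattened x s.
have wL := flattened_nonexpanding x s0; have wI := flattened_invariant x s.
have wS := @flattened_cluster x s.
pose v := smooth g s w.
have vL := smooth_lip g3 sm s0 s1 es' wL wS.
have vC := smooth_cross g3 sm s0 s1 es' wL wI wS.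
have vZ b p z : vertices z -> enorm (p - z) <= 25 * eps g -> v b p = sg.
  move=> vz hz; rewrite /v /sg; apply: (smooth_vertex g3 sm s0 s1 es' wL wS _ vz).
  by apply: le_trans hz _; clear -es' eg0; lra.
have vP b p : segment (P R g (N g).+1) (Q R g (N g).+1) p -> v b p = sg.
  by move=> /(cut_edge g3 sm)[z vz hz]; exact: vZ vz hz.
have vW b p : segment (@W R g (M g)) (@W R g (M g).-1) p -> v b p = sg.
  by move=> /(last_attached_edge g3 sm M1)[z vz hz]; exact: vZ vz hz.
have L0 := slope_ge0 g3 s0 s1 es'.
have [b [p [Ep Dp xE xcl]]] := Xoo_chart x; have [b' [p' [Ep' Dp' yE ycl]]] := Xoo_chart y.
have [pl [q [vp tq hq dE]]] := displayP g3 sm l01 b Ep.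
have [pl' [q' [vp' tq' hq' dE']]] := displayP g3 sm l01 b' Ep'.
have k1 := lipschitz_clp g3 M1 L0 vL vC vP vW b b' vp vp' tq tq'; rewrite -dE -dE' in k1.
have i1 := @iota_display R g g3 sm lam l01 x b p xE Ep.
have i2 := @iota_display R g g3 sm lam l01 y b' p' yE Ep'.
rewrite flat_distC in i1.
have k2 := flat_dist4 (@X_connected R g g3) i1 (lexx (flat_dist (iota_g g3 lam x) (iota_g g3 lam y))) i2.
have k3 := H2 g g3 lam l01 h2 x y; have k4 := Xoo_diam x y.
have c1 := smooth_close g3 sm s0 s1 es' wL wS b Ep hq.
have c2 := smooth_close g3 sm s0 s1 es' wL wS b' Ep' hq'.
have c3 := flattened_close x s0 b p; have c4 := flattened_close x s0 b' p'.
have u1 : potential x b p <= 0 by rewrite potentialE// -xcl; exact: flat_dist_xx.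
have u2 : potential x b' p' = flat_dist x y by rewrite potentialE// -ycl.
have kE : slope g s - 1 <= 8 / 100 * s.
  rewrite /slope addrC addKr ler_pdivrMr//.
  by move: (eps g) ee => z; clear; lra.
have /andP[L1 _] := slope_bounds g3 s0 s1 es'.
exact: (lower_arith s0 s1 s2 eg0 es L1 kE k1 k2 k3 k4 c1 c2 c3 c4 u1 u2).
Qed.

End Lower.

Theorem theorem3p3 (R : realType) (lam : nat -> R)
    (lam01 : forall g : nat, (3 <= g)%N -> 0 < lam g < 1)
    (K : set (Xoo R)) (cK : compact K) (eps : R) (eps_gt0 : 0 < eps) :
  exists G : nat, forall (g : nat) (g_ge3 : (3 <= g)%N), (G <= g)%N ->
    K `<=` U g /\
    forall x y : Xoo R, K x -> K y ->
      `| pullback_dist (iota_g g_ge3 (lam g)) x y - flat_dist x y | < eps.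
Proof.
have [G0 H0] := compact_in_U cK.
have d0 : 0 < eps / 2 by rewrite divr_gt0.
have [G1 H1] := iota_upper_uniform d0; have [G2 H2] := iota_lower_uniform d0.
exists (maxn G0 (maxn G1 G2)) => g g3; rewrite !geq_max => /and3P[h0 h1 h2].
split; first exact: H0.
move=> x y _ _; rewrite /pullback_dist.
have := H1 g g3 (lam g) (lam01 g g3) h1 x y; have := H2 g g3 (lam g) (lam01 g g3) h2 x y.
move: (flat_dist (iota_g _ _ _) _) (flat_dist x y) => u v l1 l2.
by rewrite ltr_norml; apply/andP; split; lra.
Qed.
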